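(* Let $(\widetilde{\mathfrak g},H_0)$ be a simple regular graded Lie algebra over $F$, let $(I^-,H_0,I^+)$ be a diagonal $\mathfrak{sl}_2$-triple and let $\sigma$ be the associated involution. Then the subalgebra $$\mathfrak p=\mathfrak z_{\mathfrak g}(\mathfrak a^0)\oplus\Big(\bigoplus_{0\le i<j\le k}E_{i,j}(1,-1)\Big)$$ is a minimal $\sigma$-split parabolic subalgebra of $\mathfrak g$. Its Langlands decomposition is $\mathfrak p=\mathfrak l+\mathfrak n=\mathfrak m_1\oplus\mathfrak a_{\mathfrak p}\oplus\mathfrak n$, where $\mathfrak n=\bigoplus_{0\le i<j\le k}E_{i,j}(1,-1)$, $\mathfrak l=\mathfrak m_1\oplus\mathfrak a_{\mathfrak p}=\mathfrak z_{\mathfrak g}(\mathfrak a^0)$, $\mathfrak a_{\mathfrak p}=\{H\in\mathfrak a: \text{for all }\lambda\in\Sigma,\ \lambda(\mathfrak a^0)=0\Rightarrow\lambda(H)=0\}$, and $\mathfrak m_1$ is the orthogonal of $\mathfrak a_{\mathfrak p}$ in $\mathfrak z_{\mathfrak g}(\mathfrak a^0)$ for the Killing form of $\widetilde{\mathfrak g}$.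
   Context: Setting. $F$ is a finite extension of $\mathbb Q_p$ whose residue field has characteristic $\neq 2$; $\overline F$ is an algebraic closure and $\overline U=U\otimes_F\overline F$. A regular graded Lie algebra is a reductive Lie algebra $\widetilde{\mathfrak g}$ over $F$ with an element $H_0$ such that (H1) $\widetilde{\mathfrak g}=V^-\oplus\mathfrak g\oplus V^+$ with $V^+\ne 0$, where $V^-,\mathfrak g,V^+$ are the eigenspaces of $\operatorname{ad}H_0$ for $-2,0,2$; (H2) the bracket representation of $\mathfrak g$ on $\overline{V^+}$ is irreducible; (H3) there are elements of $V^-$ and $V^+$ forming with $H_0$ an $\mathfrak{sl}_2$-triple. Convention: $(Y,H,X)$ is an $\mathfrak{sl}_2$-triple if $[H,X]=2X$, $[H,Y]=-2Y$, $[Y,X]=H$. Roots and descent. $\mathfrak a$ is a maximal split abelian subalgebra of $\mathfrak g$ containing $H_0$; $\widetilde\Sigma,\Sigma$ are the root systems of $(\widetilde{\mathfrak g},\mathfrak a)$ and $(\mathfrak g,\mathfrak a)$, $\widetilde{\mathfrak g}^\lambda$ the root spaces, $H_\lambda\in\mathfrak a$ the coroot of $\lambda$. Fix a basis $\widetilde\Pi$ of $\widetilde\Sigma$ with $\nu(H_0)\in\{0,2\}$ for all $\nu\in\widetilde\Pi$; exactly one simple root, $\lambda_0$, satisfies $\lambda_0(H_0)=2$. Inductively, $\lambda_j$ is the unique simple root with $\lambda_j(H_0)=2$ of the system $\widetilde\Sigma_j$ of roots of $\widetilde\Sigma$ strongly orthogonal to $\lambda_0,\dots,\lambda_{j-1}$,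 ordered by $\widetilde\Sigma^+\cap\widetilde\Sigma_j$; the process stops at $\lambda_k$, when no root $\lambda$ with $\lambda(H_0)=2$ is strongly orthogonal to $\lambda_0,\dots,\lambda_k$. $\mathfrak a^0=\bigoplus_{j=0}^kFH_{\lambda_j}$; $E_{i,j}(p,q)=\{X\in\widetilde{\mathfrak g}:[H_{\lambda_i},X]=pX,[H_{\lambda_j},X]=qX,[H_{\lambda_s},X]=0\ (s\ne i,j)\}$. An $\mathfrak{sl}_2$-triple $(I^-,H_0,I^+)$ is diagonal if $I^+=X_0+\dots+X_k$, $I^-=Y_0+\dots+Y_k$ with $X_j\in\widetilde{\mathfrak g}^{\lambda_j}\setminus\{0\}$, $Y_j\in\widetilde{\mathfrak g}^{-\lambda_j}\setminus\{0\}$ and each $(Y_j,H_{\lambda_j},X_j)$ an $\mathfrak{sl}_2$-triple. The associated involution of $\widetilde{\mathfrak g}$ is $\sigma=e^{\operatorname{ad}I^+}e^{\operatorname{ad}I^-}e^{\operatorname{ad}I^+}$; it stabilizes $\mathfrak g$. A parabolic subalgebra $\mathfrak r$ of $\mathfrak g$ is $\sigma$-split if $\sigma(\mathfrak r)$ is a parabolic subalgebra opposite to $\mathfrak r$ (so $\mathfrak r\cap\sigma(\mathfrak r)$ is a common Levi component); ''minimal'' means minimal among $\sigma$-split parabolic subalgebras. *)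

(* Defs.v *)
From HB Require Import structures.
From mathcomp Require Import all_boot all_order all_algebra all_field.
Set Implicit Arguments.
Unset Strict Implicit.
Unset Printing Implicit Defensive.
Import Order.TTheory GRing.Theory Num.Theory.
Local Open Scope ring_scope.

Definition padic_norm (p : nat) (q : rat) : rat :=
  if q == 0 then 0
  else (p%:R : rat) ^ ((logn p `|denq q|%N)%:Z - (logn p `|numq q|%N)%:Z).

(* [is_padic_field p v]: [Qp], with the absolute value [v], is the completion
   of the rationals for the p-adic absolute value. The values of [v] are 0 and
   powers of p, so they can be taken in [rat]. Since [ratr] is a junk embedding
   in positive characteristic, note that [pa_rat] and [pa_eq0] force
   characteristic 0. *)
Record is_padic_field (p : nat) (Qp : fieldType) (v : Qp -> rat) : Prop := {
  pa_prime : prime p;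
  pa_ge0 : forall x, 0 <= v x;
  pa_eq0 : forall x, (v x == 0) = (x == 0);
  pa_mul : forall x y, v (x * y) = v x * v y;
  pa_ultra : forall x y, v (x + y) <= Num.max (v x) (v y);
  pa_rat : forall q : rat, v (ratr q) = padic_norm p q;
  pa_dense : forall x (e : rat), 0 < e -> exists q : rat, v (x - ratr q) < e;
  pa_complete : forall u : nat -> Qp,
    (forall e : rat, 0 < e -> exists N, forall m n,
       (N <= m)%N -> (N <= n)%N -> v (u m - u n) < e) ->
    exists l, forall e : rat, 0 < e -> exists N, forall n,
       (N <= n)%N -> v (u n - l) < e
}.

(* The ring of integers of a finite extension [F] of [Qp] is the integral
   closure in [F] of the valuation ring of [Qp]. *)
Definition integers (Qp : fieldType) (v : Qp -> rat) (F : fieldExtType Qp)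
    (x : F) : Prop :=
  exists2 P : {poly Qp}, P \is monic /\ (forall i, v P`_i <= 1)
    & root (map_poly (in_alg F) P) x.

Definition maximal_ideal (Qp : fieldType) (v : Qp -> rat)
    (F : fieldExtType Qp) (x : F) : Prop :=
  integers v x /\ (x = 0 \/ ~ integers v x^-1).

Definition residue_char (Qp : fieldType) (v : Qp -> rat)
    (F : fieldExtType Qp) (l : nat) : Prop :=
  prime l /\ maximal_ideal v (l%:R : F).

Definition is_algebraic_closure (F : fieldType) (Fbar : closedFieldType)
    (iota : {rmorphism F -> Fbar}) : Prop :=
  forall z : Fbar, algebraicOver iota z.

HB.mixin Record Vector_isLie (K : fieldType) L of Vector K L := {
  lie_br : L -> L -> L;
  lie_linearl : forall z, linear (lie_br^~ z);
  lie_linearr : forall z, linear (lie_br z);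
  lie_brxx : forall x, lie_br x x = 0;
  lie_jacobi : forall x y z,
    lie_br x (lie_br y z) + lie_br y (lie_br z x) + lie_br z (lie_br x y) = 0
}.

#[short(type="lieType")]
HB.structure Definition Lie (K : fieldType) :=
  {L of Vector_isLie K L & Vector K L}.

Notation "[lie x , y ]" := (lie_br x y)
  (at level 0, x, y at level 99, format "[lie  x ,  y ]") : ring_scope.

Section LieAlgebra.
Variables (K : fieldType) (L : lieType K).
Implicit Types (x y h : L) (U V I : {vspace L}).

HB.instance Definition _ x := GRing.isLinear.Build K L L _ _ (lie_linearr x).

Definition ad x : 'End(L) := linfun (lie_br x).

Lemma adE x y : ad x y = [lie x, y].
Proof. by rewrite lfunE. Qed.

Definition brv U V : {vspace L} :=
  <<[seq [lie x, y] | x <- vbasis U, y <- vbasis V]>>%VS.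

Definition is_subalgebra U := (brv U U <= U)%VS.
Definition is_ideal I U := ((I <= U) && (brv U I <= I))%VS.
Definition derived n U := iter n (fun V => brv V V) U.
Definition solvable_lie U := exists n, derived n U = 0%VS.
Definition abelian_lie U := (brv U U == 0)%VS.

Definition centralizer U V : {vspace L} :=
  (U :&: \bigcap_(i < \dim V) lker (ad (vbasis V)`_i))%VS.
Definition center U := centralizer U U.

Definition simple_lie : Prop :=
  ~~ abelian_lie fullv /\
  forall I, is_ideal I fullv -> I = 0%VS \/ I = fullv.

(* The adjoint representation is semisimple. *)
Definition reductive_lie U : Prop :=
  forall I, is_ideal I U ->
    exists J : {vspace L},
      [/\ is_ideal J U, (I + J)%VS = U & (I :&: J)%VS = 0%VS].

Definition is_radical (R U : {vspace L}) : Prop :=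
  [/\ is_ideal R U, solvable_lie R
    & forall I, is_ideal I U -> solvable_lie I -> (I <= R)%VS].

(* Nilpotent radical (common kernel of the irreducible finite-dimensional
   representations), which in characteristic 0 is [U, U] :&: rad U; unlike the
   largest nilpotent ideal, it does not contain the center of a reductive
   algebra. *)
Definition is_nilpotent_radical (N U : {vspace L}) : Prop :=
  exists2 R, is_radical R U & N = (brv U U :&: R)%VS.

Definition lmx (f : 'End(L)) : 'M[K]_(\dim {:L}) :=
  passmx.mxof (vbasis {:L}) (vbasis {:L}) f.

Definition killing x y : K := \tr (lmx (ad x \o ad y)%VF).

(* Ad-diagonalizability over the base field, in the whole algebra [L]. *)
Definition split_abelian U : Prop :=
  abelian_lie U /\ forall h, h \in U -> diagonalizable (lmx (ad h)).

(* The exponential of ad x for ad-nilpotent x: then (ad x)^n = 0 for all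
   n >= dim L, so the sum below is the whole series. *)
Definition exp_ad x : 'End(L) :=
  \sum_(n < (\dim {:L}).+1)
     (n`!%:R)^-1 *: iter n (fun f : 'End(L) => (ad x \o f)%VF) \1%VF.

(* Beware of the order (Y, H, X) and of the sign [Y, X] = H. *)
Definition sl2_triple y h x : Prop :=
  [/\ [lie h, x] = x *+ 2, [lie h, y] = - (y *+ 2) & [lie y, x] = h].

(* [A] is the largest split abelian subalgebra in the center of [U]. *)
Definition is_split_component (A U : {vspace L}) : Prop :=
  [/\ (A <= center U)%VS, split_abelian A
    & forall A' : {vspace L},
        (A' <= center U)%VS -> split_abelian A' -> (A' <= A)%VS].

End LieAlgebra.

(* [L] tensored with [K], in the coordinates of the basis [vbasis {:L}]. *)
Definition lie_ext (F K : fieldType) (iota : {rmorphism F -> K})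
  (L : lieType F) : Type := 'rV[K]_(\dim {:L}).

Section BaseChange.
Variables (F K : fieldType) (iota : {rmorphism F -> K}) (L : lieType F).
Local Notation n := (\dim {:L}).
Local Notation b := (vbasis {:L}).
Local Notation LK := (lie_ext iota L).

HB.instance Definition _ := Vector.copy LK 'rV[K]_n.

(* x |-> x (x) 1 *)
Definition ext_elt (x : L) : LK := map_mx iota (passmx.rVof b x).

Definition ext_br (u w : LK) : LK :=
  \sum_(i < n) \sum_(j < n)
     ((u : 'rV_n) 0 i * (w : 'rV_n) 0 j) *: ext_elt [lie b`_i, b`_j].

Lemma ext_eltE x i : (ext_elt x : 'rV_n) 0 i = iota (coord b i x).
Proof. by rewrite !mxE. Qed.

Lemma ext_eltD x y : ext_elt (x + y) = ext_elt x + ext_elt y.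
Proof. by apply/rowP => i; rewrite ext_eltE [RHS]mxE ?ext_eltE linearD rmorphD. Qed.

Lemma ext_elt0 : ext_elt 0 = 0.
Proof. by apply/rowP => i; rewrite ext_eltE [RHS]mxE ?ext_eltE linear0 rmorph0. Qed.

Lemma ext_eltZ c x : ext_elt (c *: x) = iota c *: ext_elt x.
Proof. by apply/rowP => i; rewrite ext_eltE [RHS]mxE ?ext_eltE linearZ rmorphM. Qed.

Lemma ext_eltN x : ext_elt (- x) = - ext_elt x.
Proof. by rewrite -scaleN1r ext_eltZ rmorphN1 scaleN1r. Qed.

Lemma ext_br_linearl w : linear (ext_br^~ w).
Proof.
move=> c u u'; rewrite /ext_br scaler_sumr -big_split; apply: eq_bigr => i _ /=.
rewrite scaler_sumr -big_split; apply: eq_bigr => j _ /=.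
by rewrite !mxE mulrDl scalerDl scalerA mulrA.
Qed.

Lemma ext_br_linearr u : linear (ext_br u).
Proof.
move=> c w w'; rewrite /ext_br scaler_sumr -big_split; apply: eq_bigr => i _ /=.
rewrite scaler_sumr -big_split; apply: eq_bigr => j _ /=.
by rewrite !mxE mulrDr scalerDl scalerA mulrCA.
Qed.

Lemma ext_brDl u u' w : ext_br (u + u') w = ext_br u w + ext_br u' w.
Proof. by have := ext_br_linearl w 1 u u'; rewrite !scale1r. Qed.

Lemma ext_brDr u w w' : ext_br u (w + w') = ext_br u w + ext_br u w'.
Proof. by have := ext_br_linearr u 1 w w'; rewrite !scale1r. Qed.

Lemma ext_br0l w : ext_br 0 w = 0.
Proof. by apply: (addIr (ext_br 0 w)); rewrite -ext_brDl !add0r. Qed.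

Lemma ext_br0r u : ext_br u 0 = 0.
Proof. by apply: (addIr (ext_br u 0)); rewrite -ext_brDr !add0r. Qed.

Lemma ext_brZl c u w : ext_br (c *: u) w = c *: ext_br u w.
Proof. by have := ext_br_linearl w c u 0; rewrite ext_br0l !addr0. Qed.

Lemma ext_brZr c u w : ext_br u (c *: w) = c *: ext_br u w.
Proof. by have := ext_br_linearr u c w 0; rewrite ext_br0r !addr0. Qed.

Lemma ext_eltb (i j : 'I_n) : (ext_elt b`_i : 'rV_n) 0 j = (j == i)%:R.
Proof.
rewrite ext_eltE coord_free ?(basis_free (vbasisP _)) //.
by rewrite rmorph_nat eq_sym.
Qed.

Lemma ext_sum (u : LK) : u = \sum_(i < n) (u : 'rV_n) 0 i *: ext_elt b`_i.
Proof.
apply/rowP => j; rewrite summxE (bigD1 j) //= big1 => [|i ij].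
  by rewrite [X in _ = X + _]mxE ext_eltb eqxx mulr1 addr0.
by rewrite mxE ext_eltb eq_sym (negPf ij) mulr0.
Qed.

Lemma ext_ind (P : LK -> Prop) :
    P 0 -> (forall u w, P u -> P w -> P (u + w)) ->
    (forall c u, P u -> P (c *: u)) -> (forall i : 'I_n, P (ext_elt b`_i)) ->
  forall u, P u.
Proof.
by move=> P0 PD PZ Pb u; rewrite (ext_sum u); elim/big_ind: _ => // i _; apply/PZ.
Qed.

Lemma ext_brb (i j : 'I_n) :
  ext_br (ext_elt b`_i) (ext_elt b`_j) = ext_elt [lie b`_i, b`_j].
Proof.
rewrite /ext_br (bigD1 i) //= [X in _ + X]big1 => [|i' ne]; last first.
  by apply: big1 => j' _; rewrite ext_eltb (negPf ne) mul0r scale0r.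
rewrite (bigD1 j) //= big1 => [|j' ne]; last first.
  by rewrite (ext_eltb j) (negPf ne) mulr0 scale0r.
by rewrite !ext_eltb !eqxx mul1r scale1r !addr0.
Qed.

Lemma ext_brE (i : 'I_n) x :
  ext_br (ext_elt b`_i) (ext_elt x) = ext_elt [lie b`_i, x].
Proof.
have add_elt := big_morph _ ext_eltD ext_elt0.
have add_br u := big_morph _ (ext_brDr u) (ext_br0r u).
rewrite (coord_basis (vbasisP {:L}) (memvf x)) linear_sum !add_elt add_br.
by apply: eq_bigr => j _; rewrite linearZ !ext_eltZ ext_brZr ext_brb.
Qed.

Lemma lie_brC x y : [lie x, y] = - [lie y, x] :> L.
Proof.
have brDl u u' w : [lie u + u', w] = [lie u, w] + [lie u', w] :> L.
  by have := lie_linearl w 1 u u'; rewrite !scale1r.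
have /eqP := lie_brxx (x + y).
by rewrite brDl !linearD /= !lie_brxx add0r addr0 addr_eq0 => /eqP.
Qed.

Lemma ext_brC u w : ext_br u w = - ext_br w u.
Proof.
rewrite /ext_br exchange_big -sumrN; apply: eq_bigr => j _ /=.
rewrite -sumrN; apply: eq_bigr => i _ /=.
by rewrite lie_brC ext_eltN scalerN mulrC.
Qed.

Lemma ext_brxx u : ext_br u u = 0.
Proof.
elim/ext_ind: u => [|u w Hu Hw|c u Hu|i].
- exact: ext_br0l.
- by rewrite ext_brDl !ext_brDr Hu Hw add0r addr0 (ext_brC u) addNr.
- by rewrite ext_brZl ext_brZr Hu !scaler0.
by rewrite ext_brb lie_brxx ext_elt0.
Qed.

Lemma ext_jacobi u w z :
  ext_br u (ext_br w z) + ext_br w (ext_br z u) + ext_br z (ext_br u w) = 0.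
Proof.
pose jac u w z :=
  ext_br u (ext_br w z) + ext_br w (ext_br z u) + ext_br z (ext_br u w).
have jacC u' w' z' : jac u' w' z' = jac w' z' u'.
  by rewrite /jac -addrA addrC.
have jac0 w' z' : jac 0 w' z' = 0.
  by rewrite /jac ext_br0l ext_br0r !ext_br0l !ext_br0r !addr0.
have jacD u1 u2 w' z' : jac u1 w' z' = 0 -> jac u2 w' z' = 0 ->
    jac (u1 + u2) w' z' = 0.
  have -> : jac (u1 + u2) w' z' = jac u1 w' z' + jac u2 w' z'.
    rewrite /jac !(ext_brDl, ext_brDr) [RHS]addrACA; congr (_ + _).
    exact: addrACA.
  by move=> -> ->; rewrite addr0.
have jacZ c u' w' z' : jac u' w' z' = 0 -> jac (c *: u') w' z' = 0.
  move=> E; rewrite -(scaler0 _ c) -E /jac.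
  by rewrite !(ext_brZl, ext_brZr) -!scalerDr.
rewrite -/(jac u w z); elim/ext_ind: u => // [u u'|c u|i]; rewrite ?jac0;
  [exact: jacD | exact: jacZ |].
rewrite jacC; elim/ext_ind: w => // [w w'|c w|j];
  [exact: jacD | exact: jacZ |].
rewrite jacC; elim/ext_ind: z => // [z z'|c z|k];
  [exact: jacD | exact: jacZ |].
by rewrite /jac !ext_brb !ext_brE -!ext_eltD lie_jacobi ext_elt0.
Qed.

HB.instance Definition _ := Vector_isLie.Build K LK
  ext_br_linearl ext_br_linearr ext_brxx ext_jacobi.

Definition ext_sub (U : {vspace L}) : {vspace LK} :=
  <<[seq ext_elt x | x <- vbasis U]>>%VS.

End BaseChange.

Definition is_borel (K : fieldType) (L : lieType K) (B G : {vspace L}) : Prop :=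
  [/\ (B <= G)%VS, is_subalgebra B, solvable_lie B
    & forall B' : {vspace L}, (B' <= G)%VS -> is_subalgebra B' ->
        solvable_lie B' -> (B <= B')%VS -> B' = B].

Section Parabolic.
Variables (F : fieldType) (Fbar : closedFieldType).
Variables (iota : {rmorphism F -> Fbar}) (L : lieType F).
Implicit Types (g r l m A n : {vspace L}) (s : 'End(L)).

(* After extension to the algebraic closure, [r] contains a Borel (i.e. maximal
   solvable) subalgebra of [g]. *)
Definition is_parabolic g r : Prop :=
  [/\ (r <= g)%VS, is_subalgebra r
    & exists2 B, is_borel B (ext_sub iota g) & (B <= ext_sub iota r)%VS].

Definition is_levi l r : Prop :=
  [/\ is_subalgebra l, reductive_lie l
    & exists2 n, is_nilpotent_radical n r
        & (l + n)%VS = r /\ (l :&: n)%VS = 0%VS].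

Definition opposite r r' : Prop :=
  is_levi (r :&: r')%VS r /\ is_levi (r :&: r')%VS r'.

Definition sigma_split s g r : Prop :=
  [/\ is_parabolic g r, is_parabolic g (s @: r)%VS & opposite r (s @: r)%VS].

Definition minimal_sigma_split s g r : Prop :=
  sigma_split s g r /\
  forall r' : {vspace L}, sigma_split s g r' -> (r' <= r)%VS -> r' = r.

(* r = l + n = m + A + n, with [n] the nilpotent radical of [r], [l] a Levi
   component, [A] the split component of [l], and [m] the orthogonal of [A]
   in [l] for the Killing form of [L]. *)
Record langlands_decomposition r l m A n : Prop := {
  ld_nil : is_nilpotent_radical n r;
  ld_levi : is_levi l r;
  ld_r : r = (l + n)%VS;
  ld_split : is_split_component A l;
  ld_m : forall x : L,
    x \in m <-> x \in l /\ (forall h, h \in A -> killing x h = 0);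
  ld_l : l = (m + A)%VS;
  ld_direct : directv (m + A + n)
}.

End Parabolic.

Section Graded.
Variables (F : fieldType) (Fbar : closedFieldType).
Variables (iota : {rmorphism F -> Fbar}) (L : lieType F) (H0 : L).

Definition grade (c : F) : {vspace L} := passmx.leigenspace (ad H0) c.

Definition irreducible_on (g V : {vspace L}) : Prop :=
  V != 0%VS /\
  forall W : {vspace lie_ext iota L}, (W <= ext_sub iota V)%VS ->
    (brv (ext_sub iota g) W <= W)%VS -> W = 0%VS \/ W = ext_sub iota V.

Record regular_graded : Prop := {
  rg_reductive : reductive_lie {:L};
  rg_sum : (grade (- 2) + grade 0 + grade 2)%VS = fullv;
  rg_direct : directv (grade (- 2) + grade 0 + grade 2);
  rg_neq0 : grade 2 != 0%VS;
  rg_irr : irreducible_on (grade 0) (grade 2);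
  rg_sl2 : exists y x, [/\ y \in grade (- 2), x \in grade 2
                         & sl2_triple y H0 x]
}.

Record maximal_split_abelian (a : {vspace L}) : Prop := {
  ms_sub : (a <= grade 0)%VS;
  ms_H0 : H0 \in a;
  ms_split : split_abelian a;
  ms_max : forall a' : {vspace L}, (a' <= grade 0)%VS -> split_abelian a' ->
    (a <= a')%VS -> a' = a
}.

End Graded.

Section Roots.
Variables (F : fieldType) (L : lieType F) (a : {vspace L}).

Definition dual := 'Hom(subvs_of a, F^o).
Implicit Types (lam mu : dual) (h : L).

(* Meaningful only for h in a. *)
Definition ev lam h : F := lam (vsproj a h).

Definition root_space lam : {vspace L} :=
  (\bigcap_(i < \dim a)
     passmx.leigenspace (ad (vbasis a)`_i) (ev lam (vbasis a)`_i))%VS.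

(* Roots of (U, a). *)
Definition is_root (U : {vspace L}) lam : bool :=
  (lam != 0) && (root_space lam :&: U != 0)%VS.

Local Notation root := (is_root fullv).

(* The coroot in the sense of abstract root systems; it is unique as soon as
   the roots span the dual of [a], e.g. when [L] is semisimple. *)
Definition is_coroot lam h : Prop :=
  [/\ h \in a, ev lam h = 2
    & forall mu, root mu ->
        (exists z : int, ev mu h = z%:~R) /\ root (mu - ev mu h *: lam)].

Definition nat_comb (Pi : seq dual) lam : Prop :=
  exists c : 'I_(size Pi) -> nat, lam = \sum_(i < size Pi) Pi`_i *+ c i.

Definition is_base (Pi : seq dual) : Prop :=
  [/\ free Pi, (forall mu, mu \in Pi -> root mu)
    & forall mu, root mu -> nat_comb Pi mu \/ nat_comb Pi (- mu)].

Definition positive (Pi : seq dual) lam : Prop := root lam /\ nat_comb Pi lam.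

Definition strongly_orthogonal lam mu : Prop :=
  [/\ lam + mu != 0, lam - mu != 0, ~~ root (lam + mu)
    & ~~ root (lam - mu)].

(* Simple roots of the system [S], ordered by its positive roots [P]. *)
Definition simple_root (S P : dual -> Prop) lam : Prop :=
  [/\ S lam, P lam
    & forall mu nu, S mu -> P mu -> S nu -> P nu -> lam <> mu + nu].

Variables (H0 : L) (Pi : seq dual) (k : nat) (lam : 'I_k.+1 -> dual).

Definition descent_system (j : nat) (mu : dual) : Prop :=
  root mu /\ forall i : 'I_k.+1, (i < j)%N -> strongly_orthogonal mu (lam i).

Record descent : Prop := {
  ds_first : lam ord0 \in Pi;
  ds_simple : forall j : 'I_k.+1, (0 < j)%N ->
    simple_root (descent_system j) (positive Pi) (lam j);
  ds_two : forall j, ev (lam j) H0 = 2;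
  ds_stop : forall mu, descent_system k.+1 mu -> ev mu H0 <> 2
}.

Variable H : 'I_k.+1 -> L.

Definition a_zero : {vspace L} := (\sum_j <[H j]>)%VS.

Definition E_space (i j : 'I_k.+1) (p q : F) : {vspace L} :=
  (passmx.leigenspace (ad (H i)) p :&: passmx.leigenspace (ad (H j)) q :&:
   \bigcap_(s | (s != i) && (s != j)) passmx.leigenspace (ad (H s)) 0)%VS.

Definition diagonal_triple (Im Ip : L) : Prop :=
  sl2_triple Im H0 Ip /\
  exists X Y : 'I_k.+1 -> L,
    [/\ Ip = \sum_j X j, Im = \sum_j Y j
      & forall j, [/\ X j \in root_space (lam j), X j != 0,
                      Y j \in root_space (- lam j), Y j != 0
                    & sl2_triple (Y j) (H j) (X j)]].

End Roots.

Definition involution_of (F : fieldType) (L : lieType F) (Im Ip : L) : 'End(L) :=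
  (exp_ad Ip \o exp_ad Im \o exp_ad Ip)%VF.

(* Main.v *)
(* Let [h] be the combination of the [H j] with coefficients [k + 1 - j]. By
   sl_2-theory the weights of [a^0] on [g] are 0 and the differences [e_i - e_j], so
   [z_g(a^0)] is the null space [l] of [ad h] in [g], and the sum [n] of the
   [E_{i,j}(1,-1)] with [i < j] is the sum of the eigenspaces of [ad h] in [g] with
   positive eigenvalue. Over the algebraic closure a Borel subalgebra of [l] plus [n]
   is a Borel subalgebra of [g], so [p = l + n] is parabolic, and [sigma h = - h]
   shows that [sigma p] is opposite to [p].

   For the minimality, the descent forces the eigenspace where [H j] acts by 2 and
   the other [H i] by 0 to be the root space of [lam j]; hence the elements of [l]
   that [sigma] negates centralize [a]. By maximality of [a], and the first steps of
   the Jacobson-Morozov theorem, the centralizer of [a] contains no nonzero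
   ad-nilpotent element. A sigma-split parabolic contained in [p] is [q + n] with [q]
   containing a Borel subalgebra of [l]; its nilpotent radical in [l] is the
   orthogonal of [q], is fixed by [sigma], hence lies in the radical of the reductive
   algebra [q], and therefore vanishes. *)

From HB Require Import structures.
Require Import Defs.
From mathcomp Require Import all_boot all_order all_algebra all_field.
From mathcomp Require Import ring zify.
From Stdlib Require Import Classical.
Set Implicit Arguments.
Unset Strict Implicit.
Unset Printing Implicit Defensive.
Import Order.TTheory GRing.Theory Num.Theory passmx.
Local Open Scope ring_scope.

(** * Traces and polynomials of endomorphisms *)

(** The Killing form of [L] carries the structure theory. It is nondegenerate because [L] is simple
    and [killing H0 H0] is 4 times the rank of a nonzero projection; nondegeneracy passes to [g], to
    [l] and to suitable ideals, and yields reductivity, radicals and double orthogonals. Solvable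
    ideals are treated by traces of nilpotent maps, which works over any field of characteristic 0.
    The obstacle is that a sigma-split parabolic subalgebra is known only through some Borel
    subalgebra over the closure, of which no root decomposition is given. What is extracted from it
    is metric: the orthogonal of a Borel subalgebra consists of nilpotent elements of that
    subalgebra. The orthogonal of [q] is fixed by sigma because [l] is the sum of the ideal
    generated by the elements that sigma negates and of its orthogonal, where sigma is trivial. The
    first ideal centralizes [a]. A nonzero nilpotent there would have a neutral element whose
    semisimple part commutes with [a], hence lies in [a], and yet does not commute with the
    nilpotent. *)

Lemma horner_mx_sum (K : fieldType) n (A : 'M[K]_n.+1) (p : {poly K}) :
  horner_mx A p = \sum_(i < size p) p`_i *: A ^+ i.
Proof.
rewrite -{1}[p]coefK poly_def raddf_sum; apply: eq_bigr => i _ /=.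
by rewrite horner_mxZ rmorphXn /= horner_mx_X.
Qed.

Section MatrixTrace.
Variable K : fieldType.

(** With the rank factorization [A = C R], the powers of [A] are governed by the smaller matrix
    [R C]. This allows inductions that do not triangularize [A] over a larger field. *)
Lemma mulmx_base_comm n (A : 'M[K]_n) m :
  A ^+ m.+1 = col_base A *m (row_base A *m col_base A) ^+ m *m row_base A.
Proof.
elim: m => [|m IHm]; first by rewrite expr1 expr0 mulmx1 mulmx_base.
rewrite exprSr IHm (exprSr (row_base A *m col_base A) m).
rewrite -[X in _ * X = _](mulmx_base A).
by rewrite -[LHS]/(_ *m _) -[_ ^+ m * _]/(_ *m _) !mulmxA.
Qed.

Lemma row_base_can m n p (A : 'M[K]_(m, n)) (B C : 'M_(p, _)) :
  B *m row_base A = C *m row_base A -> B = C.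
Proof. by move/(row_free_inj (row_base_free A)). Qed.

Lemma col_base_can m n p (A : 'M[K]_(m, n)) (B C : 'M_(_, p)) :
  col_base A *m B = col_base A *m C -> B = C.
Proof.
move=> E; apply/trmx_inj.
have fr : row_free (col_base A)^T by rewrite /row_free mxrank_tr; exact: col_base_full.
by apply: (row_free_inj fr); rewrite -!trmx_mul E.
Qed.

Lemma mxtrace_base n (A : 'M[K]_n) m :
  \tr (A ^+ m.+1) = \tr ((row_base A *m col_base A) ^+ m.+1).
Proof. by rewrite mulmx_base_comm -mulmxA mxtrace_mulC -mulmxA exprSr. Qed.

(** Passing from [C R] to [R C] keeps the trace and lowers the nilpotency exponent by one, since [C]
    and [R] can be cancelled. *)
Lemma mxtrace_nilp n (A : 'M[K]_n) N : A ^+ N = 0 -> \tr A = 0.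
Proof.
elim: N n A => [|N IHN] n A.
  by rewrite expr0 => E; rewrite -(mulmx1 A) -[1%:M]/(1 : 'M_n) E mulmx0 mxtrace0.
rewrite mulmx_base_comm -(expr1 A) mxtrace_base expr1 => E.
apply: (IHN); apply: (@col_base_can _ _ _ A); rewrite mulmx0.
by apply: (@row_base_can _ _ _ A); rewrite E mul0mx.
Qed.

Lemma mxtrace_idem n (A : 'M[K]_n) : A *m A = A -> \tr A = (\rank A)%:R.
Proof.
move=> E; have F : row_base A *m col_base A = 1%:M.
  apply: (@col_base_can _ _ _ A); apply: (@row_base_can _ _ _ A).
  rewrite mulmx1 mulmx_base -mulmxA -[_ *m _ *m row_base A]mulmxA mulmx_base.
  by rewrite mulmxA mulmx_base.
by rewrite -{1}(mulmx_base A) mxtrace_mulC F mxtrace1.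
Qed.

Hypothesis ch0 : forall n, n.+1%:R != 0 :> K.

(** A singular [A] is replaced by the smaller matrix of its rank factorization. For an invertible
    [A], the trace of the Cayley-Hamilton identity leaves only the constant term, so the size times
    the determinant vanishes, which characteristic 0 forbids in positive size. *)
Lemma nilp_mxtrace n (A : 'M[K]_n) :
  (forall m, \tr (A ^+ m.+1) = 0) -> exists N, A ^+ N = 0.
Proof.
have [r] := ubnP n; elim: r n A => // r IHr n A rA trA.
have [fA|nfA] := eqVneq (\rank A) n; last first.
  have [||N EN] := IHr _ (row_base A *m col_base A).
  - have := rank_leq_row A; rewrite leq_eqVlt (negPf nfA) /= => lt.
    exact: leq_trans lt _.
  - by move=> m; rewrite -mxtrace_base.
  by exists N.+1; rewrite mulmx_base_comm EN mulmx0 mul0mx.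
case: n A fA {rA} trA => [|n] A fA trA; first by exists 0; apply/matrixP => -[].
have := congr1 mxtrace (Cayley_Hamilton A).
rewrite horner_mx_sum raddf_sum mxtrace0 size_char_poly big_ord_recl big1 => [|i _]; last first.
  by rewrite /= mxtraceZ trA mulr0.
rewrite /= expr0 mxtraceZ mxtrace1 addr0.
move/eqP; rewrite mulf_eq0 (negPf (ch0 _)) orbF char_poly_det mulf_eq0 signr_eq0 /=.
have : A \in unitmx by rewrite -row_free_unit /row_free fA.
by rewrite unitmxE unitfE => /negPf ->.
Qed.
End MatrixTrace.

Section EndoTrace.
Variables (K : fieldType) (V : vectType K).
Implicit Types f g : 'End(V).
Local Notation b := (vbasis {:V}).

Definition etr f : K := \tr (mxof b b f).

Lemma etrD f g : etr (f + g) = etr f + etr g.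
Proof. by rewrite /etr linearD mxtraceD. Qed.

Lemma etrZ c f : etr (c *: f) = c * etr f.
Proof. by rewrite /etr linearZ mxtraceZ. Qed.

Lemma etr0 : etr 0 = 0.
Proof. by rewrite /etr linear0 mxtrace0. Qed.

Lemma etrN f : etr (- f) = - etr f.
Proof. by rewrite -scaleN1r etrZ mulN1r. Qed.

Lemma etr_sum I (r : seq I) P (F : I -> 'End(V)) :
  etr (\sum_(i <- r | P i) F i) = \sum_(i <- r | P i) etr (F i).
Proof. exact: (big_morph _ etrD etr0). Qed.

Lemma mxof_compV f g :
  mxof b b (f \o g)%VF = mxof b b g *m mxof b b f.
Proof. exact: (mxof_comp _ _ (vbasisP _)). Qed.

Lemma etrC f g : etr (f \o g)%VF = etr (g \o f)%VF.
Proof. by rewrite /etr !mxof_compV mxtrace_mulC. Qed.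

Definition fexp f n : 'End(V) := iter n (fun g : 'End(V) => (f \o g)%VF) \1%VF.

Lemma fexpE f n v : fexp f n v = iter n f v.
Proof. by elim: n => [|n IHn] /=; rewrite ?id_lfunE // comp_lfunE IHn. Qed.

Lemma mxof_fexp f n : mxof b b (fexp f n) = mxof b b f ^+ n.
Proof.
elim: n => [|n IHn]; last by rewrite exprSr -IHn /= mxof_compV.
by rewrite expr0 mxof1 // (basis_free (vbasisP _)).
Qed.

Definition nilpotent_end f := exists N, forall v, iter N f v = 0.

Lemma mxof_inj : injective (mxof b b : 'End(V) -> _).
Proof. exact: (can_inj (mxofK (vbasisP _) (vbasisP _))). Qed.

Lemma etr_nilp f : nilpotent_end f -> etr f = 0.
Proof.
case=> N fN; apply: (@mxtrace_nilp _ _ _ N); rewrite -mxof_fexp.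
suff -> : fexp f N = 0 by rewrite linear0.
by apply/lfunP => v; rewrite fexpE fN zero_lfunE.
Qed.

Lemma nilp_etr : (forall n, n.+1%:R != 0 :> K) ->
  forall f, (forall n, etr (fexp f n.+1) = 0) -> nilpotent_end f.
Proof.
move=> ch0 f ftr; have [n|N EN] := nilp_mxtrace ch0 (A := mxof b b f).
  by rewrite -mxof_fexp; exact: ftr.
exists N => v; rewrite -fexpE (_ : fexp f N = 0) ?zero_lfunE //.
by apply: mxof_inj; rewrite linear0 mxof_fexp.
Qed.

Lemma etr_idem f : (forall v, f (f v) = f v) ->
  etr f = (\rank (mxof b b f))%:R.
Proof.
move=> ff; apply: mxtrace_idem; rewrite -mxof_compV.
by congr (mxof _ _ _); apply/lfunP => v; rewrite comp_lfunE ff.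
Qed.

Lemma rank_mxof_eq0 f : (\rank (mxof b b f) == 0) = (f == 0).
Proof. by rewrite mxrank_eq0 -(inj_eq mxof_inj) linear0. Qed.

End EndoTrace.

Section PolyAction.
Variables (K : fieldType) (V : vectType K).
Implicit Types (f : 'End(V)) (p q : {poly K}) (v : V) (s : seq K).

(** The value of [p] at [f], written as a sum so that [V] may have dimension 0. *)
Definition hor f p : 'End(V) := \sum_(i < size p) p`_i *: fexp f i.

Lemma horE f n p v : (size p <= n)%N ->
  hor f p v = \sum_(i < n) p`_i *: iter i f v.
Proof.
move=> le; rewrite sum_lfunE.
rewrite (eq_bigr (fun i : 'I_(size p) => p`_i *: iter i f v)) => [|i _]; last first.
  by rewrite scale_lfunE fexpE.
rewrite (big_ord_widen n (fun i => p`_i *: iter i f v) le) big_mkcond.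
apply: eq_bigr => i _; case: ltnP => // /(nth_default 0) ->.
by rewrite scale0r.
Qed.

Lemma horD f p q v : hor f (p + q) v = hor f p v + hor f q v.
Proof.
rewrite (@horE _ (maxn (size p) (size q))) ?size_polyD //.
rewrite !(@horE _ (maxn (size p) (size q))) ?leq_maxl ?leq_maxr // -big_split.
by apply: eq_bigr => i _; rewrite coefD scalerDl.
Qed.

Lemma horZ f c p v : hor f (c *: p) v = c *: hor f p v.
Proof.
rewrite (@horE _ (size p)) ?size_scale_leq // (@horE _ (size p)) // scaler_sumr.
by apply: eq_bigr => i _; rewrite coefZ scalerA.
Qed.

Lemma hor0 f v : hor f 0 v = 0.
Proof. by rewrite -(scale0r 0) horZ scale0r. Qed.

Lemma horC f c v : hor f c%:P v = c *: v.
Proof. by rewrite (@horE _ 1) ?size_polyC_leq1 // big_ord1 coefC. Qed.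

Lemma hor1 f v : hor f 1 v = v.
Proof. by rewrite horC scale1r. Qed.

Lemma horMX f p v : hor f (p * 'X) v = hor f p (f v).
Proof.
rewrite (@horE _ (size p).+1) ?size_polyMleq; last first.
  by have [->|nz] := eqVneq p 0; rewrite ?mul0r ?size_poly0 // size_mulX.
rewrite big_ord_recl coefMX eqxx scale0r add0r (@horE _ (size p)) //.
by apply: eq_bigr => i _; rewrite coefMX /= -iterSr.
Qed.

Lemma hor_comm f p v : f (hor f p v) = hor f p (f v).
Proof.
rewrite !(@horE _ (size p)) // linear_sum; apply: eq_bigr => i _.
by rewrite linearZ /= -iterSr.
Qed.

Lemma horX f v : hor f 'X v = f v.
Proof. by rewrite -['X]mul1r horMX hor1. Qed.

Lemma horM f p q v : hor f (p * q) v = hor f p (hor f q v).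
Proof.
elim/poly_ind: p v => [|p c IHp] v; first by rewrite mul0r !hor0.
rewrite mulrDl !horD mul_polyC horZ horC; congr (_ + _).
by rewrite -mulrA ['X * q]mulrC mulrA horMX IHp horMX hor_comm.
Qed.

Lemma hor_sum f I (r : seq I) (F : I -> {poly K}) v :
  hor f (\sum_(i <- r) F i) v = \sum_(i <- r) hor f (F i) v.
Proof.
exact: (big_morph (fun p => hor f p v) (fun p q => horD f p q v) (hor0 f v)).
Qed.

Lemma hor_dvd f p q v : p %| q -> hor f p v = 0 -> hor f q v = 0.
Proof. by case/dvdpP => r -> E; rewrite horM E linear0. Qed.

Lemma horXsubC f c v : hor f ('X - c%:P) v = f v - c *: v.
Proof. by rewrite horD -polyCN horX horC scaleNr. Qed.

Lemma hor_stable f p (U : {vspace V}) :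
  (forall v, v \in U -> f v \in U) -> forall v, v \in U -> hor f p v \in U.
Proof.
move=> fU v vU; rewrite (@horE _ (size p)) //; apply: memv_suml => i _.
by apply: memvZ; elim: (i : nat) => //= n; apply: fU.
Qed.

Lemma hor_prod_zero f s v : (exists2 c, c \in s & f v = c *: v) ->
  hor f (\prod_(c <- s) ('X - c%:P)) v = 0.
Proof.
case=> c cs fv; rewrite (big_rem c) //= mulrC horM horXsubC fv subrr.
exact: linear0.
Qed.

Lemma coprime_eq0 f p q v : coprimep p q -> hor f p v = 0 -> hor f q v = 0 -> v = 0.
Proof.
case/Bezout_eq1_coprimepP => -[u w] /= uw pv qv.
by rewrite -(hor1 f v) -uw horD !horM pv qv !linear0 addr0.
Qed.

Lemma hor_eigen f c v p : f v = c *: v -> hor f p v = p.[c] *: v.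
Proof.
move=> fv; elim/poly_ind: p => [|p a IHp]; first by rewrite hor0 horner0 scale0r.
rewrite horD horMX fv linearZ /= IHp scalerA horC hornerMXaddC scalerDl.
by rewrite [c * _]mulrC.
Qed.

Lemma hor_prod_eigenvalue f s c v : hor f (\prod_(a <- s) ('X - a%:P)) v = 0 ->
  v != 0 -> f v = c *: v -> c \in s.
Proof.
move=> sv v0 fv; move/eqP: sv; rewrite (hor_eigen _ fv) scaler_eq0 (negPf v0) orbF.
rewrite horner_prod prodf_seq_eq0 => /hasP [a sa] /=.
by rewrite hornerXsubC subr_eq0 => /eqP ->.
Qed.

Lemma hor_prod_int f (js : seq int) j v : j \in js -> f v = j%:~R *: v ->
  hor f (\prod_(j <- js) ('X - j%:~R%:P)) v = 0.
Proof.
move=> jjs fv; rewrite -(big_map (fun j : int => j%:~R : K) predT (fun a => 'X - a%:P)).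
by apply: hor_prod_zero; exists j%:~R => //; exact: map_f.
Qed.

(** These are the idempotents of the Chinese remainder theorem. When a root [a] is added, with
    [u A + v Q = 1], the new idempotent is [v Q] and the former ones are multiplied by [u A]. *)
Lemma poly_idempotents s N : uniq s -> exists e : K -> {poly K},
  \prod_(d <- s) ('X - d%:P) ^+ N %| 1 - \sum_(c <- s) e c /\
  forall c, c \in s -> \prod_(d <- s) ('X - d%:P) ^+ N %| ('X - c%:P) ^+ N * e c.
Proof.
elim: s => [|a s IHs] /=; first by exists (fun=> 0); split=> //; rewrite big_nil dvd1p.
case/andP=> a_s us; have [e [e1 e2]] := IHs us.
set A := ('X - a%:P) ^+ N; set Q := \prod_(d <- s) ('X - d%:P) ^+ N in e1 e2 *.
have cop : coprimep A Q.
  rewrite /Q big_seq; apply: (big_ind (fun q => coprimep A q)).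
  - exact: coprimep1.
  - by move=> x y ax ay; rewrite coprimepMr ax.
  - move=> c cs; apply: coprimep_expl; apply: coprimep_expr.
    by rewrite coprimep_XsubC root_XsubC; apply: contraNneq a_s => <-.
have [[u v] /= uv] := Bezout_eq1_coprimepP _ _ cop.
pose e' c := if c == a then v * Q else u * A * e c.
have e'a : e' a = v * Q by rewrite /e' eqxx.
have e's c : c \in s -> e' c = u * A * e c.
  by rewrite /e'; case: eqP => // ->; rewrite (negPf a_s).
exists e'; rewrite !big_cons -/A -/Q; split.
- rewrite e'a big_seq (eq_bigr (fun c => u * A * e c)) => [|c /e's //].
  rewrite -big_seq -mulr_sumr opprD addrA -uv addrK -{1}[u * A]mulr1 -mulrBr.
  by rewrite -mulrA; apply/dvdp_mull/dvdp_mul.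
move=> c; rewrite inE => /predU1P [->|cs].
  by rewrite e'a -/A dvdp_mul // dvdp_mull.
by rewrite (e's _ cs) mulrCA; apply: dvdp_mul; [rewrite dvdp_mull|exact: e2].
Qed.

(* The [P c] are the projections onto the generalized eigenspaces of [f]. *)
Lemma primary_decomposition f s N : uniq s -> exists P : K -> {poly K},
  forall v, hor f (\prod_(c <- s) ('X - c%:P) ^+ N) v = 0 ->
  v = \sum_(c <- s) hor f (P c) v /\
  forall c, c \in s -> hor f (('X - c%:P) ^+ N) (hor f (P c) v) = 0.
Proof.
move=> us; have [e [e1 e2]] := poly_idempotents N us; exists e => v fv.
split=> [|c cs]; last by rewrite -horM (hor_dvd (e2 c cs)).
rewrite -hor_sum; apply/eqP; rewrite -subr_eq0 -{1}(hor1 f v) -scaleN1r -horZ.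
by rewrite scaleN1r -horD (hor_dvd e1).
Qed.

Lemma eigen_decomposition f s : uniq s -> exists P : K -> {poly K},
  forall v, hor f (\prod_(c <- s) ('X - c%:P)) v = 0 ->
  v = \sum_(c <- s) hor f (P c) v /\
  forall c, c \in s -> f (hor f (P c) v) = c *: hor f (P c) v.
Proof.
move=> us; have [P HP] := primary_decomposition f 1 us; exists P => v fv.
have [|Ev Pv] := HP v; first by under eq_bigr do rewrite expr1.
split=> // c /Pv; rewrite expr1 horXsubC => /eqP.
by rewrite subr_eq0 => /eqP.
Qed.

End PolyAction.

Lemma mxof_hor (K : fieldType) (V : vectType K) (f : 'End(V)) p :
  mxof (vbasis {:V}) (vbasis {:V}) (hor f p) =
  \sum_(i < size p) p`_i *: mxof (vbasis {:V}) (vbasis {:V}) f ^+ i.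
Proof.
by rewrite /hor linear_sum; apply: eq_bigr => i _; rewrite linearZ /= mxof_fexp.
Qed.

(** * Brackets and the Killing form *)

Section AddMem.
Variables (K : fieldType) (V : vectType K).
Implicit Types (U W : {vspace V}) (x : V).

Lemma memv_addl U W x : x \in U -> x \in (U + W)%VS.
Proof. exact: (subvP (addvSl _ _)). Qed.

Lemma memv_addr U W x : x \in W -> x \in (U + W)%VS.
Proof. exact: (subvP (addvSr _ _)). Qed.

End AddMem.

Section LieBasics.
Variables (K : fieldType) (L : lieType K).
Implicit Types (x y z h : L) (U V W I J S : {vspace L}).

Lemma lieDr x y z : [lie x, y + z] = [lie x, y] + [lie x, z].
Proof. exact: linearD. Qed.

Lemma lieZr c x y : [lie x, c *: y] = c *: [lie x, y].
Proof. by rewrite linearZ. Qed.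

Lemma lie0r x : [lie x, 0] = 0.
Proof. exact: linear0. Qed.

Lemma lieNr x y : [lie x, - y] = - [lie x, y].
Proof. exact: linearN. Qed.

Lemma lieBr x y z : [lie x, y - z] = [lie x, y] - [lie x, z].
Proof. exact: linearB. Qed.

Lemma lieC x y : [lie x, y] = - [lie y, x].
Proof. exact: lie_brC. Qed.

Lemma lieDl x y z : [lie x + y, z] = [lie x, z] + [lie y, z].
Proof. by rewrite lieC lieDr opprD -!lieC. Qed.

Lemma lieZl c x y : [lie c *: x, y] = c *: [lie x, y].
Proof. by rewrite lieC lieZr -scalerN -lieC. Qed.

Lemma lie0l x : [lie 0, x] = 0.
Proof. by rewrite lieC lie0r oppr0. Qed.

Lemma lieNl x y : [lie - x, y] = - [lie x, y].
Proof. by rewrite lieC lieNr -lieC. Qed.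

Lemma lieBl x y z : [lie x - y, z] = [lie x, z] - [lie y, z].
Proof. by rewrite lieDl lieNl. Qed.

Lemma lie_sumr T (r : seq T) (P : pred T) (F : T -> L) x :
  [lie x, \sum_(i <- r | P i) F i] = \sum_(i <- r | P i) [lie x, F i].
Proof. exact: linear_sum. Qed.

Lemma lie_suml T (r : seq T) (P : pred T) (F : T -> L) x :
  [lie \sum_(i <- r | P i) F i, x] = \sum_(i <- r | P i) [lie F i, x].
Proof. by rewrite lieC lie_sumr -sumrN; apply: eq_bigr => i _; rewrite -lieC. Qed.

Lemma lieA x y z : [lie x, [lie y, z]] = [lie [lie x, y], z] + [lie y, [lie x, z]].
Proof.
apply/eqP; rewrite -subr_eq0 opprD addrA (lieC [lie x, y] z) opprK.
by rewrite (lieC x z) lieNr opprK addrAC lie_jacobi.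
Qed.

Lemma lieAl x y z : [lie [lie x, y], z] = [lie x, [lie y, z]] - [lie y, [lie x, z]].
Proof. by rewrite lieA addrK. Qed.

Lemma ad_br x y : ad [lie x, y] = (ad x \o ad y)%VF - (ad y \o ad x)%VF.
Proof.
apply/lfunP => z; rewrite add_lfunE opp_lfunE !comp_lfunE !adE; exact: lieAl.
Qed.

Lemma adD x y : ad (x + y) = ad x + ad y.
Proof. by apply/lfunP => z; rewrite add_lfunE !adE lieDl. Qed.

Lemma adZ c x : ad (c *: x) = c *: ad x.
Proof. by apply/lfunP => z; rewrite scale_lfunE !adE lieZl. Qed.

Lemma brv_mem U V x y : x \in U -> y \in V -> [lie x, y] \in brv U V.
Proof.
move=> xU yV; rewrite (coord_vbasis xU) lie_suml.
apply: memv_suml => i _; rewrite lieZl; apply: memvZ.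
rewrite (coord_vbasis yV) lie_sumr; apply: memv_suml => j _.
rewrite lieZr; apply/memvZ/memv_span/allpairsP.
by exists ((vbasis U)`_i, (vbasis V)`_j); rewrite /= !mem_nth ?size_tuple.
Qed.

Lemma brvP U V W : (forall x y, x \in U -> y \in V -> [lie x, y] \in W) ->
  (brv U V <= W)%VS.
Proof.
move=> UV; apply/span_subvP => z /allpairsP [[x y] /= [xU yV ->]].
by apply: UV; apply: vbasis_mem.
Qed.

Lemma brvS U V U' V' : (U <= U')%VS -> (V <= V')%VS -> (brv U V <= brv U' V')%VS.
Proof.
move=> /subvP UU' /subvP VV'; by apply: brvP => x y /UU' xU /VV' yV; apply: brv_mem.
Qed.

Lemma brvE U V z : z \in brv U V -> exists n (u v : 'I_n -> L),
  [/\ forall i, u i \in U, forall i, v i \in V & z = \sum_i [lie u i, v i]].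
Proof.
rewrite /brv; set X := [seq _ | x <- _, y <- _] => zX.
have XP (i : 'I_(size X)) : exists p, (p.1 \in U) && (p.2 \in V) && (X`_i == [lie p.1, p.2]).
  have /allpairsP [[x y] /= [xU yV ->]] : X`_i \in X by rewrite mem_nth.
  by exists (x, y) => /=; rewrite !vbasis_mem ?eqxx.
pose p i := xchoose (XP i).
have pP i : (p i).1 \in U /\ (p i).2 \in V /\ X`_i = [lie (p i).1, (p i).2].
  by have /andP [/andP [-> ->] /eqP] := xchooseP (XP i).
exists (size X), (fun i => coord (in_tuple X) i z *: (p i).1), (fun i => (p i).2).
split=> [i|i|]; [by apply: memvZ; case: (pP i)|by case: (pP i) => _ []|].
rewrite {1}(coord_span (X := in_tuple X) zX); apply: eq_bigr => i _.
by rewrite lieZl; case: (pP i) => _ [_ <-].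
Qed.

Lemma is_subalgebraP {U} :
  reflect (forall x y, x \in U -> y \in U -> [lie x, y] \in U) (is_subalgebra U).
Proof.
by apply: (iffP idP) => [/subvP sU x y xU yU|sU]; [exact/sU/brv_mem|exact: brvP].
Qed.

Lemma is_idealP {I U} :
  reflect ((I <= U)%VS /\ forall x y, x \in U -> y \in I -> [lie x, y] \in I)
    (is_ideal I U).
Proof.
apply: (iffP andP) => -[IU]; last by split=> //; exact: brvP.
by move=> /subvP sU; split=> // x y xU yU; exact/sU/brv_mem.
Qed.

Lemma ideal_cap I J U : is_ideal I U -> is_ideal J U -> is_ideal (I :&: J) U.
Proof.
move=> /is_idealP [IU sI] /is_idealP [_ sJ]; apply/is_idealP; split.
  exact: subv_trans (capvSl _ _) IU.
by move=> x y xU /memv_capP [yI yJ]; apply/memv_capP; split; [exact: sI|exact: sJ].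
Qed.

Lemma lie_line x u v : u \in <[x]>%VS -> v \in <[x]>%VS -> [lie u, v] = 0.
Proof.
by move=> /vlineP [c ->] /vlineP [c' ->]; rewrite lieZl lieZr lie_brxx !scaler0.
Qed.

Lemma centralizerP U V x : reflect (x \in U /\ forall y, y \in V -> [lie y, x] = 0)
  (x \in centralizer U V).
Proof.
apply: (iffP memv_capP) => -[xU xV]; split=> //.
  move=> y yV; rewrite (coord_vbasis yV) lie_suml big1 // => i _.
  move: xV; rewrite memvE => /subv_bigcapP /(_ i isT).
  by rewrite -memvE memv_ker adE lieZl => /eqP ->; rewrite scaler0.
rewrite memvE; apply/subv_bigcapP => i _; rewrite -memvE memv_ker adE xV //.
by rewrite vbasis_mem // mem_nth // size_tuple.
Qed.

Lemma leigenspaceP (f : 'End(L)) c x : (x \in leigenspace f c) = (f x == c *: x).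
Proof.
by rewrite memv_ker add_lfunE opp_lfunE scale_lfunE id_lfunE subr_eq0.
Qed.

Lemma killingE x y : killing x y = etr (ad x \o ad y)%VF.
Proof. by []. Qed.

Lemma killingC x y : killing x y = killing y x.
Proof. exact: etrC. Qed.

Lemma killingDl x y z : killing (x + y) z = killing x z + killing y z.
Proof. by rewrite !killingE adD comp_lfunDl etrD. Qed.

Lemma killingZl c x y : killing (c *: x) y = c * killing x y.
Proof. by rewrite !killingE adZ -comp_lfunZl etrZ. Qed.

Lemma killing0l x : killing 0 x = 0.
Proof. by rewrite -(scale0r 0) killingZl mul0r. Qed.

Lemma killingNl x y : killing (- x) y = - killing x y.
Proof. by rewrite -scaleN1r killingZl mulN1r. Qed.

Lemma killingDr x y z : killing x (y + z) = killing x y + killing x z.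
Proof. by rewrite killingC killingDl !(killingC x). Qed.

Lemma killingZr c x y : killing x (c *: y) = c * killing x y.
Proof. by rewrite killingC killingZl killingC. Qed.

Lemma killing0r x : killing x 0 = 0.
Proof. by rewrite killingC killing0l. Qed.

Lemma killingNr x y : killing x (- y) = - killing x y.
Proof. by rewrite killingC killingNl killingC. Qed.

Lemma killing_suml T (r : seq T) (P : pred T) (F : T -> L) x :
  killing (\sum_(i <- r | P i) F i) x = \sum_(i <- r | P i) killing (F i) x.
Proof. by elim/big_rec2: _ => [|i a b _ <-]; rewrite ?killing0l ?killingDl. Qed.

Lemma killing_sumr T (r : seq T) (P : pred T) (F : T -> L) x :
  killing x (\sum_(i <- r | P i) F i) = \sum_(i <- r | P i) killing x (F i).
Proof. by elim/big_rec2: _ => [|i a b _ <-]; rewrite ?killing0r ?killingDr. Qed.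

Lemma killing_inv x y z : killing [lie x, y] z = killing x [lie y, z].
Proof.
rewrite !killingE !ad_br !(comp_lfunDl, comp_lfunDr, comp_lfunNl, comp_lfunNr).
rewrite !etrD !etrN !comp_lfunA.
by rewrite -[((ad y \o ad x) \o _)%VF]comp_lfunA [etr (ad y \o _)%VF]etrC.
Qed.

End LieBasics.

(** * Nilpotency of the radical *)

Notation stable S W :=
  (forall x w, x \in S -> w \in W -> [lie x, w] \in W).

Section JointlyNilpotent.
Variables (K : fieldType) (L : lieType K).
Hypothesis ch0 : forall n, n.+1%:R != 0 :> K.
Implicit Types (x y z h : L) (U V W I J S Y M : {vspace L}).

(** [bpow Y i] is spanned by the vectors obtained by applying [i] maps [ad y], [y] in [Y], to
    elements of [L]. Hence [jointly_nilpotent Y] says that the associative algebra without unit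
    generated by [ad Y] is nilpotent. *)
Definition bpow Y i : {vspace L} := iter i (brv Y) fullv.
Definition jointly_nilpotent Y := exists r, bpow Y r = 0%VS.

Lemma stable_brv S Y W : stable S Y -> stable S W -> stable S (brv Y W).
Proof.
move=> sY sW x w xS /brvE [n [u [v [uY vW ->]]]]; rewrite lie_sumr.
apply: memv_suml => i _; rewrite lieA memvD // brv_mem //; [exact: sY|exact: sW].
Qed.

Lemma bpow_stable S Y i : stable S Y -> stable S (bpow Y i).
Proof.
move=> sY; elim: i => [x w _ _|i IHi] /=; first exact: memvf.
exact: stable_brv.
Qed.

Lemma jointly_nilpotentS Y Y' : (Y <= Y')%VS ->
  jointly_nilpotent Y' -> jointly_nilpotent Y.
Proof.
move=> sYY' [r Er]; exists r; apply/eqP; rewrite -subv0 -Er.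
by elim: (r) => //= i IHi; apply: brvS.
Qed.

Lemma nilp_shift Y (T : 'End(L)) : jointly_nilpotent Y ->
  (forall i v, v \in bpow Y i -> T v \in bpow Y i.+1) -> nilpotent_end T.
Proof.
case=> r Er sT; exists r => v; apply/eqP; rewrite -memv0 -Er.
by elim: r {Er} => [|r IHr] /=; [exact: memvf|exact: sT].
Qed.

(** The decreasing spaces [bpow M i] become stationary for reasons of dimension, so only a nonzero
    term contained in its own bracket with [M] has to be excluded. *)
Lemma stable_dim M :
  (forall W, (forall i, W = bpow M i -> (W <= brv M W)%VS -> W = 0%VS)) ->
  jointly_nilpotent M.
Proof.
move=> H; pose n := \dim {:L}.
have z i : bpow M i = 0%VS -> bpow M i.+1 = 0%VS.
  move=> /= ->; apply/eqP; rewrite -subv0; apply: brvP => x y _.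
  by rewrite memv0 => /eqP ->; rewrite lie0r mem0v.
have bd i : bpow M i = 0%VS \/ (\dim (bpow M i) + i <= n)%N.
  elim: i => [|i [E|IHi]]; [by right; rewrite addn0|by left; apply: z|].
  have sub : (bpow M i.+1 <= bpow M i)%VS.
    by elim: (i) => [|j IHj]; [exact: subvf|exact: brvS].
  have [le|nle] := boolP (bpow M i <= bpow M i.+1)%VS.
    by left; apply: z; apply: H le.
  right; apply: leq_trans IHi; rewrite addnS ltn_add2r.
  by rewrite ltn_neqAle dimvS // andbT; apply: contra nle => /eqP E; rewrite -(geq_leqif (dimv_leqif_sup sub)) E.
exists n.+1; case: (bd n.+1) => // le; suff : false by [].
by move: le; rewrite addnS ltnNge leq_addl.
Qed.

(** * Enlarging a jointly nilpotent space by commutators *)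

Section Step.
Variables (S Y M : {vspace L}).
Hypotheses (MS : (M <= S)%VS) (sY : stable S Y) (sM : stable S M).
Hypotheses (nY : jointly_nilpotent Y) (MM : (brv M M <= Y)%VS).
Hypothesis hM : forall y, y \in M -> exists n (u d : 'I_n -> L),
  [/\ forall i, u i \in S, forall i, d i \in S, y = \sum_i [lie u i, d i]
    & forall i, [lie d i, y] \in Y].

(* The traces of the powers of [ad y] vanish: [tr ([u, d] y ^ n)] equals
   [tr (u [d, y ^ n])], and [[d, y ^ n]] lies in the associative ideal generated
   by [Y], which is nilpotent. *)
Lemma step_nilp y : y \in M -> nilpotent_end (ad y).
Proof.
move=> yM; apply: nilp_etr => // n.
have [m [u [d [uS dS Ey dY]]]] := hM yM.
rewrite /= -/(fexp (ad y) n) {1}Ey.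
have -> : ad (\sum_i [lie u i, d i]) = \sum_i ad [lie u i, d i].
  by apply/lfunP => v; rewrite adE sum_lfunE lie_suml; apply: eq_bigr => i _; rewrite adE.
set T := fexp (ad y) n.
have -> : ((\sum_i ad [lie u i, d i]) \o T)%VF = \sum_i (ad [lie u i, d i] \o T)%VF.
  apply/lfunP => v; rewrite comp_lfunE !sum_lfunE; apply: eq_bigr => i _.
  by rewrite comp_lfunE.
rewrite etr_sum big1 // => i _.
rewrite ad_br comp_lfunDl comp_lfunNl etrD etrN.
rewrite -[((ad (d i) \o _) \o _)%VF]comp_lfunA (etrC (ad (d i))) -!comp_lfunA.
rewrite -etrN -etrD -comp_lfunNr -comp_lfunDr; apply: etr_nilp.
apply: (nilp_shift nY) => j v vj.
rewrite comp_lfunE adE; apply: (bpow_stable (i := j.+1) sY) => //.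
rewrite add_lfunE opp_lfunE !comp_lfunE !fexpE !adE.
elim: n {T} => [|n IHn] /=; first by rewrite subrr mem0v.
rewrite !adE lieA -addrA -lieBr; apply: memvD.
  apply: brv_mem => //; elim: (n) => //= k IHk; rewrite adE.
  by apply: (bpow_stable (i := j) sY) => //; apply: (subvP MS).
by apply: (bpow_stable (i := j.+1) sY) => //; apply: (subvP MS).
Qed.

(** Generators are removed one at a time. The map [ad y] preserves the rest [R] of the sum because
    [[y, y']] lies in [Y]; as it is nilpotent, iterating [W <= ad y W + R] puts [W] inside [R]. *)
Lemma step_elim W (ys : seq L) : stable S W -> {subset ys <= M} ->
  (W <= \sum_(y <- ys) (ad y @: W) + brv Y W)%VS -> (W <= brv Y W)%VS.
Proof.
move=> sW; elim: ys => [|y ys IHys] ysM; first by rewrite big_nil add0v.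
have yM : y \in M by rewrite ysM ?mem_head.
have yS : y \in S by apply: (subvP MS).
have {}ysM : {subset ys <= M} by move=> z zys; rewrite ysM // inE zys orbT.
rewrite big_cons -addvA; set R := (_ + brv Y W)%VS => sub.
apply: (IHys ysM); rewrite -/R.
have yR z : z \in R -> [lie y, z] \in R.
  case/memv_addP=> z1 + [z2 z2Y ->]; rewrite lieDr => z1W.
  apply: memvD; last first.
    by apply: memv_addr; apply: (stable_brv sY sW).
  move: z1W; rewrite big_tnth => /memv_sumP [w wW ->]; rewrite lie_sumr.
  apply: memv_suml => i _; have /memv_imgP [w' w'W ->] := wW i isT.
  rewrite adE lieA; apply: memvD.
    apply: memv_addr; apply: brv_mem => //; apply: (subvP MM).
    by apply: brv_mem => //; apply: ysM; apply: mem_tnth.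
  apply: memv_addl; rewrite big_tnth memvE; apply: (sumv_sup i) => //.
  by rewrite -memvE -adE; apply: memv_img; exact: sW.
have dec m w : w \in W -> exists2 w', w' \in W & w - iter m (ad y) w' \in R.
  elim: m w => [|m IHm] w wW; first by exists w => //=; rewrite subrr mem0v.
  have /memv_addP [z1 /memv_imgP [w1 w1W ->] [z2 z2R E]] := subvP sub _ wW.
  have [w' w'W w'R] := IHm _ w1W; exists w' => //=.
  rewrite E addrAC !adE -lieBr memvD //; exact: yR.
have [N Ny] := step_nilp yM.
by apply/subvP => w /(dec N) [w' _]; rewrite Ny subr0.
Qed.

Lemma step_jointly_nilpotent : jointly_nilpotent M.
Proof.
apply: stable_dim => W i WE sub.
have sW : stable S W by rewrite WE; exact: bpow_stable.
have WY : (W <= brv Y W)%VS.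
  apply: (step_elim (ys := vbasis M)) => //; first by move=> y; exact: vbasis_mem.
  apply: subv_trans sub _; apply: subv_trans (addvSl _ _).
  apply: brvP => y w yM wW; rewrite (coord_vbasis yM) lie_suml.
  apply: memv_suml => j _; rewrite lieZl; apply: memvZ.
  have jM : (vbasis M)`_j \in vbasis M by rewrite mem_nth ?size_tuple.
  rewrite (big_rem _ jM) /=; apply: memv_addl.
  by rewrite -adE memv_img.
have [r Er] := nY; apply/eqP; rewrite -subv0 -Er.
elim: (r) => [|j IHj] /=; first exact: subvf.
by apply: subv_trans WY _; apply: brvS.
Qed.

End Step.

Lemma stable_ideal I S : is_ideal I S -> stable S I.
Proof. by case/is_idealP. Qed.

Lemma jointly_nilpotent0 : jointly_nilpotent 0.
Proof.
exists 1; apply/eqP; rewrite -subv0; apply: brvP => x y.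
by rewrite memv0 => /eqP ->; rewrite lie0l mem0v.
Qed.

(** This takes the place of Lie's theorem, without eigenvalues. By induction on the derived length
    it holds for [[J, J]]; it then climbs to [[S, J]] and to [[S, S] :&: J], the bracket of each of
    these with itself falling into the preceding one. *)
Lemma solvable_ideal_jointly_nilpotent S J :
  is_subalgebra S -> is_ideal J S -> solvable_lie J ->
  jointly_nilpotent (brv S S :&: J).
Proof.
move=> sS iJ [n]; elim: n J iJ => [|n IHn] J iJ.
  by move=> /= ->; rewrite capv0; exact: jointly_nilpotent0.
rewrite /derived iterSr -/(derived n (brv J J)) => EJ.
have [JS sJ] := (is_idealP iJ).
have sSS : stable S S by apply/is_subalgebraP.
have J1J : (brv J J <= J)%VS.
  by apply: brvP => x y xJ yJ; apply: sJ => //; apply: (subvP JS).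
have sJ1 : stable S (brv J J) by apply: stable_brv.
have nJ1 : jointly_nilpotent (brv J J).
  apply: jointly_nilpotentS (IHn (brv J J) _ EJ).
    by rewrite subv_cap subvv andbT; apply: brvS.
  by apply/is_idealP; split=> //; exact: subv_trans J1J JS.
have sSJ : stable S (brv S J) by apply: stable_brv.
have SJJ : (brv S J <= J)%VS by apply: brvP.
have nSJ : jointly_nilpotent (brv S J).
  apply: (step_jointly_nilpotent (S := S) (Y := brv J J)) => //.
  - exact: subv_trans SJJ JS.
  - exact: brvS.
  move=> y yM; have [m [u [d [uS dJ Ey]]]] := brvE yM.
  exists m, u, d; split=> // i; first exact: (subvP JS).
  by apply: brv_mem => //; apply: (subvP SJJ).
apply: (step_jointly_nilpotent (S := S) (Y := brv S J)) => //.
- exact: subv_trans (capvSr _ _) JS.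
- move=> x y xS /memv_capP [y1 y2]; apply/memv_capP; split; last exact: sJ.
  by apply: (stable_brv sSS sSS).
- by apply: brvS; [exact: subv_trans (capvSr _ _) JS|exact: capvSr].
move=> y /memv_capP [yM yJ]; have [m [u [d [uS dJ Ey]]]] := brvE yM.
by exists m, u, d; split=> // i; apply: brv_mem.
Qed.

(** The map [ad x \o ad y] lowers the filtration by the [bpow] of [[S, S] :&: J], so it is nilpotent
    and has trace 0. *)
Lemma solvable_ideal_killing S J x y :
  is_subalgebra S -> is_ideal J S -> solvable_lie J ->
  x \in S -> y \in brv S S -> y \in J -> killing x y = 0.
Proof.
move=> sS iJ solJ xS yS yJ; rewrite killingE; apply: etr_nilp.
apply: (nilp_shift (solvable_ideal_jointly_nilpotent sS iJ solJ)) => i v vi.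
rewrite comp_lfunE !adE; apply: (@bpow_stable S) => //; last first.
  by apply: brv_mem => //; apply/memv_capP.
move=> a b aS /memv_capP [b1 b2]; apply/memv_capP; split; last exact: (stable_ideal iJ).
by apply: (@stable_brv S) => //; apply/is_subalgebraP.
Qed.

End JointlyNilpotent.

(** * Nondegeneracy of the Killing form *)

Section Nondegenerate.
Variables (K : fieldType) (L : lieType K).
Implicit Types (x y z h d v w : L) (U V W : {vspace L}).

Definition nondegenerate_on U :=
  forall x, x \in U -> (forall y, y \in U -> killing x y = 0) -> x = 0.

Definition gram U : 'M[K]_(\dim U) :=
  \matrix_(i, j) killing (vbasis U)`_i (vbasis U)`_j.

Lemma mul_gram U (u : 'rV_(\dim U)) j :
  (u *m gram U) 0 j = killing (\sum_i u 0 i *: (vbasis U)`_i) (vbasis U)`_j.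
Proof.
by rewrite !mxE killing_suml; apply: eq_bigr => i _; rewrite mxE killingZl.
Qed.

Lemma gram_unit U : nondegenerate_on U -> gram U \in unitmx.
Proof.
move=> nU; rewrite -row_free_unit -kermx_eq0; apply/rowV0P => u /sub_kermxP uG0.
have u0 : \sum_i u 0 i *: (vbasis U)`_i = 0.
  apply: nU => [|y yU].
    by apply: memv_suml => i _; rewrite memvZ // vbasis_mem // mem_nth ?size_tuple.
  rewrite (coord_vbasis yU) killing_sumr big1 // => j _.
  by rewrite killingZr -mul_gram uG0 mxE mulr0.
by apply/rowP => i; rewrite mxE; have /freeP -> := basis_free (vbasisP U).
Qed.

Lemma killing_repr U (phi : L -> K) : nondegenerate_on U ->
  (forall c x y, phi (c *: x + y) = c * phi x + phi y) ->
  exists2 y, y \in U & forall x, x \in U -> killing y x = phi x.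
Proof.
move=> nU phiL; have phi0 : phi 0 = 0.
  by have := phiL (-1) 0 0; rewrite scaler0 add0r mulN1r addNr.
have phi_sum (u : 'I_(\dim U) -> K) :
    phi (\sum_j u j *: (vbasis U)`_j) = \sum_j u j * phi (vbasis U)`_j.
  by elim/big_rec2: _ => [//|j a c _ <-]; rewrite phiL.
pose u : 'rV_(\dim U) := (\row_j phi (vbasis U)`_j) *m invmx (gram U).
exists (\sum_i u 0 i *: (vbasis U)`_i) => [|x xU].
  by apply: memv_suml => i _; rewrite memvZ // vbasis_mem // mem_nth ?size_tuple.
rewrite (coord_vbasis xU) killing_sumr phi_sum; apply: eq_bigr => j _.
by rewrite killingZr -mul_gram mulmxKV ?gram_unit // mxE.
Qed.

(** The coordinates of [f], whose kernel is [W], are functionals vanishing on [W]; each is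
    represented by an element of [U] orthogonal to [W], hence vanishes at [x]. *)
Lemma killing_biorthogonal U W x : nondegenerate_on U -> (W <= U)%VS -> x \in U ->
  (forall y, y \in U -> (forall w, w \in W -> killing y w = 0) -> killing y x = 0) ->
  x \in W.
Proof.
move=> nU WU xU H; pose f : 'End(L) := \1%VF - projv W.
have fW w : w \in W -> f w = 0.
  by move=> wW; rewrite add_lfunE opp_lfunE id_lfunE projv_id // subrr.
suff fx : f x = 0.
  move/eqP: fx; rewrite add_lfunE opp_lfunE id_lfunE subr_eq0 => /eqP ->.
  exact: memv_proj.
rewrite (coord_vbasis (memvf (f x))) big1 // => i _.
have [|y yU yE] := killing_repr (phi := fun v => coord (vbasis {:L}) i (f v)) nU.
  by move=> c y z; rewrite !linearP.
rewrite -yE // H ?scale0r // => w wW.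
by rewrite yE ?(subvP WU) // fW // linear0.
Qed.

Definition derivation (D : 'End(L)) :=
  forall x y, D [lie x, y] = [lie D x, y] + [lie x, D y].

(** Choose [d] so that [ad d] and [D] have the same trace against every [ad v]. Their difference [E]
    is a derivation, and [killing (E x) v] equals the trace of [E \o ad [lie x, v]], which is 0. *)
Lemma derivation_inner (D : 'End(L)) : nondegenerate_on fullv -> derivation D ->
  exists d, D = ad d.
Proof.
move=> nL dD.
have [|d _ dE] := killing_repr (phi := fun v => etr (D \o ad v)%VF) nL.
  by move=> c x y; rewrite adD adZ comp_lfunDr -comp_lfunZr etrD etrZ.
exists d; apply/eqP; rewrite -subr_eq0; set E := D - ad d.
have dE' x y : E [lie x, y] = [lie E x, y] + [lie x, E y].
  rewrite !add_lfunE !opp_lfunE !adE dD lieA lieBl lieBr opprD !addrA.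
  by congr (_ - _); rewrite addrAC.
have tE v : etr (E \o ad v)%VF = 0.
  by rewrite comp_lfunDl comp_lfunNl etrD etrN -dE ?memvf // killingE subrr.
move: E dE' tE => E dE' tE; apply/eqP/lfunP => x; rewrite zero_lfunE; apply: nL; rewrite ?memvf // => v _.
have -> : killing (E x) v = etr (E \o ad [lie x, v])%VF; last exact: tE.
rewrite killingE.
have -> : ad (E x) = (E \o ad x)%VF - (ad x \o E)%VF.
  apply/lfunP => y; rewrite add_lfunE opp_lfunE !comp_lfunE !adE dE'.
  by rewrite addrK.
rewrite ad_br !(comp_lfunDl, comp_lfunDr, comp_lfunNl, comp_lfunNr) !etrD !etrN.
by rewrite comp_lfunA -[((ad x \o E) \o _)%VF]comp_lfunA [etr (ad x \o _)%VF]etrC comp_lfunA.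
Qed.

End Nondegenerate.

(** * Integral coordinates on finitely many scalars of a field of characteristic 0 *)

Section IntegralCoordinates.
Variable K : fieldType.
Hypothesis ch0 : forall n, n.+1%:R != 0 :> K.

Lemma intr_neq0 (z : int) : z != 0 -> z%:~R != 0 :> K.
Proof.
by case: z => [[|n]|n] // _; rewrite ?NegzE ?mulrNz ?oppr_eq0; exact: ch0.
Qed.

(* A basis of the rational span of [s], with denominators cleared. *)
Lemma integral_coordinates (s : seq K) :
  exists m (e : 'I_m -> K) (C : K -> 'I_m -> int) (D : int),
  [/\ D != 0, forall a, a \in s -> D%:~R * a = \sum_i (C a i)%:~R * e i
    & forall u : 'I_m -> int, \sum_i (u i)%:~R * e i = 0 -> forall i, u i = 0].
Proof.
suff H m : forall (e : 'I_m -> K) (C : K -> 'I_m -> int) (D : int), D != 0 ->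
   (forall a, a \in s -> D%:~R * a = \sum_i (C a i)%:~R * e i) ->
  exists m (e : 'I_m -> K) (C : K -> 'I_m -> int) (D : int),
  [/\ D != 0, forall a, a \in s -> D%:~R * a = \sum_i (C a i)%:~R * e i
    & forall u : 'I_m -> int, \sum_i (u i)%:~R * e i = 0 -> forall i, u i = 0].
  apply: (H (size s) (fun i => s`_i) (fun a i => (i == index a s :> nat)%:Z) 1) => //.
  move=> a sa; have lt : (index a s < size s)%N by rewrite index_mem.
  rewrite (bigD1 (Ordinal lt)) //= eqxx nth_index // big1 ?addr0 // => i ne.
  by rewrite (_ : (i == _ :> nat) = false) ?mul0r //; apply: negbTE.
elim: m => [|m IHm] e C D D0 EC; first by exists 0, e, C, D; split=> // u _ [].
case: (classic (forall u : 'I_m.+1 -> int,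
    \sum_i (u i)%:~R * e i = 0 -> forall i, u i = 0)) => [ind|nind].
  by exists m.+1, e, C, D.
have [u nu] := not_all_ex_not _ _ nind; have [Eu nu'] := imply_to_and _ _ nu.
have [j /eqP uj] := not_all_ex_not _ _ nu'.
(* The relation [u] with [u j != 0] eliminates [e j], at the price of multiplying the common
   denominator by [u j]. *)
apply: (IHm (fun i => e (lift j i))
  (fun a i => u j * C a (lift j i) - C a j * u (lift j i)) (u j * D)).
  by rewrite mulf_neq0.
move=> a sa; rewrite intrM -mulrA EC // (bigD1_ord j) //= mulrDr.
have Ej : (u j)%:~R * e j = - \sum_(i < m) (u (lift j i))%:~R * e (lift j i).
  by apply/eqP; rewrite -addr_eq0; apply/eqP; rewrite -[RHS]Eu (bigD1_ord j).
rewrite mulrCA Ej mulrN mulr_sumr mulr_sumr addrC -sumrB; apply: eq_bigr => i _.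
by rewrite intrB !intrM mulrBl !mulrA.
Qed.

Lemma intr_eq (i j : int) : (i%:~R == j%:~R :> K) = (i == j).
Proof.
apply/idP/idP => [|/eqP -> //]; rewrite -subr_eq0 -intrB -[i == j]subr_eq0.
by apply: contraLR => /intr_neq0.
Qed.

Lemma natr_eq (m n : nat) : (m%:R == n%:R :> K) = (m == n).
Proof. by rewrite !pmulrn intr_eq. Qed.

End IntegralCoordinates.

(** * Nilpotency criteria *)

Section AdditiveParts.
Variables (K : fieldType) (L : lieType K).
Hypothesis ch0 : forall n, n.+1%:R != 0 :> K.
Hypothesis nL : nondegenerate_on {:L}.
Implicit Types (x y z h d v w : L) (U V W : {vspace L}) (t : seq K).

(** Repetitions in [t] are allowed, so this says that the eigenvalues lie in the base field; for a
    duplicate-free [t] it means diagonalizability. *)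
Definition split_by (f : 'End(L)) t :=
  forall v, hor f (\prod_(a <- t) ('X - a%:P)) v = 0.

Definition additive_on t (phi : K -> K) :=
  forall a b, a \in t -> b \in t -> a + b \in t -> phi (a + b) = phi a + phi b.

(** The operator [ad c - (a + b)] acts on [[lie x, y]] as [ad c - a] on [x] plus [ad c - b] on [y],
    and each term lowers one of the exponents. *)
Lemma hor_lie c a b m n x y :
  hor (ad c) (('X - a%:P) ^+ m) x = 0 -> hor (ad c) (('X - b%:P) ^+ n) y = 0 ->
  hor (ad c) (('X - (a + b)%:P) ^+ (m + n)) [lie x, y] = 0.
Proof.
elim: m n x y => [|m IHm] n x y.
  by rewrite expr0 hor1 => ->; rewrite lie0l linear0.
elim: n y => [|n IHn] y; first by rewrite expr0 hor1 => _ ->; rewrite lie0r linear0.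
rewrite exprSr horM => Ex Ey; rewrite addnS exprSr horM horXsubC adE.
have -> : [lie c, [lie x, y]] - (a + b) *: [lie x, y] =
   [lie hor (ad c) ('X - a%:P) x, y] + [lie x, hor (ad c) ('X - b%:P) y].
  rewrite !horXsubC !adE lieBl lieBr lieZl lieZr scalerDl opprD lieA.
  by rewrite addrACA.
rewrite [hor _ _ (_ + _)]linearD {1}addSnnS /= IHm // add0r IHn //.
  by rewrite exprSr horM.
by rewrite -horM -exprSr.
Qed.

(** The exponent is a crude bound for all multiplicities in [t]. The eigenvalue 0 is added because
    nilpotency will mean that only its component survives. *)
Lemma split_by_gen f t : split_by f t ->
  forall v, hor f (\prod_(a <- undup (0 :: t)) ('X - a%:P) ^+ (size t).+1) v = 0.
Proof.
move=> ft v; apply: hor_dvd (ft v); rewrite -prodr_undup_exp_count.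
apply: (@dvdp_trans _ (\prod_(a <- undup t) ('X - a%:P) ^+ (size t).+1)).
  rewrite big_seq [X in _ %| X]big_seq; apply: (big_rec2 (fun p q => p %| q)) => // a p q _ pq.
  by apply: dvdp_mul => //; apply: dvdp_exp2l; rewrite leqW // count_size.
by rewrite /=; case: ifP => // _; rewrite big_cons dvdp_mull.
Qed.

(* The components [hor (ad c) (P a)] are the projections onto the generalized
   eigenspaces of [ad c], and [r a] is the dimension of the [a]-th one. For
   additive [phi], scaling each generalized eigenspace by [phi a] is a derivation,
   hence inner. *)
Lemma additive_parts c t : split_by (ad c) t ->
  exists r : K -> nat,
    ((forall a, a \in undup (0 :: t) -> a != 0 -> r a = 0) -> nilpotent_end (ad c)) /\
    forall phi, additive_on (0 :: t) phi ->
    exists d,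
    [/\ forall U, (forall x, x \in U -> [lie c, x] \in U) ->
          forall x, x \in U -> [lie d, x] \in U,
        forall x a, a \in 0 :: t -> [lie c, x] = a *: x -> [lie d, x] = phi a *: x,
        split_by (ad d) (undup (map phi (0 :: t)))
      & killing c d = \sum_(a <- undup (0 :: t)) phi a * a * (r a)%:R].
Proof.
move=> ct; set s := undup (0 :: t).
have [N cN] : exists N, forall v, hor (ad c) (\prod_(a <- s) ('X - a%:P) ^+ N) v = 0.
  by exists (size t).+1; apply: split_by_gen.
have us : uniq s by apply: undup_uniq.
have [P HP] := primary_decomposition (ad c) N us.
have P1 v := proj1 (HP v (cN v)); have P2 a v := proj2 (HP v (cN v)) a.
pose p a := hor (ad c) (P a); exists (fun a => \rank (mxof (vbasis {:L}) (vbasis {:L}) (p a))).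
have p0 a : \rank (mxof (vbasis {:L}) (vbasis {:L}) (p a)) = 0 -> p a = 0.
  by move/eqP; rewrite rank_mxof_eq0 => /eqP.
split=> [H|phi aphi].
  exists N => v; have s0 : 0 \in s by rewrite mem_undup mem_head.
  rewrite [v]P1 (bigD1_seq 0) //= big1_seq => [|a /andP [a0 sa]]; last first.
    by rewrite -/(p a) p0 ?H // zero_lfunE.
  rewrite addr0 -[RHS](P2 0 v s0) polyC0 subr0; elim: (N) => [|n IHn].
    by rewrite expr0 hor1.
  by rewrite iterS IHn exprS horM horX.
pose D : 'End(L) := \sum_(a <- s) phi a *: p a.
have DE v : D v = \sum_(a <- s) phi a *: p a v.
  by rewrite sum_lfunE; apply: eq_bigr => a _; rewrite scale_lfunE.
have copX (a b : K) m n : a != b -> coprimep (('X - a%:P) ^+ m) (('X - b%:P) ^+ n).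
  move=> ab; apply/coprimep_expl/coprimep_expr.
  by rewrite coprimep_XsubC root_XsubC eq_sym.
have gen0 b n x : b \notin s -> hor (ad c) (('X - b%:P) ^+ n) x = 0 -> x = 0.
  move=> sb xb; apply: coprime_eq0 xb (cN x).
  rewrite big_seq; apply: (big_ind (fun q => coprimep _ q)).
  - exact: coprimep1.
  - by move=> q q' cq cq'; rewrite coprimepMr cq.
  - by move=> a sa; apply: copX; apply: contraNneq sb => ->.
have p_gen a v : a \in s -> hor (ad c) (('X - a%:P) ^+ N) (p a v) = 0 by exact: P2.
have p_other a b n x : b \in s -> b != a -> hor (ad c) (('X - a%:P) ^+ n) x = 0 -> p b x = 0.
  move=> sb ba xa; apply: (coprime_eq0 (copX _ _ N n ba)); first exact: p_gen.
  by rewrite -horM mulrC horM xa linear0.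
have p_id a n x : a \in s -> hor (ad c) (('X - a%:P) ^+ n) x = 0 -> p a x = x.
  move=> sa xa; rewrite {2}[x]P1 (bigD1_seq a) //= big1_seq ?addr0 // => b.
  by case/andP=> ba sb; apply: p_other xa.
have Dgen a n x : a \in s -> hor (ad c) (('X - a%:P) ^+ n) x = 0 -> D x = phi a *: x.
  move=> sa xa; rewrite DE (bigD1_seq a) //= (p_id _ _ _ sa xa) big1_seq ?addr0 // => b.
  by case/andP=> ba sb; rewrite (p_other _ _ _ _ sb ba xa) scaler0.
have dD : derivation D.
  have hom a b x y : a \in s -> b \in s ->
      D [lie p a x, p b y] = [lie D (p a x), p b y] + [lie p a x, D (p b y)].
    move=> sa sb; rewrite (Dgen _ _ _ sa (p_gen _ _ sa)) (Dgen _ _ _ sb (p_gen _ _ sb)).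
    rewrite lieZl lieZr -scalerDl.
    have gab := hor_lie (p_gen _ x sa) (p_gen _ y sb).
    have [sab|sab] := boolP (a + b \in s); last by rewrite (gen0 _ _ _ sab gab) linear0 scaler0.
    by rewrite (Dgen _ _ _ sab gab) aphi // -mem_undup.
  have D_sum (F : K -> L) : D (\sum_(a <- s) F a) = \sum_(a <- s) D (F a).
    exact: linear_sum.
  move=> x y; rewrite [x]P1 [y]P1; move: y => y.
  rewrite !(D_sum, lie_suml) -big_split [LHS]big_seq [RHS]big_seq.
  apply: eq_bigr => a sa /=; rewrite !(D_sum, lie_sumr) -big_split [LHS]big_seq [RHS]big_seq.
  by apply: eq_bigr => b sb /=; apply: hom.
have [d dE] := derivation_inner nL dD.
have adDE v : [lie d, v] = \sum_(a <- s) phi a *: p a v by rewrite -adE -dE DE.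
have phi0 : phi 0 = 0.
  apply: (addIr (phi 0)); rewrite -aphi ?addr0 ?mem_head //.
  by rewrite add0r.
exists d; split.
- move=> U cU x xU; rewrite adDE; apply: memv_suml => a _; apply: memvZ.
  by apply: hor_stable => // v; rewrite adE; apply: cU.
- move=> x a sa cx; rewrite -adE -dE (Dgen a 1%N) ?mem_undup //.
  by rewrite expr1 horXsubC adE cx subrr.
- move=> v; rewrite [v]P1 linear_sum big1_seq // => a /andP [_ sa].
  apply: hor_prod_zero; exists (phi a); first by rewrite mem_undup map_f // -mem_undup.
  by rewrite -dE (Dgen a N) // p_gen.
rewrite killingE -dE.
have -> : (ad c \o D)%VF = \sum_(a <- s) phi a *: (ad c \o p a)%VF.
  apply/lfunP => v; rewrite comp_lfunE DE sum_lfunE linear_sum; apply: eq_bigr => a _.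
  by rewrite scale_lfunE comp_lfunE linearZ.
rewrite etr_sum big_seq [RHS]big_seq; apply: eq_bigr => a sa; rewrite etrZ -mulrA; congr (_ * _).
(* On the image of [p a], [ad c] is [a] plus a nilpotent map, so the trace is [a] times the rank of
   the projection. *)
have -> : (ad c \o p a)%VF = a *: p a + hor (ad c) (('X - a%:P) * P a).
  by apply/lfunP => v; rewrite add_lfunE scale_lfunE comp_lfunE horM horXsubC addrC subrK.
rewrite etrD etrZ etr_idem => [|v]; last by rewrite (p_id _ N) // p_gen.
rewrite [X in _ + X]etr_nilp ?addr0 //; exists N.+1 => v.
have itE n w : iter n (hor (ad c) (('X - a%:P) * P a)) w =
    hor (ad c) ((('X - a%:P) * P a) ^+ n) w.
  by elim: n => [|n IHn] /=; rewrite ?hor1 // IHn -horM -exprS.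
rewrite itE exprMn exprS [P a ^+ _]exprSr mulrACA horM.
by rewrite [hor _ (_ * P a) v]horM p_gen // linear0.
Qed.

(* Cartan's trick: the functionals [phi] are the coordinates on the rational span
   of the eigenvalues, for which the trace form takes a sum of squares. *)
Lemma nilp_of_orthogonal_parts c t : split_by (ad c) t ->
  (forall d,
     (forall U, (forall x, x \in U -> [lie c, x] \in U) ->
        forall x, x \in U -> [lie d, x] \in U) ->
     (forall x, [lie c, x] = 0 -> [lie d, x] = 0) ->
     (exists2 s, uniq s & split_by (ad d) s) -> killing c d = 0) ->
  nilpotent_end (ad c).
Proof.
move=> ct H; have [r [r0 rphi]] := additive_parts ct.
set s := undup (0 :: t) in r0 rphi.
have [m [e [C [D [D0 EC ind]]]]] := integral_coordinates (0 :: t).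
apply: r0 => a sa; apply: contra_neq_eq => ra.
have Ca i : C a i = 0.
  have aphi : additive_on (0 :: t) (fun b => (C b i)%:~R).
    move=> b b' tb tb' tbb'; rewrite -intrD; congr (_%:~R).
    apply/eqP; rewrite -subr_eq0; apply/eqP.
    apply: (ind (fun j => C (b + b') j - (C b j + C b' j))).
    rewrite (eq_bigr (fun j => (C (b + b') j)%:~R * e j -
        ((C b j)%:~R * e j + (C b' j)%:~R * e j))) => [|j _].
      by rewrite sumrB big_split /= -!EC // -mulrDr subrr.
    by rewrite intrB intrD mulrBl mulrDl.
  have [d [d1 d2 d3 d4]] := rphi _ aphi.
  have phi0 : (C 0 i)%:~R = 0 :> K.
    by apply: (addIr (C 0 i)%:~R); rewrite -aphi ?mem_head ?add0r ?mem_head.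
  have kcd : killing c d = 0.
    apply: H => // [x cx|]; first by rewrite (d2 x 0) ?mem_head ?scale0r // phi0 scale0r.
    by exists (undup [seq (C b i)%:~R | b <- 0 :: t]); rewrite ?undup_uniq.
  (* Expanding [D * killing c d] in the independent [e j] gives integer coefficients that all
     vanish; the one with [j = i] is the sum of squares. *)
  have E : \sum_j (\sum_(b <- s) C b i * C b j * (r b)%:Z)%:~R * e j = 0.
    have E : D%:~R * killing c d = 0 by rewrite kcd mulr0.
    move: E; rewrite d4 mulr_sumr => E; rewrite -[RHS]E {E}.
    rewrite [LHS](eq_bigr (fun j => \sum_(b <- s) (C b i * C b j * (r b)%:Z)%:~R * e j)); last first.
      by move=> j _; rewrite -mulr_suml rmorph_sum.
    rewrite [LHS]exchange_big /= [LHS]big_seq [RHS]big_seq; apply: eq_bigr => b sb.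
    have -> : D%:~R * ((C b i)%:~R * b * (r b)%:R) =
      ((C b i)%:~R * (r b)%:R) * (D%:~R * b) :> K by ring.
    have tb : b \in 0 :: t by rewrite -mem_undup.
    rewrite (EC _ tb) mulr_sumr; apply: eq_bigr => j _.
    by rewrite !intrM -pmulrn; ring.
  have {}E := ind (fun j => \sum_(b <- s) C b i * C b j * (r b)%:Z) E i.
  have : C a i * C a i * (r a)%:Z = 0.
    apply/eqP; have /eqP := E; rewrite psumr_eq0 => [/allP /(_ a sa) //|b _].
    by rewrite mulr_ge0 // -expr2 sqr_ge0.
  move/eqP; rewrite !mulf_eq0 orbb => /orP [/eqP //|].
  by move/eqP=> [ra0]; rewrite ra0 in ra.
apply/eqP; rewrite -(mulrI_eq0 _ (mulfI (intr_neq0 ch0 D0))) EC; last by rewrite -mem_undup.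
by rewrite big1 // => i _; rewrite Ca mul0r.
Qed.

(** Jacobson's lemma: since [f] commutes with the powers of [D], the trace of [(f g - g f) D ^ n] is
    0 for every [n]. *)
Lemma nilp_comm_trace (f g : 'End(L)) (D := (f \o g)%VF - (g \o f)%VF) :
  (f \o D)%VF = (D \o f)%VF -> nilpotent_end D.
Proof.
move=> fD; apply: nilp_etr => // n.
have fDn : (f \o fexp D n)%VF = (fexp D n \o f)%VF.
  elim: n => [|n IHn] /=; first by rewrite comp_lfun1r comp_lfun1l.
  by rewrite -/(fexp D n) comp_lfunA fD -[LHS]comp_lfunA IHn comp_lfunA.
rewrite /= -/(fexp D n) {1}/D comp_lfunDl comp_lfunNl etrD etrN.
rewrite -[((g \o f) \o _)%VF]comp_lfunA fDn [(g \o (_ \o f))%VF]comp_lfunA.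
by rewrite [etr (_ \o f)%VF]etrC [(f \o (g \o _))%VF]comp_lfunA subrr.
Qed.

(** Jacobson's lemma makes [D = ad [lie y, w]] nilpotent, and [D] commutes with [E = ad y]. On the
    kernel of [E ^ n.+1], applying [E ^ n] turns [T = E W] into [(n + 1) D]; hence [M] applications
    of [T] lead into the kernel of [E ^ n], and [T] is nilpotent. *)
Lemma killing_nilp_comm y w : nilpotent_end (ad y) -> [lie y, [lie y, w]] = 0 -> killing y w = 0.
Proof.
move=> [N yN] yyw; pose E := ad y; pose W := ad w; pose D := ad [lie y, w].
have EW v : E (W v) = W (E v) + D v by rewrite /E /W /D !adE lieAl addrC subrK.
have ED v : E (D v) = D (E v).
  by rewrite /E /D !adE lieA yyw lie0l add0r.
have [M DM] : nilpotent_end D.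
  rewrite /D ad_br; apply: nilp_comm_trace; rewrite -ad_br.
  by apply/lfunP => v; rewrite !comp_lfunE; exact: ED.
have EnD n v : iter n E (D v) = D (iter n E v) by elim: n => //= n ->.
have EnW n v : iter n.+1 E (W v) = W (iter n.+1 E v) + n.+1%:R *: D (iter n E v).
  elim: n => [|n IHn]; first by rewrite scale1r /= EW.
  rewrite iterS IHn linearD /= EW -addrA; congr (_ + _).
  by rewrite linearZ /= ED -[in RHS]natr1 scalerDl scale1r addrC.
rewrite killingE; apply: etr_nilp; rewrite -/E -/W.
pose T : 'End(L) := (E \o W)%VF; rewrite -/T.
have EnT n v : iter n.+1 E v = 0 -> iter n E (T v) = n.+1%:R *: D (iter n E v).
  by move=> Ev; rewrite comp_lfunE -iterSr EnW Ev linear0 add0r.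
have EnTi n k v : iter n.+1 E v = 0 ->
    iter n.+1 E (iter k T v) = 0 /\ iter n E (iter k T v) = n.+1%:R ^+ k *: iter k D (iter n E v).
  move=> Ev; elim: k => [|k [IH1 IH2]]; first by rewrite expr0 scale1r.
  split; last by rewrite iterS EnT // IH2 linearZ scalerA -exprS.
  by rewrite !iterS EnT // linearZ /= ED -iterS IH1 linear0 scaler0.
have step n v : iter n.+1 E v = 0 -> iter n E (iter M T v) = 0.
  by move=> /EnTi -/(_ M) [_ ->]; rewrite DM scaler0.
exists (N * M)%N => v; have: iter N E v = 0 by apply: yN.
elim: N {yN} v => [//|n IHn] v /step /IHn.
by rewrite -iterD mulSn addnC.
Qed.

(** Since [w] is not assumed to be an eigenvector of [ad h], there is no full triple to rely on. On
    the kernel of [E], [H - i] maps the image of [E ^ i] into that of [E ^ i.+1], so the eigenvalues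
    there are among 0, ..., N - 1. The map [E ^ m] carries the kernel of [E ^ m.+1] into that of [E]
    and shifts the eigenvalues by [2 m]. *)
Lemma split_by_int y h : nilpotent_end (ad y) -> [lie h, y] = y *+ 2 ->
  (exists w, h = [lie w, y]) ->
  exists js : seq int, split_by (ad h) [seq j%:~R | j <- js].
Proof.
move=> [N yN] hy [w hwy]; pose E := ad y; pose W := ad w; pose H := ad h.
have HE v : H (E v) = E (H v) + E v *+ 2.
  by rewrite /H /E !adE lieA hy addrC mulr2n lieDl mulr2n.
have WE v : W (E v) = E (W v) + H v.
  by rewrite /W /E /H !adE hwy lieAl addrC subrK.
have HEn n v : H (iter n E v) = iter n E (H v) + iter n E v *+ (2 * n).
  elim: n => [|n IHn] /=; first by rewrite muln0 addr0.
  by rewrite HE IHn linearD -addrA linearMn -mulrnDr mulnS addnC.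
have WEn n v : W (iter n.+1 E v) =
    iter n.+1 E (W v) + (H (iter n E v) - iter n E v *+ n) *+ n.+1.
  elim: n => [|n IHn]; first by rewrite /= WE subr0.
  rewrite iterS WE IHn linearD /= -addrA; congr (_ + _).
  rewrite linearMn linearB linearMn /=.
  have -> : E (H (iter n E v)) = H (E (iter n E v)) - E (iter n E v) *+ 2.
    by rewrite HE addrK.
  rewrite -addrA -opprD -mulrnDr !mulrnBl -!mulrnA addrAC -mulrSr.
  by rewrite [in RHS]mulnC.
have itD k u v : iter k E (u + v) = iter k E u + iter k E v.
    by elim: k => //= k ->; rewrite linearD.
have itZ k a v : iter k E (a *: v) = a *: iter k E v.
    by elim: k => //= k ->; rewrite linearZ.
have ker_step n i v u : E v = 0 -> v = iter i E u -> exists u',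
    hor H (\prod_(j <- iota i n) ('X - j%:R%:P)) v = iter (i + n) E u'.
  elim: n i v u => [|n IHn] i v u Ev vu.
    by exists u; rewrite big_nil hor1 addn0.
  rewrite /= big_cons mulrC horM horXsubC addnS -addSn.
  apply: (IHn i.+1 _ (- (i.+1%:R^-1 *: W u))).
    rewrite linearB linearZ /= Ev scaler0 subr0.
    by apply: (addIr (E v *+ 2)); rewrite -HE Ev linear0 mul0rn addr0.
  have := WEn i u; rewrite iterS -vu Ev linear0 => /eqP.
  rewrite eq_sym addrC addr_eq0 => /eqP E1.
  have -> : H v - i%:R *: v = i.+1%:R^-1 *: ((H v - v *+ i) *+ i.+1).
    by rewrite -scaler_nat scalerA mulVf // scale1r scaler_nat.
  by rewrite E1 scalerN -scaleNr -itZ scaleNr.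
have shift m (js : seq int) v :
    iter m E (hor H (\prod_(j <- js) ('X - (j - (2 * m)%:Z)%:~R%:P)) v) =
    hor H (\prod_(j <- js) ('X - j%:~R%:P)) (iter m E v).
  elim: js v => [|j js IHjs] v; first by rewrite !big_nil !hor1.
  rewrite !big_cons mulrC [in RHS]mulrC !horM IHjs; congr (hor _ _ _).
  rewrite !horXsubC HEn intrB scalerBl opprB addrA.
  by rewrite itD -scaleN1r !itD !itZ scaleN1r -pmulrn scaler_nat addrAC.
have all_m m : exists js : seq int, forall v, iter m E v = 0 ->
    hor H (\prod_(j <- js) ('X - j%:~R%:P)) v = 0.
  elim: m => [|m [js IHm]]; first by exists [::] => v /= ->; rewrite linear0.
  exists (js ++ [seq j - (2 * m)%:Z | j <- [seq j%:Z | j <- iota 0 N]]) => v Ev.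
  rewrite big_cat horM big_map; apply: IHm; rewrite shift big_map.
  by have [u' ->] := ker_step N 0 _ _ Ev erefl; apply: yN.
have [js Hjs] := all_m N; exists js => v; rewrite big_map; apply: Hjs; exact: yN.
Qed.

End AdditiveParts.

(** * Reductive subalgebras *)

Section Reductive.
Variables (K : fieldType) (L : lieType K).
Hypothesis ch0 : forall n, n.+1%:R != 0 :> K.
Implicit Types (x y z h d v w : L) (U V W S I J : {vspace L}).

Definition killing_with w : L -> K^o := killing w.

Fact killing_with_linear w : linear (killing_with w).
Proof. by move=> c x y; rewrite /killing_with killingDr killingZr. Qed.

HB.instance Definition _ w :=
  GRing.isLinear.Build K L K^o _ (killing_with w) (killing_with_linear w).

Definition perp U W : {vspace L} :=
  (U :&: \bigcap_(i < \dim W) lker (linfun (killing_with (vbasis W)`_i)))%VS.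

Lemma perpP U W x : reflect (x \in U /\ forall w, w \in W -> killing x w = 0)
  (x \in perp U W).
Proof.
apply: (iffP memv_capP) => -[xU xW]; split=> //.
  move=> w wW; rewrite (coord_vbasis wW) killing_sumr big1 // => i _.
  move: xW; rewrite memvE => /subv_bigcapP /(_ i isT).
  rewrite -memvE memv_ker lfunE /= /killing_with => /eqP E.
  by rewrite killingZr killingC E mulr0.
rewrite memvE; apply/subv_bigcapP => i _; rewrite -memvE memv_ker lfunE /=.
by rewrite /killing_with killingC xW // vbasis_mem // mem_nth // size_tuple.
Qed.

Lemma perp_sub U W : (perp U W <= U)%VS.
Proof. exact: capvSl. Qed.

Lemma perp_add U W : (W <= U)%VS -> nondegenerate_on W ->
  (W + perp U W = U)%VS /\ (W :&: perp U W = 0)%VS.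
Proof.
move=> WU nW; split; last first.
  apply/eqP; rewrite -subv0; apply/subvP => x /memv_capP [xW /perpP [_ xp]].
  by rewrite memv0; apply/eqP/nW.
apply/eqP; rewrite eqEsubv subv_add WU perp_sub; apply/subvP => x xU.
have [|y yW yE] := killing_repr (phi := killing x) nW.
  by move=> c u v; rewrite killingDr killingZr.
apply/memv_addP; exists y => //; exists (x - y); last by rewrite addrC subrK.
apply/perpP; split; first by rewrite memvB // (subvP WU).
by move=> w wW; rewrite killingDl killingNl yE // subrr.
Qed.

Lemma solvable_abelian J : (forall x y, x \in J -> y \in J -> [lie x, y] = 0) ->
  solvable_lie J.
Proof.
move=> JJ; exists 1; apply/eqP; rewrite -subv0; apply: brvP => x y xJ yJ.
by rewrite JJ // mem0v.
Qed.

Lemma perp_ideal S I : is_subalgebra S -> is_ideal I S -> is_ideal (perp S I) S.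
Proof.
move=> /is_subalgebraP sS /is_idealP [IS sI]; apply/is_idealP; split.
  exact: perp_sub.
move=> x y xS /perpP [yS yI]; apply/perpP; split; first exact: sS.
by move=> w wI; rewrite lieC killingNl killing_inv yI ?oppr0 // sI.
Qed.

Section NondegenerateSubalgebra.
Variable S : {vspace L}.
Hypotheses (sS : is_subalgebra S) (nS : nondegenerate_on S).

(** The bracket [[lie x, y]] lies in [J] and in [brv S S], hence is orthogonal to [S]. *)
Lemma solvable_ideal_central J x y : is_ideal J S -> solvable_lie J ->
  x \in S -> y \in J -> [lie x, y] = 0.
Proof.
move=> iJ solJ xS yJ; have [JS sJ] := is_idealP iJ.
have zJ := sJ x y xS yJ; apply: nS => [|s sS']; first exact: (subvP JS).
rewrite killingC; apply: (solvable_ideal_killing ch0 sS iJ solJ) => //.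
by apply: brv_mem => //; apply: (subvP JS).
Qed.

(** Invariance of the form makes an isotropic ideal abelian, which reduces to the solvable case. *)
Lemma isotropic_ideal_central J x y : is_ideal J S ->
  (forall u v, u \in J -> v \in J -> killing u v = 0) ->
  x \in S -> y \in J -> [lie x, y] = 0.
Proof.
move=> iJ isoJ; have [JS sJ] := is_idealP iJ.
apply: solvable_ideal_central => //; apply: solvable_abelian => u v uJ vJ.
apply: nS => [|s sS']; first by apply: (subvP JS); apply: sJ => //; apply: (subvP JS).
by rewrite killing_inv isoJ // lieC memvN sJ.
Qed.

Lemma central_derived_eq0 x : x \in S -> (forall y, y \in S -> [lie y, x] = 0) ->
  x \in brv S S -> x = 0.
Proof.
move=> xS cx xSS; apply: nS => // y yS; rewrite killingC.
apply: (solvable_ideal_killing ch0 (J := <[x]>%VS) sS) => //; last exact: memv_line.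
  apply/is_idealP; split; first by rewrite -memvE.
  by move=> u v uS /vlineP [k ->]; rewrite lieZr cx // scaler0 mem0v.
by apply: solvable_abelian => u v; exact: lie_line.
Qed.

(** The radical of the form on [J] is an isotropic ideal, hence central, and central elements of
    [brv S S] vanish. *)
Lemma isotropic_ideal_derived J : is_ideal J S -> (J <= brv S S)%VS ->
  nondegenerate_on J.
Proof.
move=> iJ JSS x xJ xp; have [JS sJ] := is_idealP iJ.
have iC := ideal_cap iJ (perp_ideal sS iJ).
apply: central_derived_eq0; [exact: (subvP JS)| |exact: (subvP JSS)] => y yS.
apply: (isotropic_ideal_central iC) => // [u v /memv_capP [_ /perpP [_ up]] /memv_capP [vJ _]|].
  exact: up.
by apply/memv_capP; split=> //; apply/perpP; split=> //; apply: (subvP JS).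
Qed.

(* For an ideal [I], [[S, I]] is complemented by its orthogonal [P], in which
   [I :&: P] is central, hence meets [[S, P]] trivially. *)
Lemma nondegenerate_reductive : reductive_lie S.
Proof.
move=> I iI; have [IS sI] := is_idealP iI.
have SS : stable S S by apply/is_subalgebraP.
pose I1 := brv S I; have I1I : (I1 <= I)%VS by apply: brvP.
have I1S := subv_trans I1I IS.
have iI1 : is_ideal I1 S by apply/is_idealP; split=> //; apply: stable_brv.
have [E1 E2] := perp_add I1S (isotropic_ideal_derived iI1 (brvS (subvv _) IS)).
set P := perp S I1 in E1 E2.
have [PS sP] := is_idealP (perp_ideal sS iI1).
pose Z := (I :&: P)%VS; pose B := brv S P.
have BP : (B <= P)%VS by apply: brvP.
have ZB : (Z :&: B = 0)%VS.
  apply/eqP; rewrite -subv0; apply/subvP => x /memv_capP [/memv_capP [xI xP] xB].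
  rewrite memv0; apply/eqP/central_derived_eq0; first exact: (subvP IS).
    move=> y yS; apply/eqP; rewrite -memv0 -E2; apply/memv_capP.
    by split; [apply: brv_mem|apply: sP].
  by apply: (subvP (brvS (subvv _) PS)).
(* Every subspace between [B = [S, P]] and [P] is an ideal, so an arbitrary linear complement [W] of
   [Z + B] in [P] will do. *)
pose W := (P :\: (Z + B))%VS; pose C := (B + W)%VS.
have CP : (C <= P)%VS by rewrite subv_add BP diffvSl.
exists C; split.
- apply/is_idealP; split; first exact: subv_trans CP PS.
  move=> x y xS yC; apply: memv_addl; apply: brv_mem => //.
  exact: (subvP CP).
- apply/eqP; rewrite eqEsubv subv_add IS (subv_trans CP PS) /= -{1}E1 subv_add.
  rewrite (subv_trans I1I) ?addvSl //=.
  have : (P <= Z + C)%VS.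
    rewrite /C addvA addvC addv_diff; exact: addvSl.
  by move/subv_trans; apply; apply: addvS => //; apply: capvSl.
apply/eqP; rewrite -subv0; apply/subvP => x /memv_capP [xI xC].
have xZ : x \in Z by apply/memv_capP; split=> //; apply: (subvP CP).
move/memv_addP: xC => [b bB [w wW E]].
have w0 : w = 0.
  apply/eqP; rewrite -memv0 -(capv_diff P (Z + B)%VS); apply/memv_capP; split=> //.
  have -> : w = x - b by rewrite E addrC addKr.
  by apply: memvB; [apply: memv_addl|apply: memv_addr].
rewrite -ZB; apply/memv_capP; split=> //; by rewrite E w0 addr0.
Qed.

End NondegenerateSubalgebra.

(* An abelian ideal [A <= [J, J]] vanishes: if [A'] is a complementary ideal then
   [A] is central and [J, J <= A']. *)
Lemma reductive_solvable_central S J x y : is_subalgebra S -> reductive_lie S ->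
  is_ideal J S -> solvable_lie J -> x \in S -> y \in J -> [lie x, y] = 0.
Proof.
move=> sS rS iJ [n solJ] xS yJ; have SS : stable S S by apply/is_subalgebraP.
have abel A : is_ideal A S -> brv A A = 0%VS -> exists A', [/\ is_ideal A' S,
    (A + A')%VS = S, (A :&: A')%VS = 0%VS & forall u v, u \in S -> v \in A -> [lie u, v] = 0].
  move=> iA AA; have [A' [iA' E1 E2]] := rS A iA; exists A'; split=> // u v.
  have [_ sA] := is_idealP iA; have [A'S sA'] := is_idealP iA'.
  rewrite -{1}E1 => /memv_addP [w wA [w' wA' ->]] vA; rewrite lieDl.
  have /eqP -> : [lie w, v] == 0 by rewrite -memv0 -AA brv_mem.
  rewrite add0r; apply/eqP; rewrite -memv0 -E2; apply/memv_capP; split.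
    by rewrite sA // (subvP A'S).
  by rewrite lieC memvN sA' // -E1 memv_addl.
have [JS sJ] := is_idealP iJ.
have iD m : is_ideal (derived m J) S /\ (derived m J <= J)%VS.
  elim: m => [|m [/is_idealP [DS sD] DJ]] /=; first by split.
  have DD : (brv (derived m J) (derived m J) <= derived m J)%VS.
    by apply: brvP => u v /(subvP DS); apply: sD.
  split; last exact: subv_trans DD DJ.
  by apply/is_idealP; split; [exact: subv_trans DD DS|exact: stable_brv].
have JJ0 : brv J J = 0%VS.
  elim: n solJ => [/= ->|m IHm Em].
    by apply/eqP; rewrite -subv0; apply: brvP => u v; rewrite memv0 => /eqP ->; rewrite lie0l mem0v.
  case: m IHm Em => [//|m] IHm Em; apply: IHm.
  have [iA _] := iD m.+1; have [A' [iA' E1 E2 cA]] := abel _ iA Em.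
  have [_ sA'] := is_idealP iA'.
  apply/eqP; rewrite -subv0 -E2 subv_cap subvv.
  apply: subv_trans (_ : brv J J <= A')%VS; first by apply: brvS; case: (iD m).
  apply: brvP => u v uJ /(subvP JS); rewrite -{1}E1 => /memv_addP [w wA [w' wA' ->]].
  have uS := subvP JS _ uJ.
  by rewrite lieDr cA // add0r sA'.
by have [_ [_ _ _ cJ]] := abel J iJ JJ0; apply: cJ.
Qed.

(* The first steps of the Jacobson-Morozov theorem, with the semisimple part of
   the neutral element. *)
Lemma nilp_split_element M y : nondegenerate_on {:L} -> is_subalgebra M ->
  nondegenerate_on M -> y \in M -> nilpotent_end (ad y) ->
  exists d, [/\ exists2 s, uniq s & split_by (ad d) s, [lie d, y] = y *+ 2
    & forall x, (forall m, m \in M -> [lie m, x] = 0) -> [lie d, x] = 0].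
Proof.
move=> nL /is_subalgebraP sM nM yM ny.
(* By biorthogonality it suffices to treat [z] in [M] orthogonal to [[y, [y, M]]]. Invariance gives
   [[y, [y, z]] = 0], and then the nilpotent [y] is orthogonal to [z]. *)
have : y \in (ad y @: (ad y @: M))%VS.
  apply: (killing_biorthogonal nM) => //.
    apply/subvP => x /memv_imgP [x1 /memv_imgP [x2 x2M ->] ->].
    by rewrite !adE; apply: (sM) => //; apply: sM.
  move=> z zM zW; rewrite killingC; apply: (killing_nilp_comm ch0) => //.
  apply: nM => [|m mM]; first by apply: (sM) => //; apply: sM.
  rewrite lieC killingNl killing_inv lieC killingNl killing_inv opprK.
  by apply: zW; rewrite -!adE; do 2!apply: memv_img.
case/memv_imgP=> y1 /memv_imgP [w wM ->]; rewrite !adE => Ey.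
pose h := [lie w *+ 2, y]; have hy : [lie h, y] = y *+ 2.
  rewrite /h -scaler_nat lieZl lieZl -scaler_nat; congr (_ *: _).
  by rewrite [RHS]Ey lieC [[lie w, y]]lieC lieNr opprK.
have hM : h \in M by rewrite /h; apply: sM => //; rewrite rpredMn.
have [|js Hjs] := split_by_int ch0 ny hy; first by exists (w *+ 2).
(* The eigenvalue 2 of [y] is put in the list because [additive_parts] speaks only of listed
   eigenvalues. With [phi = id] it returns the semisimple part of [h]. *)
have h_split : split_by (ad h) (2%:R :: [seq j%:~R | j <- js]).
  by move=> v; rewrite big_cons horM Hjs linear0.
have [r [_ /(_ id)]] := additive_parts nL h_split.
case=> [//|d [d1 d2 d3 _]]; exists d; split.
- by exists (undup [seq id i | i <- 0 :: 2%:R :: [seq j%:~R | j <- js]]); rewrite ?undup_uniq.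
- by rewrite (d2 y 2%:R) ?scaler_nat // !inE eqxx orbT.
by move=> x Mx; rewrite (d2 x 0) ?mem_head ?scale0r // Mx.
Qed.

End Reductive.

(** * Borel subalgebras and gradings *)

Lemma exists_argmin T (P : T -> Prop) (f : T -> nat) : (exists x, P x) ->
  exists x, P x /\ forall y, P y -> (f x <= f y)%N.
Proof.
case=> x; have [n] := ubnP (f x); elim: n x => // n IHn x le Px.
case: (classic (exists y, P y /\ (f y < f x)%N)) => [[y [Py ylt]]|no].
  by apply: (IHn y) => //; apply: leq_trans ylt _.
exists x; split=> // y Py; rewrite leqNgt; apply/negP => lt.
by apply: no; exists y.
Qed.

Section Solvable.
Variables (K : fieldType) (L : lieType K).
Implicit Types (x y z h d v w : L) (U V W S I J B b : {vspace L}).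

Lemma derivedS n U V : (U <= V)%VS -> (derived n U <= derived n V)%VS.
Proof. by elim: n => //= n IHn /IHn sUV; apply: brvS. Qed.

Lemma solvableS U V : (U <= V)%VS -> solvable_lie V -> solvable_lie U.
Proof.
by move=> UV [n En]; exists n; apply/eqP; rewrite -subv0 -En; apply: derivedS.
Qed.

Lemma derivedD m n U : derived (m + n) U = derived m (derived n U).
Proof. exact: iterD. Qed.

Lemma derived_sub n U : is_subalgebra U -> (derived n U <= U)%VS.
Proof.
move=> sU; elim: n => //= n IHn; apply: subv_trans sU; exact: brvS.
Qed.

Lemma solvable_add S J : is_subalgebra S -> solvable_lie S -> solvable_lie J ->
  is_subalgebra J -> stable S J -> solvable_lie (S + J).
Proof.
move=> sS [n En] [m Em] sJ SJ; exists (m + n)%N; rewrite derivedD.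
suff H k : (derived k (S + J) <= derived k S + J)%VS.
  by apply/eqP; rewrite -subv0 -Em; apply: derivedS; have := H n; rewrite En add0v.
elim: k => [|k IHk] //=; apply: subv_trans (brvS IHk IHk) _.
apply: brvP => x y /memv_addP [s sk [j jJ ->]] /memv_addP [s' sk' [j' jJ' ->]].
have dS u : u \in derived k S -> u \in S by apply/subvP/derived_sub.
have JJ := is_subalgebraP sJ.
rewrite lieDl !lieDr -addrA; apply: memv_add; first exact: brv_mem.
apply: memvD; first by apply: SJ => //; apply: dS.
by apply: memvD; [rewrite lieC memvN; apply: SJ => //; apply: dS|apply: JJ].
Qed.

Lemma subalgebra_add S J : is_subalgebra S -> is_subalgebra J -> stable S J ->
  is_subalgebra (S + J).
Proof.
move=> /is_subalgebraP sS /is_subalgebraP sJ SJ; apply/is_subalgebraP.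
move=> x y /memv_addP [s sk [j jJ ->]] /memv_addP [s' sk' [j' jJ' ->]].
rewrite lieDl !lieDr -addrA; apply: memv_add; first exact: sS.
apply: memvD; first exact: SJ.
by apply: memvD; [rewrite lieC memvN; apply: SJ|apply: sJ].
Qed.

Lemma subalgebra_cap U V : is_subalgebra U -> is_subalgebra V ->
  is_subalgebra (U :&: V).
Proof.
move=> /is_subalgebraP sU /is_subalgebraP sV; apply/is_subalgebraP.
by move=> x y /memv_capP [xU xV] /memv_capP [yU yV]; apply/memv_capP; auto.
Qed.

Lemma borel_solvable_normalized S b J : is_subalgebra S -> is_borel b S ->
  (J <= S)%VS -> solvable_lie J -> is_subalgebra J -> stable b J -> (J <= b)%VS.
Proof.
move=> sS [bS sb solb maxb] JS solJ sJ bJ.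
have <- : (b + J)%VS = b; last exact: addvSr.
apply: maxb; rewrite ?addvSl ?subv_add ?bS //.
  exact: subalgebra_add.
exact: solvable_add.
Qed.

Lemma ideal_subalgebra S J : is_ideal J S -> is_subalgebra J.
Proof.
case/is_idealP=> /subvP JS sJ; apply/is_subalgebraP => x y xJ yJ.
by apply: sJ => //; apply: JS.
Qed.

Lemma borel_solvable_ideal S b J : is_subalgebra S -> is_borel b S ->
  is_ideal J S -> solvable_lie J -> (J <= b)%VS.
Proof.
move=> sS bb iJ solJ; have [JS sJ] := is_idealP iJ.
apply: (borel_solvable_normalized sS bb) => //; first exact: ideal_subalgebra iJ.
by case: bb => /subvP bS _ _ _ x y xb yJ; apply: sJ => //; apply: bS.
Qed.

Lemma exists_borel S : exists b, is_borel b S.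
Proof.
have [|b [[bS sb solb] bmin]] := exists_argmin (fun b : {vspace L} => \dim {:L} - \dim b)%N
    (P := fun b => [/\ (b <= S)%VS, is_subalgebra b & solvable_lie b]).
  exists 0%VS; split; [exact: sub0v| |by exists 0].
  by apply/is_subalgebraP => x y; rewrite !memv0 => /eqP -> _; rewrite lie0l.
exists b; split=> // B' B'S sB' solB' bB'; apply/eqP; rewrite eq_sym eqEdim bB' /=.
have := bmin B' (And3 B'S sB' solB'); rewrite leq_sub2lE //; exact/dimvS/subvf.
Qed.

End Solvable.

Section Grading.
Variables (K : fieldType) (L : lieType K).
Hypothesis ch0 : forall n, n.+1%:R != 0 :> K.
Variables (g : {vspace L}) (h : L) (js : seq int).
Hypothesis sg : is_subalgebra g.
Hypothesis hg : h \in g.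
Hypothesis ujs : uniq js.
Hypothesis gjs : forall x, x \in g ->
  hor (ad h) (\prod_(j <- js) ('X - j%:~R%:P)) x = 0.
Implicit Types (x y z : L) (P Q R : pred int) (b : {vspace L}).

Local Notation eig j := (leigenspace (ad h) j%:~R).

(* [js] only has to contain the eigenvalues of [ad h] on [g]. *)
Definition graded_part P : {vspace L} := (\sum_(j <- js | P j) (g :&: eig j))%VS.

Lemma graded_part_ind P (T : L -> Prop) : T 0 ->
  (forall x y, T x -> T y -> T (x + y)) ->
  (forall j x, j \in js -> P j -> x \in g -> [lie h, x] = j%:~R *: x -> T x) ->
  forall x, x \in graded_part P -> T x.
Proof.
move=> T0 TD Th x; rewrite /graded_part big_seq_cond.
elim/big_rec: _ x => [x|j U /andP [jjs Pj] IHU x].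
  by rewrite memv0 => /eqP ->.
case/memv_addP=> y /memv_capP [yg]; rewrite leigenspaceP adE => /eqP yj [z zU ->].
by apply: TD; [apply: (Th j)|apply: IHU].
Qed.

Lemma eigenvalue_mem x (c : K) : x \in g -> x != 0 -> [lie h, x] = c *: x ->
  exists2 j, j \in js & c = j%:~R.
Proof.
move=> xg x0 xc; have := gjs xg.
rewrite -(big_map (fun j : int => j%:~R : K) predT (fun e => 'X - e%:P)).
by move/hor_prod_eigenvalue => /(_ c x0); rewrite adE => /(_ xc) /mapP.
Qed.

Lemma graded_part_mem P j x : x \in g -> [lie h, x] = j%:~R *: x -> P j ->
  x \in graded_part P.
Proof.
move=> xg xj Pj; have [->|x0] := eqVneq x 0; first exact: mem0v.
have [i ijs /eqP] := eigenvalue_mem xg x0 xj; rewrite (intr_eq ch0) => /eqP ij.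
rewrite -{i}ij in ijs; rewrite /graded_part (big_rem j) //= Pj.
apply: memv_addl.
by apply/memv_capP; split=> //; rewrite leigenspaceP adE xj.
Qed.

Lemma graded_part_sub P : (graded_part P <= g)%VS.
Proof.
apply/subvP; apply: graded_part_ind => [|x y|//]; [exact: mem0v|exact: memvD].
Qed.

Lemma graded_partS P Q : (forall j, P j -> Q j) -> (graded_part P <= graded_part Q)%VS.
Proof.
move=> PQ; apply/subvP; apply: graded_part_ind => [|x y|j x _ Pj xg xj].
- exact: mem0v.
- exact: memvD.
by apply: (graded_part_mem xg xj); apply: PQ.
Qed.

Lemma graded_partT : graded_part predT = g.
Proof.
apply/eqP; rewrite eqEsubv graded_part_sub; apply/subvP => x xg.
have umap : uniq [seq j%:~R : K | j <- js].
  by rewrite map_inj_uniq // => i j /eqP; rewrite (intr_eq ch0) => /eqP.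
have stab y : y \in g -> ad h y \in g.
  by rewrite adE; apply: (is_subalgebraP sg).
have [P HP] := eigen_decomposition (ad h) umap.
have [|Ex Px] := HP x; first by rewrite big_map gjs.
rewrite Ex big_map big_seq; apply: memv_suml => j jjs.
apply: (graded_part_mem (j := j)) => //; first exact: hor_stable.
by rewrite -adE Px ?map_f.
Qed.

Lemma graded_partU P Q : (graded_part (predU P Q) <= graded_part P + graded_part Q)%VS.
Proof.
apply/subvP; apply: graded_part_ind => [|x y|j x _ /orP [Pj|Qj] xg xj].
- exact: mem0v.
- exact: memvD.
- by apply: memv_addl; apply: (graded_part_mem xg xj).
by apply: memv_addr; apply: (graded_part_mem xg xj).
Qed.

Lemma graded_part_disjoint P Q : (forall j, P j -> Q j -> false) ->
  (graded_part P :&: graded_part Q = 0)%VS.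
Proof.
move=> PQ; apply/eqP; rewrite -subv0; apply/subvP => x /memv_capP [xP xQ].
have kill R : forall y, y \in graded_part R ->
    hor (ad h) (\prod_(j <- js | R j) ('X - j%:~R%:P)) y = 0.
  apply: graded_part_ind => [|y z Ey Ez|j y jjs Rj yg yj]; first exact: linear0.
    by rewrite linearD /= Ey Ez addr0.
  rewrite (big_rem j) //= Rj mulrC horM horXsubC adE yj subrr; exact: linear0.
rewrite memv0; apply/eqP; apply: coprime_eq0 (kill _ _ xP) (kill _ _ xQ).
apply: (big_ind (fun q => coprimep _ q)); first exact: coprimep1.
  by move=> q q' cq cq'; rewrite coprimepMr cq.
move=> j Qj; apply: (big_ind (fun q => coprimep q _)); first exact: coprime1p.
  by move=> q q' cq cq'; rewrite coprimepMl cq.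
move=> i Pi; rewrite coprimep_XsubC root_XsubC (intr_eq ch0).
by apply: contraTN Pi => /eqP <-; apply/negP => /PQ /(_ Qj).
Qed.

Lemma graded_part_brv P Q R : (forall i j, P i -> Q j -> R (i + j)) ->
  forall x y, x \in graded_part P -> y \in graded_part Q -> [lie x, y] \in graded_part R.
Proof.
move=> PQR x y xP yQ; move: x xP.
apply: graded_part_ind => [|x x'|i x _ Pi xg xi].
- by rewrite lie0l mem0v.
- by rewrite lieDl; apply: memvD.
move: y yQ; apply: graded_part_ind => [|y y'|j y _ Qj yg yj].
- by rewrite lie0r mem0v.
- by rewrite lieDr; apply: memvD.
apply: (graded_part_mem (j := i + j)); last exact: PQR.
  exact: (is_subalgebraP sg).
by rewrite lieA xi yj lieZl lieZr -scalerDl intrD.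
Qed.

Lemma graded_part_orth P Q : (forall i j, P i -> Q j -> i + j != 0) ->
  forall x y, x \in graded_part P -> y \in graded_part Q -> killing x y = 0.
Proof.
move=> PQ x y xP yQ; move: x xP.
apply: graded_part_ind => [|x x' Ex Ex'|i x _ Pi xg xi].
- exact: killing0l.
- by rewrite killingDl Ex Ex' addr0.
move: y yQ; apply: graded_part_ind => [|y y' Ey Ey'|j y _ Qj yg yj].
- exact: killing0r.
- by rewrite killingDr Ey Ey' addr0.
have : (i + j)%:~R * killing x y = 0.
  rewrite intrD mulrDl -killingZl -xi -killingZr -yj -killing_inv.
  by rewrite lieC killingNl addNr.
by move/eqP; rewrite mulf_eq0 (negPf (intr_neq0 ch0 (PQ _ _ Pi Qj))) => /eqP.
Qed.

Definition levi_part := graded_part (fun j => j == 0).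
Definition pos_part := graded_part (fun j => 0 < j).
Definition neg_part := graded_part (fun j => j < 0).

Lemma levi_partE x : (x \in levi_part) = (x \in g) && ([lie h, x] == 0).
Proof.
apply/idP/andP => [xl|[xg /eqP xh]]; last first.
  by apply: (graded_part_mem (j := 0)) => //; rewrite xh scale0r.
split; first exact: (subvP (graded_part_sub _)) xl.
move: x xl; apply: graded_part_ind => [|x y /eqP Ex /eqP Ey|j x _ /eqP -> _ ->].
- by rewrite lie0r.
- by rewrite lieDr Ex Ey addr0.
by rewrite scale0r.
Qed.

Lemma h_levi : h \in levi_part.
Proof. by rewrite levi_partE hg lie_brxx eqxx. Qed.

Lemma levi_subalgebra : is_subalgebra levi_part.
Proof.
by apply/is_subalgebraP; apply: graded_part_brv => i j /eqP -> /eqP ->.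
Qed.

Lemma pos_subalgebra : is_subalgebra pos_part.
Proof. apply/is_subalgebraP; apply: graded_part_brv => i j; exact: addr_gt0. Qed.

Lemma levi_pos_stable : stable levi_part pos_part.
Proof. by apply: graded_part_brv => i j /eqP ->; rewrite add0r. Qed.

(** The [d]-th derived algebra lives in degrees greater than [d], and the degrees are bounded by
    [m]. *)
Lemma pos_solvable : solvable_lie pos_part.
Proof.
pose m := (\max_(j <- js) `|j|)%N.
exists m.+1; apply/eqP; rewrite -subv0.
have H d : (derived d pos_part <= graded_part (fun j => (d%:Z < j)%R))%VS.
  elim: d => [|d IHd]; first exact: subvv.
  apply: subv_trans (brvS IHd IHd) _; apply: brvP; apply: graded_part_brv.
  by move=> i j; lia.
apply: subv_trans (H _) _; rewrite /graded_part big_seq_cond big1 ?sub0v // => j.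
case/andP=> jjs mj; have : (`|j| <= m)%N by apply: leq_bigmax_seq.
by move: mj; lia.
Qed.

Lemma levi_pos_cap : (levi_part :&: pos_part = 0)%VS.
Proof. by apply: graded_part_disjoint => j /eqP ->. Qed.

(** The map [ad h] is invertible on the positive part. This is how the positive part is shown to lie
    in derived algebras. *)
Lemma pos_bracket x : x \in pos_part -> forall U : {vspace L},
  (forall y, y \in pos_part -> [lie h, y] \in U) -> x \in U.
Proof.
move=> xn U hU; move: x xn; apply: graded_part_ind => [|x y|j x _ Pj xg xj].
- exact: mem0v.
- exact: memvD.
have -> : x = j%:~R^-1 *: [lie h, x].
  rewrite xj scalerA mulVf ?scale1r // intr_neq0 //.
  by rewrite gt_eqF.
by apply/memvZ/hU/(graded_part_mem xg xj).
Qed.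

Lemma grading_dec : (g <= levi_part + pos_part + neg_part)%VS.
Proof.
rewrite -{1}graded_partT; apply: subv_trans (addvS (graded_partU _ _) (subvv _)).
apply: subv_trans (graded_partU _ _).
by apply: graded_partS => j _ /=; case: ltgtP.
Qed.

Definition parabolic_part := (levi_part + pos_part)%VS.

Lemma parabolic_sub : (parabolic_part <= g)%VS.
Proof. by rewrite subv_add !graded_part_sub. Qed.

Lemma parabolic_subalgebra : is_subalgebra parabolic_part.
Proof.
apply: subalgebra_add; [exact: levi_subalgebra|exact: pos_subalgebra|].
exact: levi_pos_stable.
Qed.

Lemma parabolic_pos_stable : stable parabolic_part pos_part.
Proof.
move=> x y /memv_addP [u ul [w wn ->]] yn; rewrite lieDl memvD //.
  exact: levi_pos_stable.
by apply: (is_subalgebraP pos_subalgebra).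
Qed.

Lemma killing_levi_pos x y : x \in levi_part -> y \in pos_part -> killing x y = 0.
Proof. by apply: graded_part_orth => i j /eqP ->; rewrite add0r; case: ltgtP. Qed.

Lemma killing_levi_neg x y : x \in levi_part -> y \in neg_part -> killing x y = 0.
Proof. by apply: graded_part_orth => i j /eqP ->; rewrite add0r; case: ltgtP. Qed.

Lemma killing_pos_pos x y : x \in pos_part -> y \in pos_part -> killing x y = 0.
Proof. by apply: graded_part_orth => i j i0 j0; rewrite gt_eqF // addr_gt0. Qed.

Lemma killing_neg_neg x y : x \in neg_part -> y \in neg_part -> killing x y = 0.
Proof.
by apply: graded_part_orth => i j i0 j0; rewrite lt_eqF // -oppr_gt0 opprD addr_gt0 ?oppr_gt0.
Qed.

Section Nondegenerate.
Hypothesis ng : nondegenerate_on g.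

Lemma levi_nondegenerate : nondegenerate_on levi_part.
Proof.
move=> x xl xp; apply: ng => [|y yg]; first exact: (subvP (graded_part_sub _)) xl.
have /memv_addP [y' + [y3 y3n ->]] := subvP grading_dec _ yg.
case/memv_addP => y1 y1l [y2 y2n ->]; rewrite !killingDr xp //.
by rewrite killing_levi_pos // killing_levi_neg // !addr0.
Qed.

(** The negative part pairs nontrivially only with the positive part, so the negative component of
    [x] lies in the radical of the form on [g]. *)
Lemma orth_pos_parabolic x : x \in g ->
  (forall y, y \in pos_part -> killing x y = 0) -> x \in parabolic_part.
Proof.
move=> xg xn; have /memv_addP [x1 x1p [x3 x3n E]] := subvP grading_dec _ xg.
suff x30 : x3 = 0 by rewrite E x30 addr0.
apply: ng => [|y yg]; first exact: (subvP (graded_part_sub _)) x3n.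
have /memv_addP [y' + [y3 y3n ->]] := subvP grading_dec _ yg.
case/memv_addP => y1 y1l [y2 y2n ->]; rewrite !killingDr.
rewrite killingC killing_levi_neg // (killing_neg_neg x3n y3n) add0r addr0.
have := xn _ y2n; rewrite E killingDl; case/memv_addP: x1p => u ul [w wn ->].
by rewrite killingDl (killing_levi_pos ul) // killing_pos_pos // !add0r.
Qed.

(** First, [h] lies in [b] because it is central in the Levi part. A solvable [B'] above the sum
    therefore contains [pos_part = [h, pos_part]] in its derived algebra and is orthogonal to it,
    which forces [B'] into the parabolic part; its intersection with the Levi part is [b] by
    maximality. *)
Lemma parabolic_borel b : is_borel b levi_part -> is_borel (b + pos_part) g.
Proof.
move=> bb; have [bl sb solb maxb] := bb.
have hb : h \in b.
  have iJ : is_ideal <[h]>%VS levi_part.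
    apply/is_idealP; split; first by rewrite -memvE h_levi.
    move=> x y; rewrite levi_partE => /andP [_ /eqP hx] /vlineP [k ->].
    by rewrite lieZr lieC hx oppr0 scaler0 mem0v.
  apply: (subvP (borel_solvable_ideal levi_subalgebra bb iJ _)); last exact: memv_line.
  apply: solvable_abelian => x y /vlineP [k ->] /vlineP [k' ->].
  by rewrite lieZl lieZr lie_brxx !scaler0.
have bn : stable b pos_part by move=> x y /(subvP bl) xl; apply: levi_pos_stable.
split.
- by apply: subv_trans parabolic_sub; apply: addvS.
- by apply: subalgebra_add => //; exact: pos_subalgebra.
- by apply: solvable_add => //; [exact: pos_solvable|exact: pos_subalgebra].
move=> B' B'g sB' solB' bnB'.
have nB' : (pos_part <= B')%VS := subv_trans (addvSr _ _) bnB'.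
have bB' : (b <= B')%VS := subv_trans (addvSl _ _) bnB'.
have B'p : (B' <= parabolic_part)%VS.
  apply/subvP => x xB'; apply: orth_pos_parabolic; first exact: (subvP B'g).
  move=> y yn; apply: (solvable_ideal_killing ch0 sB' _ solB' xB').
  - by apply/is_idealP; split=> //; apply/is_subalgebraP.
  - apply: (pos_bracket yn) => z zn; apply: brv_mem; first exact: (subvP bB').
    exact: (subvP nB').
  exact: (subvP nB').
have E : (B' :&: levi_part = b)%VS.
  apply: maxb; first exact: capvSr.
  - by apply: subalgebra_cap => //; exact: levi_subalgebra.
  - by apply: solvableS solB'; exact: capvSl.
  by rewrite subv_cap bB'.
apply/eqP; rewrite eqEsubv bnB' andbT; apply/subvP => x xB'.
have /memv_addP [u ul [w wn Ex]] := subvP B'p _ xB'.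
rewrite Ex; apply: memv_add => //; rewrite -E; apply/memv_capP; split=> //.
have -> : u = x - w by rewrite Ex addrK.
by apply: memvB => //; apply: (subvP nB').
Qed.

(** The intersection [J] of [I + pos_part] with the Levi part is the projection of [I]; it is a
    solvable ideal there, hence central. *)
Lemma levi_center_pos_solvable_ideal I : is_ideal I parabolic_part -> solvable_lie I ->
  (I <= centralizer levi_part levi_part + pos_part)%VS.
Proof.
move=> iI solI; have [Ip sI] := is_idealP iI.
have solIn : solvable_lie (I + pos_part).
  apply: solvable_add => //; first exact: ideal_subalgebra iI.
  - exact: pos_solvable.
  - exact: pos_subalgebra.
  by move=> x y /(subvP Ip); apply: parabolic_pos_stable.
pose J := ((I + pos_part) :&: levi_part)%VS.
have iJ : is_ideal J levi_part.
  apply/is_idealP; split; first exact: capvSr.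
  move=> x y xl /memv_capP [/memv_addP [u uI [w wn ->]] yl]; apply/memv_capP; split.
    rewrite lieDr; apply: memv_add; last exact: levi_pos_stable.
    by apply: sI => //; apply: memv_addl.
  exact: (is_subalgebraP levi_subalgebra).
have solJ : solvable_lie J by apply: solvableS solIn; exact: capvSl.
apply/subvP => x xI; have /memv_addP [u ul [w wn Ex]] := subvP Ip _ xI.
rewrite Ex; apply: memv_add => //; apply/centralizerP; split=> // y yl.
apply: (solvable_ideal_central ch0 levi_subalgebra levi_nondegenerate iJ) => //.
apply/memv_capP; split=> //; have -> : u = x - w by rewrite Ex addrK.
by apply: memvB; [apply: memv_addl|apply: memv_addr].
Qed.

(** The radical is the center of the Levi part plus the positive part. Intersecting with the derived
    algebra removes the center, because a central element of [[l, l]] is 0. *)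
Lemma parabolic_nilpotent_radical : is_nilpotent_radical pos_part parabolic_part.
Proof.
pose Z := centralizer levi_part levi_part.
have ZP x : x \in Z -> x \in levi_part /\ forall y, y \in levi_part -> [lie y, x] = 0.
  by move/centralizerP.
have ll := is_subalgebraP levi_subalgebra.
exists (Z + pos_part)%VS.
  split; last exact: levi_center_pos_solvable_ideal.
    apply/is_idealP; split; first by apply: addvS => //; exact: capvSl.
    move=> x y xp /memv_addP [z /ZP [zl zc] [w wn ->]].
    rewrite lieDr; apply: memvD; last first.
      by apply: memv_addr; apply: parabolic_pos_stable.
    case/memv_addP: xp => u ul [v vn ->]; rewrite lieDl zc // add0r.
    apply: memv_addr; rewrite lieC memvN; exact: levi_pos_stable.
  apply: solvable_add; last by move=> x y /ZP [xl _]; apply: levi_pos_stable.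
  - apply/is_subalgebraP => x y /ZP [xl _] /ZP [yl yc]; rewrite yc //; exact: mem0v.
  - by apply: solvable_abelian => x y /ZP [xl _] /ZP [_ ->].
  - exact: pos_solvable.
  exact: pos_subalgebra.
apply/eqP; rewrite eqEsubv subv_cap addvSr andbT; apply/andP; split; apply/subvP.
  move=> x /pos_bracket; apply => y yn; apply: brv_mem.
    exact: (subvP (addvSl _ _) _ h_levi).
  exact: memv_addr.
move=> x /memv_capP [xpp /memv_addP [z /ZP [zl zc] [w wn Ex]]].
have pp : (brv parabolic_part parabolic_part <= brv levi_part levi_part + pos_part)%VS.
  apply: brvP => u v /memv_addP [u1 u1l [u2 u2n ->]] vp.
  rewrite lieDl; apply: memvD; last first.
    by apply: memv_addr; rewrite lieC memvN; apply: parabolic_pos_stable.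
  case/memv_addP: vp => v1 v1l [v2 v2n ->]; rewrite lieDr; apply: memv_add.
    exact: brv_mem.
  exact: levi_pos_stable.
have /memv_addP [a al [v vn Ex']] := subvP pp _ xpp.
have za : z = a.
  apply/eqP; rewrite -subr_eq0 -memv0 -levi_pos_cap; apply/memv_capP; split.
    by apply: memvB => //; apply: (subvP _ _ al); apply: brvP.
  have -> : z - a = v - w.
    by apply/eqP; rewrite subr_eq addrAC eq_sym subr_eq addrC -Ex' -Ex.
  exact: memvB.
have z0 : z = 0.
  apply: (central_derived_eq0 ch0 levi_subalgebra levi_nondegenerate) => //.
  by rewrite za.
by rewrite Ex z0 add0r.
Qed.

Lemma levi_reductive : reductive_lie levi_part.
Proof.
apply: nondegenerate_reductive => //; [exact: levi_subalgebra|exact: levi_nondegenerate].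
Qed.

Lemma levi_is_levi : is_levi levi_part parabolic_part.
Proof.
split; [exact: levi_subalgebra|exact: levi_reductive|].
exists pos_part; first exact: parabolic_nilpotent_radical.
by split=> //; exact: levi_pos_cap.
Qed.

End Nondegenerate.

End Grading.

(** * Borel subalgebras over an algebraically closed field *)

Lemma exists_split_by (K : closedFieldType) (L : lieType K) (f : 'End(L)) :
  exists t, split_by f t.
Proof.
have [p p0 fp] : exists2 p : {poly K}, p != 0 & hor f p = 0.
  have zero p : mxof (vbasis {:L}) (vbasis {:L}) (hor f p) = 0 -> hor f p = 0.
    by move=> E; apply: (@mxof_inj K L); rewrite linear0.
  suff [p p0 Ep] : exists2 p : {poly K}, p != 0 & \sum_(i < size p) p`_i *:
      mxof (vbasis {:L}) (vbasis {:L}) f ^+ i = 0.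
    by exists p => //; apply: zero; rewrite mxof_hor.
  case: (\dim _) (mxof _ _ f) => [|n] A; first by exists 1; [exact: oner_neq0|apply/matrixP => -[]].
  exists (char_poly A); first exact: monic_neq0 (char_poly_monic A).
  by rewrite -horner_mx_sum Cayley_Hamilton.
have [t Et] := closed_field_poly_normal p; exists t => v.
have /eqP : hor f p v = 0 by rewrite fp zero_lfunE.
by rewrite Et horZ scaler_eq0 lead_coef_eq0 (negPf p0) => /eqP.
Qed.

Section BorelOrthogonal.
Variables (K : closedFieldType) (L : lieType K).
Hypothesis ch0 : forall n, n.+1%:R != 0 :> K.
Hypothesis nL : nondegenerate_on {:L}.
Implicit Types (x y z c d v w : L) (U V W J : {vspace L}).

(** Lie's theorem in the quotient [W1 / W0], expressed by subspaces of [L]. On a minimal stable [W]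
    strictly above [W0], the jointly nilpotent [brv b b] acts as 0 modulo [W0]. The eigenspaces of
    each [y] modulo [W0] are then stable, so [y] acts on [W / W0] by a scalar. *)
Lemma lie_eigenvector (b W0 W1 : {vspace L}) : is_subalgebra b -> solvable_lie b ->
  (W0 <= W1)%VS -> stable b W0 -> stable b W1 -> ~~ (W1 <= W0)%VS ->
  exists x, [/\ x \in W1, x \notin W0,
    forall y, y \in b -> exists a, [lie y, x] - a *: x \in W0
    & forall y, y \in brv b b -> [lie y, x] \in W0].
Proof.
move=> sb solb W01 sW0 sW1 nW.
have bb : stable b b by apply/is_subalgebraP.
have [|W [[W0W WW1 sW nWW0] Wmin]] := exists_argmin (fun W : {vspace L} => \dim W)
    (P := fun W => [/\ (W0 <= W)%VS, (W <= W1)%VS, stable b W & ~~ (W <= W0)%VS]).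
  by exists W1.
have minW W' : (W0 <= W')%VS -> (W' <= W)%VS -> stable b W' -> ~~ (W' <= W0)%VS -> W' = W.
  move=> h1 h2 h3 h4; apply/eqP; rewrite eqEdim h2 Wmin //; split=> //.
  exact: subv_trans h2 WW1.
have iZ : is_ideal b b by apply/is_idealP.
have [r Er] := solvable_ideal_jointly_nilpotent ch0 sb iZ solb.
have ZB : (brv b b <= b)%VS by apply: brvP.
rewrite (capv_idPl ZB) in Er.
set Z := brv b b in ZB Er.
have sZ : stable b Z by apply: stable_brv.
have ZW : (brv Z W <= W0)%VS.
  apply: contraNT nWW0 => nZW.
  have sub : (brv Z W <= W)%VS by apply: brvP => x y /(subvP ZB); apply: sW.
  have E : (W0 + brv Z W)%VS = W.
    apply: minW; rewrite ?addvSl ?subv_add ?W0W //; last by rewrite subvv.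
    move=> x y xb /memv_addP [u u0 [v vZ ->]]; rewrite lieDr.
    by apply: memv_add; [apply: sW0|apply: (stable_brv sZ sW)].
  suff H i : (W <= W0 + bpow Z i)%VS by have := H r; rewrite Er addv0.
  elim: i => [|i IHi] /=; first exact: subv_trans (subvf _) (addvSr _ _).
  rewrite -{1}E subv_add addvSl; apply: brvP => x y xZ /(subvP IHi).
  case/memv_addP=> u u0 [v vZ ->]; rewrite lieDr; apply: memv_add.
    by apply: sW0 => //; apply: (subvP ZB).
  exact: brv_mem.
have eig y : y \in b -> exists a, forall x, x \in W -> [lie y, x] - a *: x \in W0.
  move=> yb; have [t Ht] := exists_split_by (ad y).
  have [v vW nv] := subvPn nWW0.
  have [a [v' [v'W nv' ev']]] : exists a v', [/\ v' \in W, v' \notin W0 & [lie y, v'] - a *: v' \in W0].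
    have {Ht} : hor (ad y) (\prod_(a <- t) ('X - a%:P)) v \in W0 by rewrite Ht mem0v.
    elim: t v vW nv => [|a t IHt] v vW nv.
      by rewrite big_nil hor1 (negPf nv).
    rewrite big_cons mulrC horM horXsubC adE.
    have [v1|nv1] := boolP ([lie y, v] - a *: v \in W0); first by exists a, v.
    by apply: IHt => //; apply: memvB; [apply: sW|apply: memvZ].
  exists a; pose f : 'End(L) := ad y - a *: \1%VF.
  have fE x : f x = [lie y, x] - a *: x.
    by rewrite add_lfunE opp_lfunE scale_lfunE id_lfunE adE.
  have <- : (W :&: f @^-1: W0)%VS = W.
    apply: minW.
    - rewrite subv_cap W0W; apply/subvP => x x0; rewrite -memv_preim fE.
      by apply: memvB; [apply: sW0|apply: memvZ].
    - exact: capvSl.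
    - move=> z x zb /memv_capP [xW]; rewrite -memv_preim fE => xf.
      apply/memv_capP; split; first exact: sW.
      rewrite -memv_preim fE lieA -addrA -lieZr -lieBr; apply: memvD; last exact: sW0.
      by apply: (subvP ZW); do 2!apply: brv_mem => //.
    apply/subvPn; exists v' => //; apply/memv_capP; split=> //.
    by rewrite -memv_preim fE.
  by move=> x /memv_capP [_]; rewrite -memv_preim fE.
have [x xW nx] := subvPn nWW0; exists x; split=> //; first exact: (subvP WW1).
  by move=> y /eig [a Ha]; exists a; apply: Ha.
by move=> y yZ; apply: (subvP ZW); apply: brv_mem.
Qed.

Variables (S b : {vspace L}).
Hypothesis sS : is_subalgebra S.
Hypothesis nS : nondegenerate_on S.
(** A double centralizer condition, satisfied by the centralizer of an element. It keeps in [S] the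
    parts of an element of [S] produced by Cartan's trick. *)
Hypothesis cS : forall d,
  (forall x, (forall y, y \in S -> [lie y, x] = 0) -> [lie d, x] = 0) -> d \in S.
Hypothesis bb : is_borel b S.

Lemma borel_normalizer x : x \in S -> (forall y, y \in b -> [lie x, y] \in b) -> x \in b.
Proof.
move=> xS xb; have [bS sb solb maxb] := bb.
have sx : is_subalgebra <[x]>%VS.
  by apply/is_subalgebraP => u v ux vx; rewrite (lie_line ux vx) mem0v.
have stx : stable <[x]>%VS b.
  by move=> u v /vlineP [k ->] vb; rewrite lieZl memvZ // xb.
have <- : (<[x]> + b)%VS = b; last by apply: memv_addl; exact: memv_line.
apply: maxb; rewrite ?addvSr ?subv_add ?bS ?andbT //.
- exact: subalgebra_add.
- by apply: solvable_add => //; apply: solvable_abelian => u v; exact: lie_line.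
Qed.

(** Every part [d] of [c] in Cartan's trick belongs to [S] by [cS] and normalizes [b], hence lies in
    [b], to which [c] is orthogonal. *)
Lemma borel_radical_nilp c : c \in b -> (forall y, y \in b -> killing c y = 0) ->
  nilpotent_end (ad c).
Proof.
move=> cb cperp; have [bS sb solb maxb] := bb; have [t ct] := exists_split_by (ad c).
apply: (nilp_of_orthogonal_parts ch0 nL ct) => d d1 d2 _; apply/cperp/borel_normalizer.
  by apply: cS => x xS; apply: d2; apply: xS; apply: (subvP bS).
by apply: d1 => y yb; apply: (is_subalgebraP sb).
Qed.

(* Otherwise the eigenvector [x] of [b] on the quotient of the orthogonal of [b]
   by the radical of the form yields a larger solvable algebra [b + <[x]>]. *)
Lemma borel_orth_sub : (perp S b <= b)%VS.
Proof.
have [bS sb solb maxb] := bb; have SS := is_subalgebraP sS.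
have sbb := is_subalgebraP sb.
pose W1 := perp S b; pose W0 := (b :&: W1)%VS.
have W1P u : u \in W1 -> u \in S /\ forall w, w \in b -> killing u w = 0 by move/perpP.
have sW1 : stable b W1.
  move=> y u yb /W1P [uS uo]; apply/perpP; split; first by apply: SS => //; apply: (subvP bS).
  by move=> w wb; rewrite lieC killingNl killing_inv uo ?oppr0 //; apply: sbb.
have sW0 : stable b W0.
  move=> y u yb /memv_capP [ub uW]; apply/memv_capP; split; [exact: sbb|exact: sW1].
have W0b u : u \in W0 -> u \in b by case/memv_capP.
apply: contraT => nW.
have nW10 : ~~ (W1 <= W0)%VS by rewrite subv_cap (negPf nW).
have [x [xW1 nx eigx Zx]] := lie_eigenvector sb solb (capvSr _ _) sW0 sW1 nW10.
have xS : x \in S by case: (W1P x xW1).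
(* Elements of [W0] are ad-nilpotent, so their eigenvalue on [x] modulo [W0] is 0. *)
have W0x u : u \in W0 -> [lie u, x] \in W0.
  move=> u0; have [a ua] := eigx u (W0b u u0).
  have [N uN] : nilpotent_end (ad u).
    by apply: borel_radical_nilp; case/memv_capP: u0 => // ub /W1P [].
  have H n : iter n (ad u) x - a ^+ n *: x \in W0.
    elim: n => [|n IHn]; first by rewrite expr0 scale1r subrr mem0v.
    rewrite iterS exprSr -scalerA.
    have -> : ad u (iter n (ad u) x) - a ^+ n *: (a *: x) =
      [lie u, iter n (ad u) x - a ^+ n *: x] + a ^+ n *: ([lie u, x] - a *: x).
      by rewrite adE lieBr lieZr scalerBr addrA subrK.
    by apply: memvD; [apply: sW0 => //; apply: W0b|apply: memvZ].
  have := H N; rewrite uN sub0r memvN => aN.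
  have a0 : a = 0.
    apply/eqP; apply: contraR nx => a0; have aN0 : a ^+ N != 0 by rewrite expf_neq0.
    by rewrite -[x]scale1r -(mulVf aN0) -scalerA memvZ.
  by move: ua; rewrite a0 scale0r subr0.
(* The space [B'] is solvable because [[B', B'] <= T] and [[T, T] <= b], which costs two steps of
   the derived series. *)
pose Z := brv b b; have ZB : (Z <= b)%VS by apply: brvP.
pose B' := (b + <[x]>)%VS; pose T := (<[x]> + W0 + Z)%VS.
have xT : (<[x]> <= T)%VS by rewrite /T -addvA addvSl.
have W0T : (W0 <= T)%VS by apply: subv_trans (addvSl _ Z); exact: addvSr.
have bxT y : y \in b -> [lie y, x] \in (<[x]> + W0)%VS.
  case/eigx=> a ha; rewrite -[[lie y, x]](subrK (a *: x)) addrC.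
  by apply: memv_add => //; apply: memvZ; exact: memv_line.
have B'T : (brv B' B' <= T)%VS.
  apply: brvP => u v /memv_addP [y yb [_ /vlineP [k ->] ->]].
  case/memv_addP=> z zb [_ /vlineP [k' ->] ->].
  rewrite lieDl !lieDr !lieZl !lieZr lie_brxx !scaler0 addr0 -addrA.
  apply: memvD; first by apply: memv_addr; apply: brv_mem.
  apply: memv_addl; apply: memvD; apply: memvZ; first exact: bxT.
  by rewrite lieC memvN; apply: bxT.
have xWZ u : u \in (W0 + Z)%VS -> [lie u, x] \in W0.
  by case/memv_addP=> u1 u10 [u2 u2Z ->]; rewrite lieDl; apply: memvD; [apply: W0x|apply: Zx].
have WZb u : u \in (W0 + Z)%VS -> u \in b.
  by apply/subvP; rewrite subv_add ZB capvSl.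
have TT : (brv T T <= b)%VS.
  rewrite /T -addvA; apply: brvP => u v /memv_addP [_ /vlineP [k ->] [u' u'W ->]].
  case/memv_addP=> _ /vlineP [k' ->] [v' v'W ->].
  rewrite lieDl !lieDr !lieZl !lieZr lie_brxx !scaler0 add0r.
  apply: memvD; first by rewrite memvZ // lieC memvN W0b // xWZ.
  by apply: memvD; [rewrite memvZ // W0b // xWZ|apply: sbb; apply: WZb].
have solB' : solvable_lie B'.
  have [n En] := solb; exists (n + 2)%N; rewrite derivedD; apply/eqP.
  rewrite -subv0 -En; apply: derivedS; apply: subv_trans TT; exact: brvS.
have TB' : (T <= B')%VS.
  rewrite !subv_add addvSr (subv_trans (capvSl _ _) (addvSl _ _)) /=.
  exact: subv_trans ZB (addvSl _ _).
have B'b : B' = b.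
  apply: maxb => //; last exact: addvSl.
    by rewrite subv_add bS -memvE.
  exact: subv_trans B'T TB'.
case/negP: nx; apply/memv_capP; split=> //; rewrite -B'b.
by apply: memv_addr; exact: memv_line.
Qed.

Lemma borel_orth x : x \in S -> (forall y, y \in b -> killing x y = 0) ->
  x \in b /\ nilpotent_end (ad x).
Proof.
move=> xS xo; have xb : x \in b by apply: (subvP borel_orth_sub); apply/perpP.
by split=> //; apply: borel_radical_nilp.
Qed.

End BorelOrthogonal.

Section BorelProjection.
Variables (K : fieldType) (L : lieType K) (S I J b : {vspace L}).
Hypotheses (sS : is_subalgebra S) (bb : is_borel b S).
Hypotheses (iI : is_ideal I S) (iJ : is_ideal J S).
Hypotheses (IJS : (I + J)%VS = S) (IJ0 : (I :&: J)%VS = 0%VS).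
Implicit Types x y u v : L.

(** The space [pr b] is the projection of [b] on [I] along [J]. As a homomorphic image of [b] it is
    solvable, and [b] normalizes it, so maximality puts it inside [b]. *)
Lemma borel_projection u v : u \in I -> v \in J -> u + v \in b -> u \in b.
Proof.
move=> uI vJ uvb; have [bS sb [n solb] maxb] := bb.
have [IS sI] := is_idealP iI; have [JS sJ] := is_idealP iJ.
have sbb := is_subalgebraP sb.
have II := is_subalgebraP (ideal_subalgebra iI).
have JJ := is_subalgebraP (ideal_subalgebra iJ).
have IJ x y : x \in I -> y \in J -> [lie x, y] = 0.
  move=> xI yJ; apply/eqP; rewrite -memv0 -IJ0; apply/memv_capP; split.
    by rewrite lieC memvN sI // (subvP JS).
  by rewrite sJ // (subvP IS).
pose pr B := ((B + J) :&: I)%VS.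
have brpr B x y : x \in pr B -> y \in pr B -> [lie x, y] \in pr (brv B B).
  case/memv_capP=> /memv_addP [s sB [j jJ Ex]] xI.
  case/memv_capP=> /memv_addP [s' sB' [j' jJ' Ey]] yI.
  apply/memv_capP; split; last exact: II.
  have -> : [lie x, y] = [lie s, s'] - [lie j, j'].
    have -> : [lie x, y] = [lie x, s'] by rewrite Ey lieDr [[lie x, j']]IJ // addr0.
    have -> : s' = y - j' by rewrite Ey addrK.
    rewrite Ex lieDl; congr (_ + _).
    by rewrite lieBr lieC [[lie y, j]]IJ // oppr0 add0r.
  by apply: memv_add; [apply: brv_mem|rewrite memvN JJ].
have prS B B' : (B <= B')%VS -> (pr B <= pr B')%VS.
  by move=> BB'; apply: capvS => //; apply: addvS.
have upr : u \in pr b.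
  apply/memv_capP; split=> //; have -> : u = (u + v) - v by rewrite addrK.
  by apply: memv_add => //; rewrite memvN.
apply: (subvP (borel_solvable_normalized sS bb _ _ _ _)) upr.
- exact: subv_trans (capvSr _ _) IS.
- exists n; apply/eqP; rewrite -subv0 -IJ0 capvC.
  have H k : (derived k (pr b) <= pr (derived k b))%VS.
    elim: k => //= k IHk; apply: subv_trans (brvS IHk IHk) _.
    by apply: brvP => x y; apply: brpr.
  by have := H n; rewrite solb /pr add0v.
- apply/is_subalgebraP => x y xb yb; apply: (subvP (prS _ _ sb)); exact: brpr.
move=> x y xb /memv_capP [/memv_addP [s sB [j jJ ->]] yI]; apply/memv_capP; split.
  rewrite lieDr; apply: memv_add; first exact: sbb.
  by apply: sJ => //; apply: (subvP bS).
by apply: sI => //; apply: (subvP bS).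
Qed.

End BorelProjection.

(** * Base change *)

(** Computing the trace from any vectors and dual functionals avoids comparing the [vbasis] of the
    extended algebra with the extension of the [vbasis] of [L]. *)
Lemma etr_dual (K : fieldType) (V : vectType K) m (e : 'I_m -> V)
    (eps : 'I_m -> V -> K) (f : 'End(V)) :
  (forall i a u w, eps i (a *: u + w) = a * eps i u + eps i w) ->
  (forall v, v = \sum_i eps i v *: e i) ->
  etr f = \sum_i eps i (f (e i)).
Proof.
move=> epsL epsE; pose b := vbasis {:V}.
have eps0 i : eps i 0 = 0.
  by have := epsL i (-1) 0 0; rewrite scaler0 add0r mulN1r addNr.
have eps_sum i (c : 'I_(\dim {:V}) -> K) :
    eps i (\sum_j c j *: b`_j) = \sum_j c j * eps i b`_j.
  by elim/big_rec2: _ => [//|j a w _ <-]; rewrite epsL.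
transitivity (\sum_j coord b j (f b`_j)).
  by apply: eq_bigr => j _; rewrite !mxE vecof_delta.
rewrite (eq_bigr (fun j : 'I_(\dim {:V}) => \sum_i eps i b`_j * coord b j (f (e i)))) => [|j _].
  rewrite exchange_big; apply: eq_bigr => i _ /=.
  rewrite {2}[f (e i)](coord_vbasis (memvf _)) eps_sum.
  by apply: eq_bigr => j _; rewrite mulrC.
rewrite {1}[b`_j]epsE !linear_sum; apply: eq_bigr => i _.
by rewrite !linearZ.
Qed.

Section BaseChangeTheory.
Variables (F K : fieldType) (iota : {rmorphism F -> K}) (L : lieType F).
Implicit Types (x y z h : L) (U V W : {vspace L}).
Local Notation LK := (lie_ext iota L).
Local Notation ext := (ext_elt iota).
Local Notation exts := (ext_sub iota).
Local Notation b := (vbasis {:L}).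

Lemma ext_ch0 : (forall n, n.+1%:R != 0 :> F) -> forall n, n.+1%:R != 0 :> K.
Proof. by move=> ch0 n; rewrite -(rmorph_nat iota) fmorph_eq0. Qed.

Lemma ext_sum_elt T (r : seq T) (P : pred T) (f : T -> L) :
  ext (\sum_(i <- r | P i) f i) = \sum_(i <- r | P i) ext (f i).
Proof. exact: (big_morph _ (@ext_eltD _ _ _ _) (ext_elt0 _ _)). Qed.

Lemma lie_ext_elt x y : [lie ext x, ext y] = ext [lie x, y].
Proof.
rewrite (coord_vbasis (memvf x)) ext_sum_elt !lie_suml ext_sum_elt.
by apply: eq_bigr => i _; rewrite ext_eltZ !lieZl ext_eltZ -ext_brE.
Qed.

Lemma ext_elt_eq0 x : (ext x == 0) = (x == 0).
Proof.
apply/eqP/eqP => [E|->]; last exact: ext_elt0.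
rewrite (coord_vbasis (memvf x)) big1 // => i _.
have := ext_eltE iota x i; rewrite E mxE => /esym/eqP; rewrite fmorph_eq0 => /eqP ->.
by rewrite scale0r.
Qed.

Lemma killing_ext x y : killing (ext x) (ext y) = iota (killing x y).
Proof.
rewrite !killingE (@etr_dual _ _ _ (fun i => ext b`_i) (fun i u => (u : 'rV_(\dim {:L})) 0 i)); first last.
- exact: ext_sum.
- by move=> i a u w; rewrite !mxE.
rewrite (@etr_dual _ _ _ (fun i => b`_i) (fun i u => coord b i u)); first last.
- by move=> v; rewrite -coord_vbasis ?memvf.
- by move=> i a u w; rewrite linearP.
rewrite rmorph_sum; apply: eq_bigr => i _.
by rewrite !comp_lfunE !adE !lie_ext_elt ext_eltE.
Qed.

Lemma ext_sub_mem U x : x \in U -> ext x \in exts U.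
Proof.
move=> xU; rewrite (coord_vbasis xU) ext_sum_elt; apply: memv_suml => i _.
rewrite ext_eltZ; apply/memvZ/memv_span/map_f.
by rewrite mem_nth // size_tuple.
Qed.

Lemma ext_subP U (W : {vspace LK}) : (forall x, x \in U -> ext x \in W) ->
  (exts U <= W)%VS.
Proof.
by move=> H; apply/span_subvP => _ /mapP [x xU ->]; apply: H; apply: vbasis_mem.
Qed.

Lemma ext_sub_coord U (u : LK) : u \in exts U -> exists c : 'I_(\dim U) -> K,
  u = \sum_i c i *: ext (vbasis U)`_i.
Proof.
rewrite /ext_sub => uU.
have sz : size [seq ext x | x <- vbasis U] == \dim U by rewrite size_map size_tuple.
exists (fun i => coord (Tuple sz) i u); rewrite {1}(coord_span (X := Tuple sz) uU).
by apply: eq_bigr => i _; rewrite /= (nth_map 0) ?size_tuple.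
Qed.

Lemma ext_sub_ind U (T : LK -> Prop) : T 0 -> (forall u w, T u -> T w -> T (u + w)) ->
  (forall c u, T u -> T (c *: u)) -> (forall x, x \in U -> T (ext x)) ->
  forall u, u \in exts U -> T u.
Proof.
move=> T0 TD TZ Tx u /ext_sub_coord [c ->]; elim/big_ind: _ => // i _.
by apply/TZ/Tx; rewrite vbasis_mem // mem_nth // size_tuple.
Qed.

Lemma ext_subS U V : (U <= V)%VS -> (exts U <= exts V)%VS.
Proof. by move/subvP=> UV; apply: ext_subP => x /UV; apply: ext_sub_mem. Qed.

Lemma ext_sub_add U V : exts (U + V) = (exts U + exts V)%VS.
Proof.
apply/eqP; rewrite eqEsubv subv_add !ext_subS ?addvSl ?addvSr // !andbT.
apply: ext_subP => x /memv_addP [u uU [v vV ->]]; rewrite ext_eltD.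
by apply: memv_add; apply: ext_sub_mem.
Qed.

Lemma ext_subf : exts {:L} = fullv.
Proof.
apply/eqP; rewrite eqEsubv subvf; apply/subvP => u _; rewrite (ext_sum u).
by apply: memv_suml => i _; apply/memvZ/ext_sub_mem/memvf.
Qed.

(** The extensions of [U] and of a complement span everything and have at most the expected
    dimensions, so they meet in 0. *)
Lemma ext_sub_memE U x : (ext x \in exts U) = (x \in U).
Proof.
apply/idP/idP => [xU|]; last exact: ext_sub_mem.
have dim_ext V : (\dim (exts V) <= \dim V)%N.
  by apply: leq_trans (dim_span _) _; rewrite size_map size_tuple.
have cap0 : (exts U :&: exts U^C = 0)%VS.
  apply/eqP; rewrite -dimv_eq0 -leqn0 -(leq_add2l (\dim (exts U + exts U^C))) addn0.
  rewrite dimv_sum_cap -ext_sub_add addv_complf ext_subf (leq_trans (leq_add (dim_ext _) (dim_ext _))) //.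
  by rewrite dimv_compl subnKC ?dimvS ?subvf // [leqRHS]dimvf /dim /= mul1n.
have : x \in (U + U^C)%VS by rewrite addv_complf memvf.
case/memv_addP=> u uU [w wU Ex]; suff /eqP : ext w = 0 by rewrite ext_elt_eq0 Ex => /eqP ->; rewrite addr0.
apply/eqP; rewrite -memv0 -cap0; apply/memv_capP; split; last exact: ext_sub_mem.
have -> : w = x - u by rewrite Ex addrC addKr.
by rewrite ext_eltD ext_eltN memvB // ext_sub_mem.
Qed.

Lemma ext_sub_sub U V : (exts U <= exts V)%VS = (U <= V)%VS.
Proof.
apply/idP/idP; last exact: ext_subS.
by move/subvP=> UV; apply/subvP => x /ext_sub_mem /UV; rewrite ext_sub_memE.
Qed.

Lemma ext_sub_nondegenerate U : nondegenerate_on U -> nondegenerate_on (exts U).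
Proof.
move=> nU u /ext_sub_coord [c ->] H; pose r : 'rV_(\dim U) := \row_i c i.
have r0 : r *m map_mx iota (gram U) = 0.
  apply/rowP => j; rewrite !mxE.
  have jU : (vbasis U)`_j \in U by rewrite vbasis_mem // mem_nth // size_tuple.
  rewrite -[RHS](H _ (ext_sub_mem jU)) killing_suml; apply: eq_bigr => i _.
  by rewrite !mxE killingZl killing_ext.
have : r = 0.
  have Gu : map_mx iota (gram U) \in unitmx by rewrite map_unitmx gram_unit.
  by rewrite -(mulmxK Gu r) r0 mul0mx.
move/rowP=> r00; rewrite big1 // => i _; have := r00 i; rewrite !mxE => ->.
by rewrite scale0r.
Qed.

Lemma ext_stable U V W : (forall x y, x \in U -> y \in V -> [lie x, y] \in W) ->
  forall u w, u \in exts U -> w \in exts V -> [lie u, w] \in exts W.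
Proof.
move=> H u w uU wV; move: u uU; apply: ext_sub_ind => [|u u' Eu Eu'|c u Eu|x xU].
- by rewrite lie0l mem0v.
- by rewrite lieDl memvD.
- by rewrite lieZl memvZ.
move: w wV; apply: ext_sub_ind => [|w w' Ew Ew'|c w Ew|y yV].
- by rewrite lie0r mem0v.
- by rewrite lieDr memvD.
- by rewrite lieZr memvZ.
by rewrite lie_ext_elt ext_sub_mem // H.
Qed.

Lemma ext_subalgebra U : is_subalgebra U -> is_subalgebra (exts U).
Proof. by move/is_subalgebraP=> sU; apply/is_subalgebraP; apply: ext_stable. Qed.

Lemma ext_ideal U V : is_ideal U V -> is_ideal (exts U) (exts V).
Proof.
case/is_idealP=> UV sU; apply/is_idealP; split; first exact: ext_subS.
exact: ext_stable.
Qed.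

Lemma ext_sub_orthogonal U V : (forall x y, x \in U -> y \in V -> killing x y = 0) ->
  forall u w, u \in exts U -> w \in exts V -> killing u w = 0.
Proof.
move=> H u w uU wV; move: u uU; apply: ext_sub_ind => [|u u' Eu Eu'|c u Eu|x xU].
- exact: killing0l.
- by rewrite killingDl Eu Eu' addr0.
- by rewrite killingZl Eu mulr0.
move: w wV; apply: ext_sub_ind => [|w w' Ew Ew'|c w Ew|y yV].
- exact: killing0r.
- by rewrite killingDr Ew Ew' addr0.
- by rewrite killingZr Ew mulr0.
by rewrite killing_ext H // rmorph0.
Qed.

Lemma ext_solvable U : solvable_lie (exts U) -> solvable_lie U.
Proof.
case=> n En; exists n; apply/eqP; rewrite -subv0; apply/subvP => x xU.
have H k : (exts (derived k U) <= derived k (exts U))%VS.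
  elim: k => //= k IHk; apply: ext_subP => _ /brvE [m [u [v [uU vU ->]]]].
  rewrite ext_sum_elt; apply: memv_suml => i _; rewrite -lie_ext_elt.
  by apply: brv_mem; apply: (subvP IHk); apply: ext_sub_mem.
by have := subvP (H n) _ (ext_sub_mem xU); rewrite En !memv0 ext_elt_eq0.
Qed.

Lemma ext_nilp x : nilpotent_end (ad (ext x)) -> nilpotent_end (ad x).
Proof.
case=> [N EN]; exists N => v; apply/eqP; rewrite -ext_elt_eq0 -(EN (ext v)).
by apply/eqP; elim: N {EN} => //= N <-; rewrite !adE lie_ext_elt.
Qed.

Section ExtGrading.
Hypothesis ch0 : forall n, n.+1%:R != 0 :> F.
Variables (g : {vspace L}) (h : L) (js : seq int).
Hypothesis sg : is_subalgebra g.
Hypothesis hg : h \in g.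
Hypothesis ujs : uniq js.
Hypothesis gjs : forall x, x \in g ->
  hor (ad h) (\prod_(j <- js) ('X - j%:~R%:P)) x = 0.

Lemma ext_grading u : u \in exts g ->
  hor (ad (ext h)) (\prod_(j <- js) ('X - j%:~R%:P)) u = 0.
Proof.
move: u; apply: ext_sub_ind => [|u w Eu Ew|c u Eu|x xg].
- exact: linear0.
- by rewrite linearD /= Eu Ew addr0.
- by rewrite linearZ /= Eu scaler0.
rewrite -(graded_partT ch0 sg hg ujs gjs) in xg; move: x xg.
apply: graded_part_ind => [|x y Ex Ey|j x jjs _ _ hx].
- by rewrite ext_elt0 linear0.
- by rewrite ext_eltD linearD /= Ex Ey addr0.
by apply: hor_prod_int jjs _; rewrite adE lie_ext_elt hx ext_eltZ rmorph_int.
Qed.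

(** The easy inclusion, applied to [P] and to its complement, suffices, because the two extended
    parts together span [g] and the two graded parts are disjoint. *)
Lemma ext_graded_part P :
  exts (graded_part g h js P) = graded_part (exts g) (ext h) js P.
Proof.
have ch0K := ext_ch0 ch0; have sgK := ext_subalgebra sg.
have le Q : (exts (graded_part g h js Q) <= graded_part (exts g) (ext h) js Q)%VS.
  apply: ext_subP; apply: graded_part_ind => [|x y|j x _ Qj xg hx].
  - by rewrite ext_elt0 mem0v.
  - by rewrite ext_eltD; apply: memvD.
  apply: (graded_part_mem ch0K ext_grading (j := j)) => //; first exact: ext_sub_mem.
  by rewrite lie_ext_elt hx ext_eltZ rmorph_int.
apply/eqP; rewrite eqEsubv le; apply/subvP => u uP.
have : u \in (exts (graded_part g h js P) + exts (graded_part g h js (predC P)))%VS.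
  rewrite -ext_sub_add; apply: (subvP (ext_subS (graded_partU ch0 gjs _ _))).
  apply: (subvP (ext_subS (graded_partS ch0 gjs (P := predT) _))).
    by move=> j _ /=; case: (P j).
  rewrite (graded_partT ch0 sg hg ujs gjs); exact: (subvP (graded_part_sub _ _ _ _)) uP.
case/memv_addP=> v vP [w wC Eu]; suff w0 : w = 0 by rewrite Eu w0 addr0.
apply/eqP; rewrite -memv0 -(graded_part_disjoint ch0K (exts g) (ext h) js (P := P) (Q := predC P)).
  apply/memv_capP; split; last exact: (subvP (le _)).
  have -> : w = u - v by rewrite Eu addrC addKr.
  by apply: memvB => //; apply: (subvP (le _)).
by move=> j Pj /=; rewrite Pj.
Qed.

End ExtGrading.

End BaseChangeTheory.

(** * Roots *)

Section Weights.
Variables (F : fieldType) (L : lieType F).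
Hypothesis ch0 : forall n, n.+1%:R != 0 :> F.
Implicit Types (x y z h : L) (U V W : {vspace L}).

Lemma diagonalizable_split (f : 'End(L)) : diagonalizable (lmx f) ->
  exists2 s, uniq s & split_by f s.
Proof.
have zero s : \sum_(i < size (\prod_(r <- s) ('X - r%:P))) (\prod_(r <- s) ('X - r%:P))`_i *:
    mxof (vbasis {:L}) (vbasis {:L}) f ^+ i = 0 -> split_by f s.
  rewrite -mxof_hor => E v; have -> : hor f (\prod_(r <- s) ('X - r%:P)) = 0.
    by apply: (@mxof_inj F L); rewrite linear0.
  by rewrite zero_lfunE.
move=> df; suff [s us Es] : exists2 s, uniq s &
    \sum_(i < size (\prod_(r <- s) ('X - r%:P))) (\prod_(r <- s) ('X - r%:P))`_i *:
    mxof (vbasis {:L}) (vbasis {:L}) f ^+ i = 0 by exists s => //; exact: zero.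
move: df; rewrite /lmx; case: (\dim _) (mxof _ _ f) => [|n] A.
  by move=> _; exists [::] => //; apply/matrixP => -[].
case/diagonalizableP=> s us /mxminpoly_minP sA; exists s => //.
by rewrite -horner_mx_sum.
Qed.

Lemma split_diagonalizable (f : 'End(L)) s : uniq s -> split_by f s ->
  diagonalizable (lmx f).
Proof.
rewrite /lmx => us fs.
have : mxof (vbasis {:L}) (vbasis {:L}) (hor f (\prod_(r <- s) ('X - r%:P))) = 0.
  suff -> : hor f (\prod_(r <- s) ('X - r%:P)) = 0 by rewrite linear0.
  by apply/lfunP => v; rewrite zero_lfunE; exact: fs.
rewrite mxof_hor; case: (\dim _) (mxof _ _ f) => [|n] A EA.
  have -> : A = 0 by apply/matrixP => -[].
  exact: diagonalizable0.
by apply/diagonalizableP; exists s => //; apply/mxminpoly_minP; rewrite horner_mx_sum.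
Qed.

Lemma hor_ad_comm h h' p x : [lie h', h] = 0 ->
  [lie h', hor (ad h) p x] = hor (ad h) p [lie h', x].
Proof.
move=> hh'; elim/poly_ind: p x => [|p c IHp] x; first by rewrite !hor0 lie0r.
rewrite !horD !horMX !horC lieDr IHp lieZr; congr (hor _ _ _ + _).
by rewrite !adE lieA hh' lie0l add0r.
Qed.

(* Simultaneous diagonalization, as an induction principle. *)
Lemma eigen_ind (hs : seq L) U (T : L -> Prop) :
  (forall h, h \in hs -> exists2 s, uniq s & split_by (ad h) s) ->
  {in hs &, forall h h', [lie h, h'] = 0} -> (forall h, h \in hs -> stable <[h]>%VS U) ->
  T 0 -> (forall x y, T x -> T y -> T (x + y)) ->
  (forall x, x \in U -> (forall h, h \in hs -> exists c, [lie h, x] = c *: x) -> T x) ->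
  forall x, x \in U -> T x.
Proof.
elim: hs => [|h hs IHhs] dhs chs shs T0 TD Th; first by move=> x xU; apply: Th.
apply: IHhs => //.
- by move=> h' h's; apply: dhs; rewrite inE h's orbT.
- by move=> h' h'' h's h''s; apply: chs; rewrite inE ?h's ?h''s orbT.
- by move=> h' h's; apply: shs; rewrite inE h's orbT.
move=> x xU hx; have [s us hs_split] := dhs h (mem_head _ _).
have [P HP] := eigen_decomposition (ad h) us.
have [Ex Px] := HP x (hs_split x); rewrite Ex.
rewrite big_seq; apply: (big_ind T) => // r rs; apply: Th.
  apply: hor_stable => // v vU; rewrite adE; apply: (shs h (mem_head _ _)) => //.
  exact: memv_line.
move=> h'; rewrite inE => /predU1P [->|h's].
  by exists r; rewrite -adE Px.
have [c hc] := hx h' h's; exists c; rewrite hor_ad_comm ?hc ?linearZ //.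
by apply: chs; rewrite ?mem_head // inE h's orbT.
Qed.

Section Torus.
Variable a : {vspace L}.
Hypothesis sa : split_abelian a.
Implicit Types mu nu : dual a.

Lemma torus_comm h h' : h \in a -> h' \in a -> [lie h, h'] = 0.
Proof.
by move=> ha h'a; case: sa => /eqP ab _; apply/eqP; rewrite -memv0 -ab brv_mem.
Qed.

Lemma torus_split h : h \in a -> exists2 s, uniq s & split_by (ad h) s.
Proof. by move=> ha; apply: diagonalizable_split; case: sa => _; apply. Qed.

Lemma evDl mu nu h : ev (mu + nu) h = ev mu h + ev nu h.
Proof. by rewrite /ev add_lfunE. Qed.

Lemma evN mu h : ev (- mu) h = - ev mu h.
Proof. by rewrite /ev opp_lfunE. Qed.

Lemma ev0 h : ev (0 : dual a) h = 0.
Proof. by rewrite /ev zero_lfunE. Qed.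

Lemma evZ mu c h : ev mu (c *: h) = c * ev mu h.
Proof. by rewrite /ev !linearZ. Qed.

Lemma ev_sum mu T (r : seq T) (P : pred T) (f : T -> L) :
  ev mu (\sum_(i <- r | P i) f i) = \sum_(i <- r | P i) ev mu (f i).
Proof. by rewrite /ev !linear_sum. Qed.

Lemma ev_inj mu nu : (forall h, h \in a -> ev mu h = ev nu h) -> mu = nu.
Proof.
move=> E; apply/lfunP => w; have := E _ (subvsP w).
by rewrite /ev vsvalK.
Qed.

Lemma root_spaceP mu x : reflect (forall h, h \in a -> [lie h, x] = ev mu h *: x)
  (x \in root_space mu).
Proof.
apply: (iffP idP) => [|Hx].
  rewrite memvE => /subv_bigcapP xa h ha; rewrite {1}(coord_vbasis ha) lie_suml.
  rewrite {2}(coord_vbasis ha) ev_sum scaler_suml; apply: eq_bigr => i _.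
  have := xa i isT; rewrite -memvE leigenspaceP adE lieZl evZ => /eqP ->.
  by rewrite scalerA.
rewrite memvE; apply/subv_bigcapP => i _; rewrite -memvE leigenspaceP adE Hx //.
by rewrite vbasis_mem // mem_nth // size_tuple.
Qed.

Lemma weight_ind U (T : L -> Prop) : stable a U ->
  T 0 -> (forall x y, T x -> T y -> T (x + y)) ->
  (forall mu x, x \in U -> x \in root_space mu -> T x) -> forall x, x \in U -> T x.
Proof.
move=> sU T0 TD Tmu; apply: (@eigen_ind (vbasis a)) => //.
- by move=> h /vbasis_mem; apply: torus_split.
- by move=> h h' /vbasis_mem ha /vbasis_mem h'a; apply: torus_comm.
- by move=> h /vbasis_mem ha y x /vlineP [c ->] xU; apply: sU => //; apply: memvZ.
move=> x xU hx.
have /fin_all_exists [c cE] : forall i : 'I_(\dim a), exists c, [lie (vbasis a)`_i, x] = c *: x.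
  by move=> i; apply: hx; rewrite mem_nth // size_tuple.
pose f i : dual a := linfun (coord (vbasis a) i \o vsval : subvs_of a -> F^o).
pose mu : dual a := \sum_i c i *: f i.
apply: (Tmu mu) => //; rewrite memvE; apply/subv_bigcapP => i _.
rewrite -memvE leigenspaceP adE cE; apply/eqP; congr (_ *: _).
rewrite /ev sum_lfunE (bigD1 i) //= big1 => [|j ji]; rewrite scale_lfunE lfunE /= vsprojK.
- by rewrite coord_free ?(basis_free (vbasisP _)) // eqxx addr0 [RHS]mulr1.
- by rewrite vbasis_mem // mem_nth // size_tuple.
- by rewrite coord_free ?(basis_free (vbasisP _)) // eq_sym (negPf ji) [LHS]mulr0.
by rewrite vbasis_mem // mem_nth // size_tuple.
Qed.

Lemma root_space_br mu nu x y : x \in root_space mu -> y \in root_space nu ->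
  [lie x, y] \in root_space (mu + nu).
Proof.
move=> /root_spaceP xm /root_spaceP yn; apply/root_spaceP => h ha.
by rewrite lieA (xm h ha) (yn h ha) lieZl lieZr evDl scalerDl.
Qed.

Lemma root_space_orth mu nu x y : mu + nu != 0 ->
  x \in root_space mu -> y \in root_space nu -> killing x y = 0.
Proof.
move=> ne /root_spaceP xm /root_spaceP yn; apply/eqP; apply: contraR ne => k0.
apply/eqP/ev_inj => h ha; rewrite ev0 evDl; apply/eqP.
suff /eqP : (ev mu h + ev nu h) * killing x y = 0 by rewrite mulf_eq0 (negPf k0) orbF.
rewrite mulrDl -killingZl -(xm h ha) -killingZr -(yn h ha) -killing_inv.
by rewrite lieC killingNl addNr.
Qed.

Lemma not_root mu x : mu != 0 -> ~~ is_root fullv mu -> x \in root_space mu -> x = 0.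
Proof.
rewrite /is_root capvf => -> /=; rewrite negbK => /eqP -> /[!memv0] /eqP //.
Qed.

Lemma is_root_mem mu x : mu != 0 -> x \in root_space mu -> x != 0 -> is_root fullv mu.
Proof.
move=> m0 xm x0; rewrite /is_root m0 capvf /=; apply: contraNneq x0 => E.
by rewrite -memv0 -E.
Qed.

Lemma is_rootP mu : is_root fullv mu ->
  mu != 0 /\ exists2 x, x \in root_space mu & x != 0.
Proof.
case/andP=> -> ; rewrite capvf => mu0; split=> //.
by exists (vpick (root_space mu)); [exact: memv_pick|rewrite vpick0].
Qed.

Hypothesis nL : nondegenerate_on {:L}.

Lemma weight_orthogonal_eq0 x :
  (forall mu y, y \in root_space mu -> killing x y = 0) -> x = 0.
Proof.
move=> xo; apply: nL; rewrite ?memvf // => y yL; move: y yL.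
apply: (@weight_ind _ (fun y => killing x y = 0)) => [h y _ _||y z /= Ey Ez|nu y _ yn].
- exact: memvf.
- exact: killing0r.
- by rewrite killingDr Ey Ez addr0.
exact: xo yn.
Qed.

(** The weight space of [mu] is orthogonal to all weight spaces except that of [- mu], so the latter
    cannot vanish. *)
Lemma is_rootN mu : is_root fullv mu -> is_root fullv (- mu).
Proof.
case/is_rootP=> m0 [x xm x0]; apply: contraT => nr.
case/eqP: x0; apply: weight_orthogonal_eq0 => nu y yn.
have [E|ne] := eqVneq (mu + nu) 0; last exact: (root_space_orth ne).
have -> : y = 0; last exact: killing0r.
apply: (not_root _ nr); rewrite ?oppr_eq0 //.
by have /eqP <- : nu == - mu; rewrite // -addr_eq0 addrC E.
Qed.

Lemma is_rootNE mu : is_root fullv (- mu) = is_root fullv mu.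
Proof. by apply/idP/idP => /is_rootN; rewrite ?opprK. Qed.

Lemma zero_weight_nondegenerate : nondegenerate_on (root_space (0 : dual a)).
Proof.
move=> x x0 xo; apply: weight_orthogonal_eq0 => nu y yn.
have [E|ne] := eqVneq nu 0; first by apply: xo; rewrite -E.
by apply: (root_space_orth _ x0 yn); rewrite add0r.
Qed.

Lemma zero_weightP x : reflect (forall h, h \in a -> [lie h, x] = 0)
  (x \in root_space (0 : dual a)).
Proof.
apply: (iffP (root_spaceP _ _)) => E h ha; first by rewrite E // ev0 scale0r.
by rewrite E // ev0 scale0r.
Qed.

End Torus.
End Weights.

(** * Weights of strongly orthogonal triples *)

Section OneTriple.
Variables (F : fieldType) (L : lieType F).
Hypothesis ch0 : forall n, n.+1%:R != 0 :> F.
Implicit Types (u v w x y h : L) (c : F).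

(** A triple placed inside a grading by [h0]. The last two fields say that degrees 4 and -4 do not
    occur; they bound the length of the strings and are what replaces the classification of
    representations. *)
Record graded_triple h0 y h x : Prop := {
  gt_yx : [lie y, x] = h;
  gt_hx : [lie h, x] = 2%:R *: x;
  gt_hy : [lie h, y] = - 2%:R *: y;
  gt_0x : [lie h0, x] = 2%:R *: x;
  gt_0y : [lie h0, y] = - 2%:R *: y;
  gt_no4 : forall v, [lie h0, v] = 4%:R *: v -> v = 0;
  gt_no4N : forall v, [lie h0, v] = - 4%:R *: v -> v = 0
}.

Lemma graded_triple_swap h0 y h x : graded_triple h0 y h x ->
  graded_triple (- h0) x (- h) y.
Proof.
case=> yx hx hy h0x h0y n4 n4N; split.
- by rewrite lieC yx.
- by rewrite lieNl hy scaleNr opprK.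
- by rewrite lieNl hx scaleNr.
- by rewrite lieNl h0y scaleNr opprK.
- by rewrite lieNl h0x scaleNr.
- by move=> v; rewrite lieNl => /(congr1 -%R); rewrite opprK -scaleNr; apply: n4N.
by move=> v; rewrite lieNl => /(congr1 -%R); rewrite opprK -scaleNr opprK; apply: n4.
Qed.

Lemma eigen_br h x v b c : [lie h, x] = b *: x -> [lie h, v] = c *: v ->
  [lie h, [lie x, v]] = (b + c) *: [lie x, v].
Proof. by move=> hx hv; rewrite lieA hx hv lieZl lieZr scalerDl. Qed.

Section Triple.
Variables (h0 y h x : L).
Hypothesis T : graded_triple h0 y h x.

Let xy v : [lie x, [lie y, v]] = [lie y, [lie x, v]] - [lie h, v].
Proof. by rewrite lieA (lieC x y) (gt_yx T) lieNl addrC. Qed.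

(** Absence of degree 4 makes [v] a highest weight vector, and absence of degree -4 stops its string
    at [y2]. Applying [x] to the first term of the string that vanishes gives [c = 2], 1 or 0
    according to its place. *)
Lemma triple_high v c : [lie h0, v] = 2%:R *: v -> [lie h, v] = c *: v -> v != 0 ->
  exists2 n : nat, (n <= 2)%N & c = n%:R.
Proof.
move=> v0 vc vn0.
have Xv : [lie x, v] = 0.
  by apply: (gt_no4 T); rewrite (eigen_br (gt_0x T) v0) -natrD.
pose y1 := [lie y, v]; pose y2 := [lie y, y1].
have hy1 : [lie h, y1] = (c - 2%:R) *: y1 by rewrite (eigen_br (gt_hy T) vc) addrC.
have hy2 : [lie h, y2] = (c - 4%:R) *: y2.
  by rewrite (eigen_br (gt_hy T) hy1); congr (_ *: _); ring.
have y3 : [lie y, y2] = 0.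
  apply: (gt_no4N T).
  rewrite (eigen_br (gt_0y T) (eigen_br (gt_0y T) (eigen_br (gt_0y T) v0))).
  by congr (_ *: _); ring.
have xy1 : [lie x, y1] = - c *: v by rewrite /y1 xy Xv lie0r sub0r vc scaleNr.
have xy2 : [lie x, y2] = (2%:R - c - c) *: y1.
  by rewrite /y2 xy xy1 hy1 lieZr -/y1 -scalerBl; congr (_ *: _); ring.
have : (3%:R * (2%:R - c)) *: y2 = 0.
  have := xy y2; rewrite y3 lie0r xy2 hy2 lieZr -/y2 -scalerBl => E.
  by rewrite [RHS]E; congr (_ *: _); ring.
move/eqP; rewrite scaler_eq0 mulf_eq0 (negPf (ch0 2)) /= subr_eq0.
case/orP=> [/eqP <-|/eqP y20]; first by exists 2.
have : (2%:R * (1 - c)) *: y1 = 0.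
  by rewrite -[RHS](lie0r x) -y20 xy2; congr (_ *: _); ring.
move/eqP; rewrite scaler_eq0 mulf_eq0 (negPf (ch0 1)) /= subr_eq0.
case/orP=> [/eqP <-|/eqP y10]; first by exists 1.
have /eqP : - c *: v = 0 by rewrite -xy1 y10 lie0r.
by rewrite scaler_eq0 oppr_eq0 (negPf vn0) orbF => /eqP ->; exists 0.
Qed.

End Triple.

Lemma triple_low h0 y h x v c : graded_triple h0 y h x ->
  [lie h0, v] = - 2%:R *: v -> [lie h, v] = c *: v -> v != 0 ->
  exists2 n : nat, (n <= 2)%N & c = - n%:R.
Proof.
move=> T v0 vc vn0.
have [||n n2 E] := triple_high (graded_triple_swap T) (v := v) (c := - c) _ _ vn0.
- by rewrite lieNl v0 scaleNr opprK.
- by rewrite lieNl vc scaleNr.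
by exists n => //; rewrite -E opprK.
Qed.

(** The weight [c - 2] of [[lie y, v]] in degree -2 leaves [c] among 0, 1 and 2. If [c = 2], then
    [[lie x, v]] would have weight 4 in degree 2, so it vanishes, and this forces [[lie y, v] =
    0]. *)
Lemma triple_zero_pos h0 y h x v c : graded_triple h0 y h x ->
  [lie h0, v] = 0 -> [lie h, v] = c *: v -> [lie y, v] != 0 -> c = 0 \/ c = 1.
Proof.
move=> T v0 vc u0; have v0' : [lie h0, v] = 0 *: v by rewrite v0 scale0r.
have hu := eigen_br (gt_hy T) vc; have gu := eigen_br (gt_0y T) v0'.
have [n n2 E] : exists2 n : nat, (n <= 2)%N & - 2%:R + c = - n%:R.
  by apply: (triple_low T _ hu u0); rewrite gu addr0.
have {}E : c = (2 - n)%:R by rewrite natrB // -E addrA subrr add0r.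
case: n n2 E => [|[|[|//]]] _ E; [|by right|by left].
case/eqP: u0; set u := [lie y, v] in hu gu *.
have w0 : [lie x, v] = 0.
  apply/eqP; apply: contraT => w0.
  have gw := eigen_br (gt_0x T) v0'; rewrite addr0 in gw.
  have [n n2 /eqP] := triple_high T gw (eigen_br (gt_hx T) vc) w0.
  by rewrite E -natrD natr_eq // => /eqP nE; rewrite -nE in n2.
have xu : [lie x, u] = - 2%:R *: v.
  by rewrite /u lieA (lieC x y) (gt_yx T) lieNl vc E w0 lie0r addr0 scaleNr.
have yu : [lie y, u] = 0.
  by apply: (gt_no4N T); rewrite (eigen_br (gt_0y T) gu); congr (_ *: _); ring.
have : [lie y, [lie x, u]] = 0.
  by rewrite lieA (gt_yx T) yu lie0r addr0 hu E addNr scale0r.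
rewrite xu lieZr -/u => /eqP; rewrite scaler_eq0 oppr_eq0 (negPf (ch0 1)) /=.
by move/eqP.
Qed.

(** The nonvanishing clauses give a nonzero vector of degree -2 or 2, where the sum of the weights
    for all triples is under control. *)
Lemma triple_zero h0 y h x v c : graded_triple h0 y h x ->
  [lie h0, v] = 0 -> [lie h, v] = c *: v -> v != 0 ->
  [\/ c = 0, c = 1 /\ [lie y, v] != 0 | c = -1 /\ [lie x, v] != 0].
Proof.
move=> T v0 vc vn0; have T' := graded_triple_swap T.
have xyv : [lie x, [lie y, v]] = [lie y, [lie x, v]] - c *: v.
  by rewrite lieA (lieC x y) (gt_yx T) lieNl vc addrC.
have [u0|u0] := eqVneq [lie y, v] 0; last first.
  by have [->|->] := triple_zero_pos T v0 vc u0; [apply: Or31|apply: Or32].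
have [w0|w0] := eqVneq [lie x, v] 0.
  apply: Or31; move: xyv; rewrite u0 w0 !lie0r sub0r => /esym/eqP.
  by rewrite oppr_eq0 scaler_eq0 (negPf vn0) orbF => /eqP.
have [||E|E] := triple_zero_pos T' (v := v) (c := - c) _ _ w0.
- by rewrite lieNl v0 oppr0.
- by rewrite lieNl vc scaleNr.
- by apply: Or31; rewrite -(opprK c) E oppr0.
by apply: Or33; split=> //; rewrite -E opprK.
Qed.

End OneTriple.

Lemma sum_nat_eq1E (I : finType) (P : pred I) (z : I -> nat) :
  (\sum_(i | P i) z i = 1)%N -> exists s, [/\ P s, z s = 1%N
    & forall i, P i -> i != s -> z i = 0%N].
Proof.
move=> E; have [s /andP [Ps zs]|none] := pickP (fun i => P i && (z i != 0%N)); last first.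
  by move: E; rewrite big1 // => i Pi; have := none i; rewrite Pi /= => /eqP.
move: E; rewrite (bigD1 s) //= => E.
have zs1 : z s = 1%N by lia.
exists s; split=> // i Pi is_; move: E; rewrite zs1 => -[] /eqP.
by rewrite sum_nat_eq0 => /forallP /(_ i); rewrite Pi is_ => /eqP.
Qed.

Section MultiTriple.
Variables (F : fieldType) (L : lieType F).
Hypothesis ch0 : forall n, n.+1%:R != 0 :> F.
Variables (k : nat) (H0 : L) (X Y H : 'I_k.+1 -> L).
Hypothesis T : forall j, graded_triple H0 (Y j) (H j) (X j).
Hypothesis HX : forall i j, i != j -> [lie H i, X j] = 0.
Hypothesis HY : forall i j, i != j -> [lie H i, Y j] = 0.
Hypothesis H0E : H0 = \sum_j H j.
Implicit Types (v : L) (c : 'I_k.+1 -> F).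

Lemma weights_sum v c e : (forall i, [lie H i, v] = c i *: v) ->
  [lie H0, v] = e *: v -> v != 0 -> \sum_i c i = e.
Proof.
move=> vc; rewrite H0E lie_suml (eq_bigr (fun i => c i *: v)) // -scaler_suml.
by move/eqP; rewrite -subr_eq0 -scalerBl scaler_eq0 subr_eq0 => /orP [/eqP //|->].
Qed.

Lemma weights_high v c : [lie H0, v] = 2%:R *: v ->
  (forall i, [lie H i, v] = c i *: v) -> v != 0 ->
  exists2 z : 'I_k.+1 -> nat, forall i, c i = (z i)%:R & (\sum_i z i = 2)%N.
Proof.
move=> v0 vc vn0.
have /fin_all_exists [z zE] : forall i, exists n : nat, c i = n%:R.
  by move=> i; have [n _ ->] := triple_high ch0 (T i) v0 (vc i) vn0; exists n.
exists z => //; have := weights_sum vc v0 vn0.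
rewrite (eq_bigr (fun i => (z i)%:R)) // -natr_sum => /eqP.
by rewrite natr_eq // => /eqP.
Qed.

Lemma weights_low v c : [lie H0, v] = - 2%:R *: v ->
  (forall i, [lie H i, v] = c i *: v) -> v != 0 ->
  exists2 z : 'I_k.+1 -> nat, forall i, c i = - (z i)%:R & (\sum_i z i = 2)%N.
Proof.
move=> v0 vc vn0.
have /fin_all_exists [z zE] : forall i, exists n : nat, c i = - n%:R.
  by move=> i; have [n _ ->] := triple_low ch0 (T i) v0 (vc i) vn0; exists n.
exists z => //; have := weights_sum vc v0 vn0.
rewrite (eq_bigr (fun i => - (z i)%:R)) // sumrN -natr_sum => /oppr_inj /eqP.
by rewrite natr_eq // => /eqP.
Qed.

(** If [c j = 1], then [Y j] moves [v] to degree -2, where the weights are opposites of naturals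
    with sum 2. The weight at [j] becomes -1, so exactly one other index [s] has weight -1. A weight
    -1 leads back to this case through [X s]. *)
Lemma weights_zero v c : [lie H0, v] = 0 ->
  (forall i, [lie H i, v] = c i *: v) -> v != 0 ->
  (forall i, c i = 0) \/
  exists j s, [/\ j != s, c j = 1, c s = -1 & forall i, i != j -> i != s -> c i = 0].
Proof.
move=> v0 vc vn0; have v0' : [lie H0, v] = 0 *: v by rewrite v0 scale0r.
have pos j : c j = 1 -> [lie Y j, v] != 0 ->
    exists s, [/\ j != s, c s = -1 & forall i, i != j -> i != s -> c i = 0].
  move=> cj u0; pose c' i := if i == j then -1 else c i.
  have [||z zE zs] := weights_low (v := [lie Y j, v]) (c := c') _ _ u0.
  - by rewrite (eigen_br (gt_0y (T j)) v0') addr0.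
  - move=> i; rewrite /c'; case: eqP => [->|/eqP ij].
      by rewrite (eigen_br (gt_hy (T j)) (vc j)) cj; congr (_ *: _); ring.
    by rewrite lieA HY // lie0l add0r vc lieZr.
  have zj : z j = 1%N.
    have := zE j; rewrite /c' eqxx => /oppr_inj /eqP.
    by rewrite (natr_eq ch0 1) => /eqP.
  move: zs; rewrite (bigD1 j) //= zj => -[] /sum_nat_eq1E [s [sj z1 z0]].
  exists s; rewrite eq_sym; split=> // [|i ij is_].
    by have := zE s; rewrite /c' (negPf sj) z1.
  by have := zE i; rewrite /c' (negPf ij) z0 // oppr0.
have neg s : c s = -1 -> [lie X s, v] != 0 -> exists2 j, j != s & c j = 1.
  move=> cs w0; pose c' i := if i == s then 1 else c i.
  have [||z zE zs] := weights_high (v := [lie X s, v]) (c := c') _ _ w0.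
  - by rewrite (eigen_br (gt_0x (T s)) v0') addr0.
  - move=> i; rewrite /c'; case: eqP => [->|/eqP is_].
      by rewrite (eigen_br (gt_hx (T s)) (vc s)) cs; congr (_ *: _); ring.
    by rewrite lieA HX // lie0l add0r vc lieZr.
  have zs1 : z s = 1%N.
    have := zE s; rewrite /c' eqxx => /eqP.
    by rewrite (natr_eq ch0 1) => /eqP.
  move: zs; rewrite (bigD1 s) //= zs1 => -[] /sum_nat_eq1E [j [js z1 _]].
  by exists j => //; have := zE j; rewrite /c' (negPf js) z1.
have cP j := triple_zero ch0 (T j) v0 (vc j) vn0.
have fromj j : c j = 1 -> [lie Y j, v] != 0.
  move=> cj; case: (cP j) => [E|[] //|[E _]].
    by move: (ch0 0); rewrite -[1%:R]cj E eqxx.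
  have E2 : 2%:R = c j - c j by rewrite {1}cj E opprK.
  by move: (ch0 1); rewrite E2 subrr eqxx.
have [j /eqP cj|no1] := pickP (fun j => c j == 1).
  by right; have [s [js cs c0]] := pos j cj (fromj j cj); exists j, s.
left=> i; case: (cP i) => [//|[E _]|[E w0]]; first by have := no1 i; rewrite E eqxx.
by have [j _ cj] := neg i E w0; have := no1 j; rewrite cj eqxx.
Qed.

(* The coefficients decrease in [j], so that [E_{i,j}(1,-1)] has positive weight
   exactly when [i < j]. *)
Definition height_element : L := \sum_(j < k.+1) (k.+1 - j)%N%:R *: H j.

Lemma height_weight v c : (forall i, [lie H i, v] = c i *: v) ->
  [lie height_element, v] = (\sum_(j < k.+1) (k.+1 - j)%N%:R * c j) *: v.
Proof.
move=> vc; rewrite /height_element lie_suml scaler_suml; apply: eq_bigr => j _.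
by rewrite lieZl vc scalerA.
Qed.

Lemma height_bounds (z : 'I_k.+1 -> nat) : (\sum_i z i = 2)%N ->
  (0 < \sum_(j < k.+1) (k.+1 - j) * z j <= k.+1.*2)%N.
Proof.
move=> zs; apply/andP; split; last first.
  rewrite -muln2 -zs big_distrr /=; apply: leq_sum => j _.
  by rewrite leq_mul2r leq_subr orbT.
rewrite lt0n; apply/eqP => /eqP; rewrite sum_nat_eq0 => /forallP E.
suff : (\sum_i z i = 0)%N by rewrite zs.
apply: big1 => i _; have := E i; rewrite muln_eq0 subn_eq0 leqNgt ltn_ord /=.
by move/eqP.
Qed.

Lemma height_zero v c j s : (forall i, [lie H i, v] = c i *: v) ->
  j != s -> c j = 1 -> c s = -1 -> (forall i, i != j -> i != s -> c i = 0) ->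
  [lie height_element, v] = ((s : nat)%:Z - (j : nat)%:Z)%:~R *: v.
Proof.
move=> vc js cj cs c0; rewrite (height_weight vc); congr (_ *: _).
rewrite (bigD1 j) //= (bigD1 s) 1?eq_sym //= big1 => [|i /andP [ij is_]]; last first.
  by rewrite c0 // mulr0.
rewrite cj cs mulr1 mulrN1 addr0 !natrB ?leq_ord // ?(ltnW (ltn_ord _)) //.
by rewrite intrB -!pmulrn; ring.
Qed.

End MultiTriple.

(** * Regular gradings *)

Section GradedAlgebra.
Variables (F : fieldType) (L : lieType F) (H0 : L).
Hypothesis ch0 : forall n, n.+1%:R != 0 :> F.
Hypothesis grade_sum : (grade H0 (- 2) + grade H0 0 + grade H0 2)%VS = fullv.
Implicit Types (x y z h v : L) (U V : {vspace L}).

Lemma gradeP c x : (x \in grade H0 c) = ([lie H0, x] == c *: x).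
Proof. by rewrite leigenspaceP adE. Qed.

Definition degrees : seq int := [:: -2; 0; 2].

Lemma degree_ind (T : L -> Prop) : (forall x y, T x -> T y -> T (x + y)) ->
  (forall (j : int) x, j \in degrees -> [lie H0, x] = j%:~R *: x -> T x) ->
  forall x, T x.
Proof.
move=> TD Tj x; have := memvf x; rewrite -grade_sum => /memv_addP [u + [w]].
rewrite gradeP => + /eqP w2 -> => /memv_addP [u1 + [u2]].
rewrite !gradeP => /eqP u1m /eqP u20 ->.
by apply: (TD); [apply: TD; [apply: (Tj (-2))|apply: (Tj 0)]|apply: (Tj 2)].
Qed.

Lemma degrees_split x : hor (ad H0) (\prod_(j <- degrees) ('X - j%:~R%:P)) x = 0.
Proof.
move: x; apply: degree_ind => [x y Ex Ey|j x jd xj]; first by rewrite linearD /= Ex Ey addr0.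
by apply: hor_prod_int jd _; rewrite adE.
Qed.

Lemma degree_mem x c : x != 0 -> [lie H0, x] = c *: x ->
  exists2 j : int, j \in degrees & c = j%:~R.
Proof.
by move=> x0 xc; apply: (eigenvalue_mem (fun y _ => degrees_split y) (memvf x)).
Qed.

Lemma degree_eq0 (c : int) x : c \notin degrees -> [lie H0, x] = c%:~R *: x -> x = 0.
Proof.
move=> cd xc; apply/eqP; apply: contraNT cd => x0; have [j jd /eqP] := degree_mem x0 xc.
by rewrite intr_eq // => /eqP ->.
Qed.

Lemma degree4_eq0 x : [lie H0, x] = 4%:R *: x -> x = 0.
Proof. exact: (@degree_eq0 4). Qed.

Lemma degreeN4_eq0 x : [lie H0, x] = - 4%:R *: x -> x = 0.
Proof. exact: (@degree_eq0 (- 4)). Qed.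

(** The square of [ad H0] divided by 4 is the projection [T] on the degrees 2 and -2, so the value
    is 4 times its rank. *)
Lemma killing_degree_neq0 : grade H0 2 != 0%VS -> killing H0 H0 != 0.
Proof.
move=> g2; pose T := 4%:R^-1 *: (ad H0 \o ad H0)%VF.
have n4 : 4%:R != 0 :> F by exact: ch0.
have TE x : T x = 4%:R^-1 *: [lie H0, [lie H0, x]].
  by rewrite scale_lfunE comp_lfunE !adE.
have Tj (j : int) x : j \in degrees -> [lie H0, x] = j%:~R *: x -> T (T x) = T x.
  move=> jd xj; have Tx : T x = (4%:R^-1 * j%:~R * j%:~R) *: x.
    by rewrite TE xj lieZr xj !scalerA.
  rewrite {1}Tx linearZ /= {1 2}Tx scalerA; congr (_ *: _).
  move: jd; rewrite !inE => /or3P [] /eqP ->; last by field.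
    by field.
  by rewrite !mulr0.
have TT x : T (T x) = T x.
  move: x; apply: degree_ind => [x y Ex Ey|]; last exact: Tj.
  by rewrite !linearD /= Ex Ey.
have : etr T = 4%:R^-1 * killing H0 H0 by rewrite etrZ.
rewrite (etr_idem TT) => E; apply: contraNneq g2 => K0.
have {}E : T = 0.
  apply/eqP; rewrite -rank_mxof_eq0; move/eqP: E; rewrite K0 mulr0.
  by case: (\rank _) => // n; rewrite (negPf (ch0 n)).
rewrite -subv0; apply/subvP => x; rewrite gradeP memv0 => /eqP x2.
have : T x = x.
  by rewrite TE x2 lieZr x2 !scalerA -[RHS]scale1r; congr (_ *: _); field.
by rewrite E zero_lfunE => <-.
Qed.

(** The radical of the form is an ideal that does not contain [H0], so simplicity makes it 0. *)
Lemma simple_nondegenerate : simple_lie L -> grade H0 2 != 0%VS ->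
  nondegenerate_on {:L}.
Proof.
case=> _ simL g2 x xL xo.
have iL : is_ideal {:L} {:L} by apply/is_idealP; split; rewrite ?subvv // => *; exact: memvf.
have sL : is_subalgebra {:L} by apply: ideal_subalgebra iL.
have [E|E] := simL _ (perp_ideal sL iL).
  by apply/eqP; rewrite -memv0 -E; apply/perpP.
have : H0 \in perp {:L} {:L} by rewrite E memvf.
case/perpP=> _ /(_ H0 (memvf _)) /eqP.
by rewrite (negPf (killing_degree_neq0 g2)).
Qed.

End GradedAlgebra.

(** * The involution *)

Section Exponential.
Variables (F : fieldType) (L : lieType F).
Hypothesis ch0 : forall n, n.+1%:R != 0 :> F.
Implicit Types (x y z u v w : L) (U V : {vspace L}).

Let h2 : 2%:R != 0 :> F := ch0 1.

Definition cube_zero x := forall v, [lie x, [lie x, [lie x, v]]] = 0.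

(** The sum in [exp_ad] has [\dim {:L} + 1] terms, so dimension at least 2 ensures that the
    quadratic one is present. *)
Lemma exp_adE x v : (1 < \dim {:L})%N -> cube_zero x ->
  exp_ad x v = v + [lie x, v] + 2%:R^-1 *: [lie x, [lie x, v]].
Proof.
move=> dL x3; rewrite /exp_ad sum_lfunE.
have E n : (iter n (fun f : 'End(L) => (ad x \o f)%VF) \1%VF) v = iter n (ad x) v.
  exact: fexpE.
case: (\dim {:L}) dL => [|[|d]] // _; rewrite 3!big_ord_recl big1 => [|i _].
  rewrite !scale_lfunE !E /= !adE fact0 factS fact0 invr1 !scale1r addr0 addrA.
  by rewrite factS factS fact0.
by rewrite scale_lfunE E /= !adE x3 scaler0.
Qed.

Section Automorphism.
Hypothesis dL : (1 < \dim {:L})%N.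

Lemma exp_ad_br x u v : cube_zero x ->
  exp_ad x [lie u, v] = [lie exp_ad x u, exp_ad x v].
Proof.
move=> x3; rewrite !exp_adE //.
set u1 := [lie x, u]; set u2 := [lie x, u1].
set v1 := [lie x, v]; set v2 := [lie x, v1].
have e1 : [lie x, [lie u, v]] = [lie u1, v] + [lie u, v1] by rewrite lieA.
have e2 : [lie x, [lie x, [lie u, v]]] = [lie u2, v] + ([lie u1, v1] + [lie u1, v1]) + [lie u, v2].
  by rewrite e1 lieDr (lieA x u1) (lieA x u v1) -/u2 -/v2 -/u1 !addrA.
have x3u : [lie x, u2] = 0 by apply: x3.
have x3v : [lie x, v2] = 0 by apply: x3.
have e3 : [lie u2, v1] + [lie u1, v2] = 0.
  have := x3 [lie u, v]; rewrite e2 !lieDr.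
  rewrite (lieA x u2) (lieA x u1) (lieA x u v2) -/u2 -/v2 -/u1 -/v1.
  rewrite x3u x3v lie0l lie0r add0r addr0 addrAC -mulr2n -mulrS -scaler_nat.
  by move/eqP; rewrite scaler_eq0 (negPf (ch0 2)) => /eqP.
have e4 : [lie u2, v2] = 0.
  have := congr1 (lie_br x) e3; rewrite lie0r lieDr (lieA x u2) (lieA x u1) -/u2 -/v2 x3u x3v.
  rewrite lie0l lie0r addr0 add0r -mulr2n -scaler_nat => /eqP.
  by rewrite scaler_eq0 (negPf h2) => /eqP.
rewrite e2 e1 !lieDl !lieDr !lieZl !lieZr e4 !scaler0 addr0.
have e5 : [lie u2, v1] = - [lie u1, v2] by apply/eqP; rewrite -addr_eq0 e3.
have half w : 2%:R^-1 *: w + 2%:R^-1 *: w = w.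
  by rewrite -mulr2n -scaler_nat scalerA mulfV // scale1r.
rewrite e5 !scalerDr half scalerN.
(* Terms are grouped by degree; the last group consists of the two cubic terms, opposite by [e5]. *)
rewrite [RHS](+%R.[AC ((3 * 3) * 2) ((1 * (4 * 2)) * ((7 * 5) * 3) * (6 * 8))]).
by rewrite subrr addr0.
Qed.

Lemma exp_ad_inj x v : cube_zero x -> exp_ad x v = 0 -> v = 0.
Proof.
move=> x3; rewrite exp_adE // => E.
have v2 : [lie x, [lie x, v]] = 0.
  by have := congr1 (fun w => [lie x, [lie x, w]]) E; rewrite !lieDr !lieZr !x3 !lie0r scaler0 !addr0.
have v1 : [lie x, v] = 0.
  by have := congr1 (lie_br x) E; rewrite !lieDr !lieZr v2 !lie0r scaler0 !addr0.
by move: E; rewrite v2 v1 scaler0 !addr0.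
Qed.

End Automorphism.
End Exponential.

Section Automorphisms.
Variables (F : fieldType) (L : lieType F) (s : 'End(L)).
Hypothesis s_br : forall u v, s [lie u, v] = [lie s u, s v].
Hypothesis s_inj : forall v, s v = 0 -> v = 0.

Lemma automorphism_ker : lker s == 0%VS.
Proof.
by rewrite -subv0; apply/subvP => v; rewrite memv_ker memv0 => /eqP /s_inj ->.
Qed.

Lemma automorphism_killing u v : killing (s u) (s v) = killing u v.
Proof.
have ads w : ad (s w) = (s \o ad w \o s^-1)%VF.
  apply/lfunP => x; rewrite !comp_lfunE !adE s_br.
  by rewrite (lker0_lfunVK automorphism_ker).
rewrite !killingE !ads -!comp_lfunA.
rewrite (comp_lfunA (s^-1)%VF s) (lker0_compVf automorphism_ker) comp_lfun1l.
by rewrite etrC -!comp_lfunA (lker0_compVf automorphism_ker) comp_lfun1r.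
Qed.

Lemma automorphism_dim (U : {vspace L}) : \dim (s @: U)%VS = \dim U.
Proof. by apply: limg_dim_eq; rewrite (eqP automorphism_ker) capv0. Qed.

End Automorphisms.

Section Involution.
Variables (F : fieldType) (L : lieType F) (H0 : L).
Hypothesis ch0 : forall n, n.+1%:R != 0 :> F.
Hypothesis grade_sum : (grade H0 (- 2) + grade H0 0 + grade H0 2)%VS = fullv.
Variables (k : nat) (H X Y : 'I_k.+1 -> L).
Hypothesis T : forall j, graded_triple H0 (Y j) (H j) (X j).
Hypothesis lieYX : forall i j, i != j -> [lie Y i, X j] = 0.
Hypothesis lieHX : forall i j, i != j -> [lie H i, X j] = 0.
Hypothesis lieHY : forall i j, i != j -> [lie H i, Y j] = 0.
Hypothesis Xn0 : forall j, X j != 0.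
Implicit Types (x y z v w t : L).

Let h2 : 2%:R != 0 :> F := ch0 1.
Local Notation Ip := (\sum_j X j).
Local Notation Im := (\sum_j Y j).
Local Notation sigma := (involution_of Im Ip).

Lemma dim_gt1 : (1 < \dim {:L})%N.
Proof.
rewrite ltnNge; apply/negP => le1.
have E : <[X ord0]>%VS = fullv.
  by apply/eqP; rewrite eqEdim subvf dim_vline Xn0.
have : H ord0 \in <[X ord0]>%VS by rewrite E memvf.
case/vlineP=> c Hc; have := gt_hx (T ord0); rewrite Hc lieZl lie_brxx scaler0.
move/esym/eqP; rewrite scaler_eq0 (negPf h2) (negPf (Xn0 _)).
by [].
Qed.

Lemma degree_Ip : [lie H0, Ip] = 2%:R *: Ip.
Proof. by rewrite lie_sumr scaler_sumr; apply: eq_bigr => j _; rewrite (gt_0x (T j)). Qed.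

Lemma degree_Im : [lie H0, Im] = - 2%:R *: Im.
Proof. by rewrite lie_sumr scaler_sumr; apply: eq_bigr => j _; rewrite (gt_0y (T j)). Qed.

Lemma cube_zero_degree x (c : int) : (`|c| = 2)%N -> [lie H0, x] = c%:~R *: x -> cube_zero x.
Proof.
move=> c2 xc; apply: (degree_ind grade_sum) => [u w Eu Ew|e u ed ue].
  by rewrite !lieDr Eu Ew addr0.
apply: (degree_eq0 ch0 grade_sum (c := c + (c + (c + e)))).
  by move: ed; rewrite !inE; lia.
by rewrite (eigen_br xc (eigen_br xc (eigen_br xc ue))) !intrD.
Qed.

Lemma cube_zero_Ip : cube_zero Ip.
Proof. exact: (cube_zero_degree (c := 2) erefl degree_Ip). Qed.

Lemma cube_zero_Im : cube_zero Im.
Proof. by apply: (cube_zero_degree (c := -2)); rewrite ?degree_Im. Qed.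

Lemma sigmaE v : sigma v = exp_ad Ip (exp_ad Im (exp_ad Ip v)).
Proof. by rewrite !comp_lfunE. Qed.

Lemma sigma_br u v : sigma [lie u, v] = [lie sigma u, sigma v].
Proof.
by rewrite !sigmaE !(exp_ad_br ch0 dim_gt1) //; [exact: cube_zero_Ip|exact: cube_zero_Im|exact: cube_zero_Ip].
Qed.

Lemma sigma_inj v : sigma v = 0 -> v = 0.
Proof.
rewrite sigmaE => /(exp_ad_inj dim_gt1 cube_zero_Ip) /(exp_ad_inj dim_gt1 cube_zero_Im).
exact: (exp_ad_inj dim_gt1 cube_zero_Ip).
Qed.

Let expp v := exp_adE v dim_gt1 cube_zero_Ip.
Let expm v := exp_adE v dim_gt1 cube_zero_Im.

Lemma sigma_fixed z : (forall j, [lie X j, z] = 0) -> (forall j, [lie Y j, z] = 0) ->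
  sigma z = z.
Proof.
move=> Xz Yz; have pz : [lie Ip, z] = 0 by rewrite lie_suml big1.
have mz : [lie Im, z] = 0 by rewrite lie_suml big1.
by rewrite sigmaE !(expp, expm) pz lie0r scaler0 !addr0 mz lie0r scaler0 !addr0 pz lie0r scaler0 !addr0.
Qed.

(** The vectors [w], [t] and [[lie Im, t]] behave as in the adjoint representation of the diagonal
    triple, where the Weyl element acts by -1 on the zero weight vector [t]. *)
Lemma sigma_anti j w : [lie H0, w] = 2%:R *: w -> [lie H j, w] = 2%:R *: w ->
  (forall i, i != j -> [lie Y i, w] = 0) -> sigma [lie Y j, w] = - [lie Y j, w].
Proof.
move=> w0 wj Yw; set t := [lie Y j, w].
have Xw i : [lie X i, w] = 0.
  by apply: (degree4_eq0 ch0 grade_sum); rewrite (eigen_br (gt_0x (T i)) w0) -natrD.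
have pw : [lie Ip, w] = 0 by rewrite lie_suml big1.
have pt : [lie Ip, t] = - (2%:R *: w).
  rewrite lie_suml (bigD1 j) //= big1 => [|i ij].
    by rewrite /t lieA Xw lie0r (lieC (X j)) (gt_yx (T j)) lieNl wj !addr0.
  by rewrite /t lieA Xw lie0r (lieC (X i)) lieYX 1?eq_sym // oppr0 lie0l addr0.
have mw : [lie Im, w] = t.
  by rewrite lie_suml (bigD1 j) //= big1 ?addr0.
set s := [lie Im, t]; have ms : [lie Im, s] = 0.
  apply: (degreeN4_eq0 ch0 grade_sum).
  rewrite (eigen_br degree_Im (eigen_br degree_Im (eigen_br (gt_0y (T j)) w0))).
  by congr (_ *: _); ring.
have ep : exp_ad Ip t = t - 2%:R *: w.
  by rewrite expp pt lieNr lieZr pw scaler0 oppr0 scaler0 addr0.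
have epw : exp_ad Ip w = w by rewrite expp pw lie0r scaler0 !addr0.
have et : exp_ad Im t = t + s by rewrite expm -/s ms scaler0 addr0.
have ew : exp_ad Im w = w + t + 2%:R^-1 *: s by rewrite expm mw.
rewrite sigmaE ep linearB linearZ /= et ew !scalerDr scalerA mulfV // scale1r.
have -> : t + s - (2%:R *: w + 2%:R *: t + s) = - t - 2%:R *: w.
  rewrite opprD addrACA subrr addr0 addrC opprD -addrA; rewrite addrC; congr (_ + _).
  by rewrite scaler_nat mulr2n opprD addrNK.
by rewrite linearB linearN linearZ /= ep epw opprB addrAC subrr add0r.
Qed.

Lemma sigma_H j : sigma (H j) = - H j.
Proof.
rewrite -(gt_yx (T j)) sigma_anti //; [exact: gt_0x (T j)|exact: gt_hx (T j)|].
by move=> i ij; apply: lieYX.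
Qed.

(** Under the triples, [x] has weight 0: it is an invariant [z] plus zero weight vectors of adjoint
    type, collected in [t]. The factor -1/2 makes [[lie X i, t]] equal to [[lie X i, x]]. *)
Lemma sigma_dec x : (forall j, [lie H j, x] = 0) -> [lie H0, x] = 0 ->
  (forall i j, i != j -> [lie Y i, [lie X j, x]] = 0) ->
  exists z t, [/\ x = z + t, sigma z = z, sigma t = - t,
     t = - (2%:R^-1 *: \sum_j [lie Y j, [lie X j, x]])
   & (forall j, [lie X j, z] = 0) /\ (forall j, [lie Y j, z] = 0)].
Proof.
move=> Hx H0x YXx; have H0x' : [lie H0, x] = 0 *: x by rewrite H0x scale0r.
pose w j := [lie X j, x].
have w0 j : [lie H0, w j] = 2%:R *: w j by rewrite (eigen_br (gt_0x (T j)) H0x') addr0.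
have wj i j : [lie H i, w j] = (if i == j then 2%:R else 0) *: w j.
  case: eqP => [->|/eqP ij]; rewrite /w lieA Hx lie0r addr0.
    by rewrite (gt_hx (T j)) lieZl.
  by rewrite lieHX // lie0l scale0r.
have Xw i j : [lie X i, w j] = 0.
  by apply: (degree4_eq0 ch0 grade_sum); rewrite (eigen_br (gt_0x (T i)) (w0 j)) -natrD.
pose t := - (2%:R^-1 *: \sum_j [lie Y j, w j]); pose z := x - t.
have st : sigma t = - t.
  rewrite /t linearN linearZ linear_sum /=; congr (- _); rewrite -scalerN -sumrN.
  congr (_ *: _); apply: eq_bigr => j _; apply: sigma_anti => //.
    by rewrite wj eqxx.
  by move=> i ij; apply: YXx.
have Xt i : [lie X i, t] = w i.
  rewrite /t lieNr lieZr lie_sumr (bigD1 i) //= big1 => [|j ji].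
    rewrite lieA Xw lie0r (lieC (X i)) (gt_yx (T i)) lieNl wj eqxx !addr0.
    by rewrite scalerN opprK scalerA mulVf // scale1r.
  by rewrite lieA Xw lie0r (lieC (X i)) lieYX // oppr0 lie0l addr0.
have Xz i : [lie X i, z] = 0 by rewrite /z lieBr Xt subrr.
have Hz i : [lie H i, z] = 0.
  rewrite /z lieBr Hx sub0r /t lieNr opprK lieZr lie_sumr big1 ?scaler0 // => j _.
  rewrite lieA wj; case: eqP => [->|/eqP ij].
    by rewrite (gt_hy (T j)) lieZl lieZr scaleNr addNr.
  by rewrite lieHY // lie0l scale0r lie0r addr0.
have H0z : [lie H0, z] = 0 *: z.
  rewrite scale0r /z lieBr H0x sub0r /t lieNr opprK lieZr lie_sumr big1 ?scaler0 // => j _.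
  by rewrite (eigen_br (gt_0y (T j)) (w0 j)) addNr scale0r.
(* The vector [v] is killed by [X i] and [Y i], hence by [H i], whereas its weight is -2. *)
have Yz i : [lie Y i, z] = 0.
  set v := [lie Y i, z].
  have Xv : [lie X i, v] = 0.
    by rewrite lieA Xz lie0r (lieC (X i)) (gt_yx (T i)) lieNl Hz oppr0 addr0.
  have dv := eigen_br (gt_0y (T i)) H0z.
  have Yv : [lie Y i, v] = 0.
    apply: (degreeN4_eq0 ch0 grade_sum); rewrite (eigen_br (gt_0y (T i)) dv).
    by congr (_ *: _); ring.
  have : [lie H i, v] = 0 by rewrite -(gt_yx (T i)) lieAl Xv Yv !lie0r subrr.
  rewrite /v lieA (gt_hy (T i)) Hz lie0r addr0 lieZl => /eqP.
  by rewrite scaler_eq0 oppr_eq0 (negPf h2) => /eqP.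
exists z, t; split=> //; first by rewrite subrK.
exact: sigma_fixed.
Qed.

End Involution.

(** * Parabolic subalgebras of a grading *)

Section OppositeGrading.
Variables (F : fieldType) (L : lieType F).
Hypothesis ch0 : forall n, n.+1%:R != 0 :> F.
Variables (g : {vspace L}) (h : L) (js : seq int).
Hypothesis sg : is_subalgebra g.
Hypothesis hg : h \in g.
Hypothesis ujs : uniq js.
Hypothesis gjs : forall x, x \in g ->
  hor (ad h) (\prod_(j <- js) ('X - j%:~R%:P)) x = 0.

Local Notation js' := [seq - j | j <- js].

Lemma opposite_graded_part P :
  graded_part g (- h) js' P = graded_part g h js (fun j => P (- j)).
Proof.
rewrite /graded_part big_map; apply: eq_bigr => j _; congr (_ :&: _)%VS.
apply/vspaceP => x; rewrite !leigenspaceP !adE lieNl intrN scaleNr.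
by rewrite (inj_eq oppr_inj).
Qed.

Lemma opposite_levi_part : levi_part g (- h) js' = levi_part g h js.
Proof.
by rewrite /levi_part opposite_graded_part; apply: eq_bigl => j; rewrite oppr_eq0.
Qed.

Lemma opposite_pos_part : pos_part g (- h) js' = neg_part g h js.
Proof.
by rewrite /pos_part opposite_graded_part; apply: eq_bigl => j; rewrite oppr_gt0.
Qed.

Lemma opposite_uniq : uniq js'.
Proof. by rewrite map_inj_uniq //; exact: oppr_inj. Qed.

Lemma opposite_split x : x \in g ->
  hor (ad (- h)) (\prod_(j <- js') ('X - j%:~R%:P)) x = 0.
Proof.
rewrite -{1}(graded_partT ch0 sg hg ujs gjs); move: x.
apply: graded_part_ind => [|x y Ex Ey|j x jjs _ xg hx].
- exact: linear0.
- by rewrite linearD /= Ex Ey addr0.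
by apply: hor_prod_int (map_f _ jjs) _; rewrite adE lieNl hx intrN scaleNr.
Qed.

Lemma opposite_parabolic_cap :
  (parabolic_part g h js :&: parabolic_part g (- h) js')%VS = levi_part g h js.
Proof.
rewrite /parabolic_part opposite_levi_part opposite_pos_part.
rewrite -vspace_modl ?addvSl //.
have -> : (pos_part g h js :&: (levi_part g h js + neg_part g h js) = 0)%VS; last exact: addv0.
apply/eqP; rewrite -subv0 -(graded_part_disjoint ch0 g h js (P := fun j => 0 < j) (Q := fun j => j <= 0)).
  apply: capvS => //; rewrite subv_add; apply/andP; split; apply: (graded_partS ch0 gjs) => j.
    by move/eqP->.
  exact: ltW.
by move=> j j0; rewrite leNgt j0.
Qed.

End OppositeGrading.

Section ParabolicExtension.
Variables (F : fieldType) (Fbar : closedFieldType) (iota : {rmorphism F -> Fbar}).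
Variable L : lieType F.
Hypothesis ch0 : forall n, n.+1%:R != 0 :> F.
Variables (g : {vspace L}) (h : L) (js : seq int).
Hypothesis sg : is_subalgebra g.
Hypothesis hg : h \in g.
Hypothesis ujs : uniq js.
Hypothesis gjs : forall x, x \in g ->
  hor (ad h) (\prod_(j <- js) ('X - j%:~R%:P)) x = 0.
Hypothesis ng : nondegenerate_on g.

Let ch0K := ext_ch0 iota ch0.
Let sgK := ext_subalgebra iota sg.
Let gjsK := ext_grading (iota := iota) ch0 sg hg ujs gjs.
Let ngK := ext_sub_nondegenerate (iota := iota) ng.

Lemma ext_levi_part :
  ext_sub iota (levi_part g h js) = levi_part (ext_sub iota g) (ext_elt iota h) js.
Proof. exact: ext_graded_part. Qed.

Lemma ext_pos_part :
  ext_sub iota (pos_part g h js) = pos_part (ext_sub iota g) (ext_elt iota h) js.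
Proof. exact: ext_graded_part. Qed.

Lemma parabolic_part_is_parabolic : is_parabolic iota g (parabolic_part g h js).
Proof.
split; [exact: parabolic_sub|exact: parabolic_subalgebra|].
have [b bb] := exists_borel (ext_sub iota (levi_part g h js)).
exists (b + ext_sub iota (pos_part g h js))%VS.
  rewrite ext_pos_part; apply: parabolic_borel => //; first exact: ext_sub_mem.
  by rewrite -ext_levi_part.
by rewrite /parabolic_part ext_sub_add; apply: addvS => //; case: bb.
Qed.

(** * Minimality, for an automorphism [s] reversing the grading, with [M0] in the role of the
    centralizer of [a] *)

Section Minimal.
Hypothesis levi_full : forall x, [lie h, x] = 0 -> x \in levi_part g h js.
Hypothesis nL : nondegenerate_on {:L}.
Hypothesis hjs : forall x, hor (ad h) (\prod_(j <- js) ('X - j%:~R%:P)) x = 0.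
Variables (s : 'End(L)) (M0 : {vspace L}).
Local Notation l := (levi_part g h js).
Local Notation n := (pos_part g h js).
Local Notation nm := (neg_part g h js).
Hypothesis s_br : forall u v, s [lie u, v] = [lie s u, s v].
Hypothesis s_inj : forall v, s v = 0 -> v = 0.
Hypothesis s_levi : forall x, x \in l -> s x \in l.
Hypothesis s_pos : forall x, x \in n -> s x \in nm.
Hypothesis s_dec : forall x, x \in l -> exists z t, [/\ x = z + t, s z = z & s t = - t].
Hypothesis sM0 : is_subalgebra M0.
Hypothesis s_anti : forall x, x \in l -> s x = - x -> x \in M0.
Hypothesis M0_nilp : forall y, y \in M0 -> nilpotent_end (ad y) -> y = 0.

Let h2 : 2%:R != 0 :> F := ch0 1.
Let sl : is_subalgebra l := levi_subalgebra ch0 sg gjs.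
Let nl : nondegenerate_on l := levi_nondegenerate ch0 sg hg ujs gjs ng.
Let ll : stable l l := is_subalgebraP sl.

Lemma levi_split_dec x : x \in l ->
  exists z t, [/\ x = z + t, z \in l, t \in l, s z = z & s t = - t].
Proof.
move=> xl; have [z [t [E sz st]]] := s_dec xl.
have zl : z \in l.
  have : x + s x \in l by rewrite memvD ?s_levi.
  rewrite E linearD /= sz st addrACA subrr addr0 -mulr2n -scaler_nat => zz.
  by rewrite -[z]scale1r -(mulVf h2) -scalerA memvZ.
exists z, t; split=> //; have -> : t = x - z by rewrite E addrC addKr.
by rewrite memvB.
Qed.

Definition anti_part : {vspace L} := (l :&: leigenspace s (-1))%VS.

Lemma anti_partP {x} : reflect (x \in l /\ s x = - x) (x \in anti_part).
Proof.
apply: (iffP memv_capP) => -[xl]; rewrite leigenspaceP scaleN1r => sx; split=> //.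
  exact/eqP.
by rewrite sx.
Qed.

Lemma killing_fixed_anti z t : s z = z -> s t = - t -> killing z t = 0.
Proof.
move=> sz st; have := automorphism_killing s_br s_inj z t; rewrite sz st killingNr.
move/eqP; rewrite eq_sym -addr_eq0 -mulr2n -mulr_natl mulf_eq0 (negPf h2).
by move/eqP.
Qed.

(** The ideal of [l] generated by the elements that [s] negates; the second summand is fixed by
    [s]. *)
Definition anti_ideal : {vspace L} := (anti_part + brv anti_part anti_part)%VS.

Lemma anti_brv_fixed x : x \in brv anti_part anti_part -> x \in l /\ s x = x.
Proof.
case/brvE=> m [u [v [ua va ->]]]; split.
  by apply: memv_suml => i _; apply: ll; [case/memv_capP: (ua i)|case/memv_capP: (va i)].
rewrite linear_sum; apply: eq_bigr => i _ /=; rewrite s_br.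
have [_ ->] := anti_partP (ua i); have [_ ->] := anti_partP (va i).
by rewrite lieNl lieNr opprK.
Qed.

Lemma anti_ideal_ideal : is_ideal anti_ideal l.
Proof.
apply/is_idealP; split.
  rewrite subv_add capvSl; apply/subvP => x /anti_brv_fixed [] //.
have fix_anti z t : z \in l -> s z = z -> t \in anti_part -> [lie z, t] \in anti_part.
  move=> zl sz /anti_partP [tl st]; apply/anti_partP; split; first exact: ll.
  by rewrite s_br sz st lieNr.
move=> x y /levi_split_dec [z [t [-> zl tl sz st]]] /memv_addP [u ua [v vb ->]].
have ta : t \in anti_part by apply/anti_partP.
have zv : [lie z, v] \in brv anti_part anti_part.
  have [m [p [q [pa qa ->]]]] := brvE vb; rewrite lie_sumr; apply: memv_suml => i _.
  by rewrite lieA memvD // brv_mem // fix_anti.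
have [vl sv] := anti_brv_fixed vb.
rewrite lieDl !lieDr; apply: memvD; apply: memvD.
- by apply: memv_addl; apply: fix_anti.
- exact: memv_addr.
- by apply: memv_addr; apply: brv_mem.
by apply: memv_addl; rewrite lieC memvN fix_anti.
Qed.

Lemma anti_component_eq0 t : t \in l -> s t = - t ->
  (forall u, u \in anti_part -> killing t u = 0) -> t = 0.
Proof.
move=> tl st tu; apply: nl => // y /levi_split_dec [z [u [-> zl ul sz su]]].
rewrite killingDr killingC killing_fixed_anti // add0r; apply: tu.
by apply/anti_partP.
Qed.

(** This ideal may contain central elements of [l], so it need not lie in [[l, l]]. For [x = t + w]
    in the radical of its form, [t] is orthogonal to [anti_part], hence 0, and then [w] is central
    and lies in [[l, l]]. *)
Lemma nondegenerate_anti_ideal : nondegenerate_on anti_ideal.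
Proof.
move=> x xI xp; have iI := anti_ideal_ideal.
have [Il sI] := is_idealP iI.
pose J := (anti_ideal :&: perp l anti_ideal)%VS.
have iJ : is_ideal J l by apply: ideal_cap => //; apply: perp_ideal.
have cJ u v : u \in l -> v \in J -> [lie u, v] = 0.
  apply: (isotropic_ideal_central ch0 sl nl iJ) => p q /memv_capP [_ /perpP [_ pp]].
  by case/memv_capP=> qI _; exact: pp.
have xl := subvP Il _ xI.
have xJ : x \in J by apply/memv_capP; split=> //; apply/perpP.
have /memv_addP [t ta [w wb E]] := xI; have [tl st] := anti_partP ta.
have [wl sw] := anti_brv_fixed wb.
have t0 : t = 0.
  apply: anti_component_eq0 => // u ua; have [ul su] := anti_partP ua.
  have : killing x u = 0 by apply/xp/memv_addl.
  by rewrite E killingDl (killing_fixed_anti sw su) addr0.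
apply: (central_derived_eq0 ch0 sl nl) => // [y yl|]; first exact: cJ.
by rewrite E t0 add0r; apply: subvP wb; apply: brvS; apply: capvSl.
Qed.

Lemma anti_ideal_sub : (anti_ideal <= M0)%VS.
Proof.
have aM : (anti_part <= M0)%VS.
  by apply/subvP => x /anti_partP [xl sx]; apply: s_anti.
by rewrite subv_add aM; apply: subv_trans sM0; apply: brvS.
Qed.

Lemma perp_anti_ideal_fixed y : y \in perp l anti_ideal -> s y = y.
Proof.
case/perpP=> yl yp; have [z [t [E zl tl sz st]]] := levi_split_dec yl.
suff t0 : t = 0 by rewrite E t0 addr0.
apply: anti_component_eq0 => // u ua; have [ul su] := anti_partP ua.
have : killing y u = 0 by apply/yp/memv_addl.
by rewrite E killingDl (killing_fixed_anti sz su) add0r.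
Qed.

Lemma levi_part_full : l = levi_part {:L} h js.
Proof.
apply/vspaceP => x; rewrite (levi_partE (g := {:L}) ch0 (fun y _ => hjs y)) memvf /=.
apply/idP/eqP => [|/levi_full //]; rewrite (levi_partE ch0 gjs).
by case/andP=> _ /eqP.
Qed.

Lemma ext_levi_full : ext_sub iota l = levi_part {:lie_ext iota L} (ext_elt iota h) js.
Proof.
rewrite {1}levi_part_full (ext_graded_part iota ch0 (subvf _) (memvf _) ujs) ?ext_subf //.
Qed.

Local Notation exts := (ext_sub iota).

(* With [r = q + n], the orthogonal [u] of [q] in [l] is shown to vanish: it is
   made of nilpotent elements of [q], fixed by [s] since their components in
   [anti_ideal] are nilpotent in [M0], so [s] stabilizes [q = r :&: s @: r], which
   is reductive; then [u] is central in [q] and an abelian ideal of [l]. *)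
Theorem parabolic_part_minimal r : sigma_split iota s g r ->
  (r <= parabolic_part g h js)%VS -> r = parabolic_part g h js.
Proof.
case=> -[rg sr [B bB Br]] _ [levr _] rp.
have [BG sB solB maxB] := bB.
(* Since [r] lies in the parabolic part, [B] normalizes the solvable [n] and contains it by
   maximality. *)
have nB : (exts n <= B)%VS.
  apply: (borel_solvable_normalized sgK bB).
  - by apply: ext_subS; apply: graded_part_sub.
  - rewrite ext_pos_part; apply: pos_solvable => //; exact: ext_sub_mem.
  - by apply: ext_subalgebra; apply: pos_subalgebra.
  move=> u w uB; apply: (ext_stable (parabolic_pos_stable ch0 sg gjs)).
  by apply: (subvP (ext_subS iota rp)); apply: (subvP Br).
have nr : (n <= r)%VS by rewrite -(ext_sub_sub iota) (subv_trans nB).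
pose q := (r :&: l)%VS.
have rE : r = (q + n)%VS.
  by rewrite /q vspace_modr //; apply/esym/capv_idPl.
have ql : (q <= l)%VS by apply: capvSr.
pose b := (B :&: exts l)%VS.
have sKl : is_subalgebra (exts l) by apply: ext_subalgebra.
have lnK : (exts l :&: exts n = 0)%VS.
  by rewrite ext_levi_part ext_pos_part; apply: levi_pos_cap.
have KpE : exts (parabolic_part g h js) = (exts l + exts n)%VS by exact: ext_sub_add.
have BE : B = (b + exts n)%VS.
  rewrite /b vspace_modr // -KpE; apply/esym/capv_idPl/(subv_trans Br).
  exact: ext_subS.
(* A solvable subalgebra of [l] larger than [b] would give, by adding [n], one larger than [B]. *)
have bb : is_borel b (exts l).
  split; [exact: capvSr|exact: subalgebra_cap|exact: solvableS (capvSl _ _) solB|].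
  move=> B' B'l sB' solB' bB'; apply/eqP; rewrite eqEsubv bB' andbT subv_cap B'l andbT.
  have snK : stable (exts l) (exts n) by apply: ext_stable; apply: levi_pos_stable.
  rewrite -(maxB (B' + exts n)%VS) ?addvSl //.
  - rewrite subv_add (subv_trans nB BG) andbT (subv_trans B'l) //.
    by apply: ext_subS; apply: graded_part_sub.
  - apply: subalgebra_add => //; first exact/ext_subalgebra/pos_subalgebra.
    by move=> u w /(subvP B'l); apply: snK.
  - apply: solvable_add => //; [|exact/ext_subalgebra/pos_subalgebra|].
      exact: solvableS nB solB.
    by move=> u w /(subvP B'l); apply: snK.
  by rewrite {1}BE addvS.
have bq : (b <= exts q)%VS.
  apply: (subv_trans (capvS Br (subvv (exts l)))).
  rewrite rE ext_sub_add -vspace_modl ?ext_subS // capvC lnK.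
  by rewrite addv0.
have iI := anti_ideal_ideal; have iP := perp_ideal sl iI.
have nLK : nondegenerate_on {:lie_ext iota L}.
  by rewrite -ext_subf; apply: ext_sub_nondegenerate.
have lK w : (w \in exts l) = ([lie ext_elt iota h, w] == 0).
  rewrite ext_levi_full (levi_partE (g := {:lie_ext iota L}) ch0K) ?memvf // => u uf.
  by apply: (ext_grading ch0 (subvf _) (memvf _) ujs) => //; rewrite ext_subf.
have cS d : (forall x, (forall y, y \in exts l -> [lie y, x] = 0) -> [lie d, x] = 0) ->
    d \in exts l.
  move=> Hd; rewrite lK lieC oppr_eq0 Hd // => y.
  by rewrite lK => /eqP hy; rewrite lieC hy oppr0.
have uK x : x \in perp l q -> x \in l /\ forall w, w \in b -> killing (ext_elt iota x) w = 0.
  move=> xu; have [xl _] := perpP _ _ _ xu; split=> // w /(subvP bq).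
  apply: (ext_sub_orthogonal (U := perp l q)); last exact: ext_sub_mem.
  by move=> y z /perpP [_]; apply.
have uq x : x \in perp l q -> ext_elt iota x \in b /\ nilpotent_end (ad x).
  case/uK=> xl xb.
  have [xb' nx] := borel_orth ch0K nLK sKl cS bb (ext_sub_mem iota xl) xb.
  by split=> //; apply: ext_nilp nx.
have uq' x : x \in perp l q -> x \in q.
  by case/uq=> /(subvP bq); rewrite ext_sub_memE.
have PIK u w : u \in exts anti_ideal -> w \in exts (perp l anti_ideal) -> killing u w = 0.
  by apply: ext_sub_orthogonal => x y xI /perpP [_ yI]; rewrite killingC yI.
have [IPl _] := perp_add (proj1 (is_idealP iI)) nondegenerate_anti_ideal.
have IP0 : (exts anti_ideal :&: exts (perp l anti_ideal) = 0)%VS.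
  apply/eqP; rewrite -subv0; apply/subvP => u /memv_capP [uI uP]; rewrite memv0.
  apply/eqP/(ext_sub_nondegenerate (iota := iota) nondegenerate_anti_ideal) => // w wI.
  by rewrite killingC; apply: PIK.
have proj := borel_projection sKl bb (ext_ideal iota iI) (ext_ideal iota iP) IP0.
have fixed x : x \in perp l q -> s x = x.
  move=> xu; have [xl xb] := uK x xu; have [xb' _] := uq x xu.
  move: (xl); rewrite -{1}IPl => /memv_addP [y yI [z zP E]].
  suff y0 : y = 0 by rewrite E y0 add0r; apply: perp_anti_ideal_fixed.
  have yb : ext_elt iota y \in b.
    by apply: (proj _ (ext_elt iota z)); rewrite ?ext_sub_mem // -ext_eltD -E.
  apply: M0_nilp; first exact: (subvP anti_ideal_sub).
  (* To see that [y] is orthogonal to [w] in [b], only the component [w1] in the ideal counts, and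
     [w1] again lies in [b]. *)
  apply: (ext_nilp (iota := iota)); apply: (borel_radical_nilp ch0K nLK cS bb yb) => w wb.
  have : w \in exts l by case/memv_capP: wb.
  rewrite -{1}IPl ext_sub_add => /memv_addP [w1 w1I [w2 w2P Ew]].
  have w1b : w1 \in b by apply: (proj _ w2); rewrite -?Ew.
  rewrite Ew killingDr [X in _ + X](PIK _ _ (ext_sub_mem iota yI) w2P) addr0.
  have := xb w1 w1b; rewrite E ext_eltD killingDl => /eqP.
  by rewrite [killing (_ z) w1]killingC (PIK _ _ w1I (ext_sub_mem iota zP)) addr0 => /eqP.
(* [q] is the orthogonal of [perp l q], which [s] fixes pointwise. *)
have sq x : x \in q -> s x \in q.
  move=> xq; have xl := subvP ql _ xq.
  apply: (killing_biorthogonal nl ql); first exact: s_levi.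
  move=> y yl yq; have yu : y \in perp l q by apply/perpP.
  by rewrite -(fixed y yu) (automorphism_killing s_br s_inj); apply: yq.
have sqE : (s @: q)%VS = q.
  apply/eqP; rewrite eqEdim (automorphism_dim s_inj) leqnn andbT.
  by apply/subvP => _ /memv_imgP [x xq ->]; apply: sq.
have rsr : (r :&: s @: r)%VS = q.
  apply/eqP; rewrite eqEsubv subv_cap capvSl /= -{2}sqE limgS ?capvSl // andbT.
  rewrite subv_cap capvSl /= -(opposite_parabolic_cap ch0 gjs).
  apply: capvS => //; rewrite {1}rE limgD sqE /parabolic_part opposite_levi_part opposite_pos_part.
  apply: addvS => //; apply/subvP => _ /memv_imgP [x xn ->]; exact: s_pos.
have [sgq rq _] := levr; rewrite {}rsr in sgq rq.
have qq := is_subalgebraP sgq.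
have iu : is_ideal (perp l q) q.
  apply/is_idealP; split=> [|x y xq /perpP [yl yq]]; first by apply/subvP => x /uq'.
  apply/perpP; split; first by apply: ll => //; apply: subvP xq.
  by move=> w wq; rewrite lieC killingNl killing_inv yq ?oppr0 //; apply: qq.
have solu : solvable_lie (perp l q).
  apply: (ext_solvable (iota := iota)); apply: solvableS (_ : _ <= b)%VS _; last by case: bb.
  by apply: ext_subP => x /uq [].
have cu x y : x \in q -> y \in perp l q -> [lie x, y] = 0.
  exact: (reductive_solvable_central sgq rq iu solu).
(* As [perp l q] commutes with [q], invariance makes [[l, q]] orthogonal to it. *)
have iq : is_ideal q l.
  apply/is_idealP; split=> // x w xl wq; apply: (killing_biorthogonal nl ql).
    by apply: ll => //; apply: subvP wq.
  move=> y yl yq; have yu : y \in perp l q by apply/perpP.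
  by rewrite lieC killingNr -killing_inv (lieC y) (cu w y) // oppr0 killing0l oppr0.
have [_ slu] := is_idealP (perp_ideal sl iq).
(* Now [perp l q] is an ideal of [l] that commutes with itself, so [[y, [y, w]] = 0] for [w] in [l],
   and the nilpotent [y] is orthogonal to [l]. *)
have u0 y : y \in perp l q -> y = 0.
  move=> yu; have [_ ny] := uq y yu; have /perpP [yl _] := yu.
  apply: nl => // w wl; apply: (killing_nilp_comm ch0 ny); apply: cu; first exact: uq'.
  by rewrite lieC memvN slu.
have lq : (l <= q)%VS.
  apply/subvP => x xl; apply: (killing_biorthogonal nl ql) => // y yl yq.
  by rewrite [y]u0 ?killing0l //; apply/perpP.
by rewrite rE /parabolic_part; congr (_ + _)%VS; apply/eqP; rewrite eqEsubv ql.
Qed.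
End Minimal.
End ParabolicExtension.

(** * Descent *)

Section Torus.
Variables (F : fieldType) (L : lieType F).
Hypothesis ch0 : forall n, n.+1%:R != 0 :> F.
Implicit Types (x y z h d : L).

Lemma split_by_comm x y c s t : uniq s -> split_by (ad x) s ->
  uniq t -> split_by (ad y) t -> [lie x, y] = 0 ->
  exists2 r, uniq r & split_by (ad (x + c *: y)) r.
Proof.
move=> us sx ut ty xy; pose r := undup [seq i + c * j | i <- s, j <- t].
exists r; first exact: undup_uniq.
move=> v; have := memvf v; move: v; apply: (eigen_ind (hs := [:: x; y])).
- by move=> h; rewrite !inE => /orP [] /eqP ->; [exists s|exists t].
- move=> h h'; rewrite !inE => /orP [] /eqP -> /orP [] /eqP ->; rewrite ?lie_brxx //.
  by rewrite lieC xy oppr0.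
- by move=> h _ u w _ _; exact: memvf.
- exact: linear0.
- by move=> u w Eu Ew; rewrite linearD /= Eu Ew addr0.
move=> w _ hw; have [->|w0] := eqVneq w 0; first exact: linear0.
have [b xb] := hw x (mem_head _ _); have [b' yb] := hw y (mem_last _ [:: y]).
apply: hor_prod_zero; exists (b + c * b').
  rewrite mem_undup; apply/allpairsP; exists (b, b') => /=.
  by split=> //; [apply: hor_prod_eigenvalue (sx w) w0 _|apply: hor_prod_eigenvalue (ty w) w0 _]; rewrite adE.
by rewrite adE lieDl lieZl xb yb scalerA scalerDl.
Qed.

Section Maximal.
Variables (H0 : L) (a : {vspace L}).
Hypothesis ha : maximal_split_abelian H0 a.
Hypothesis nL : nondegenerate_on {:L}.
Let sa : split_abelian a := ms_split ha.

Lemma torus_max d s : (forall h, h \in a -> [lie d, h] = 0) ->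
  uniq s -> split_by (ad d) s -> d \in a.
Proof.
move=> da us sd; have <- : (a + <[d]>)%VS = a; last first.
  by apply: memv_addr; exact: memv_line.
have ha' h : h \in a -> [lie h, d] = 0 by move=> /da E; rewrite lieC E oppr0.
apply: (ms_max ha); last exact: addvSl.
  rewrite subv_add (ms_sub ha) /= -memvE leigenspaceP adE ha' ?scale0r //.
  exact: ms_H0 ha.
split.
  rewrite /abelian_lie -subv0; apply: brvP => x y /memv_addP [u ua [w /vlineP [c ->] ->]].
  case/memv_addP=> u' ua' [w' /vlineP [c' ->] ->]; rewrite memv0.
  rewrite !lieDl !lieDr !lieZl !lieZr (torus_comm sa) // da // ha' // lie_brxx.
  by rewrite !scaler0 !addr0.
move=> x /memv_addP [u ua [w /vlineP [c ->] ->]].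
have [t ut tu] := torus_split sa ua.
have [r ur rx] := split_by_comm c ut tu us sd (ha' u ua).
exact: split_diagonalizable ur rx.
Qed.

Lemma zero_weight_subalgebra : is_subalgebra (root_space (0 : dual a)).
Proof.
by apply/is_subalgebraP => x y xz yz; rewrite -[0]addr0; apply: root_space_br.
Qed.

(** The element [d] commutes with [a] and is diagonalizable, so it lies in [a] and commutes with
    [y], against [[lie d, y] = y *+ 2]. *)
Lemma zero_weight_nilp y : y \in root_space (0 : dual a) -> nilpotent_end (ad y) -> y = 0.
Proof.
move=> yz ny.
have [d [[s us sd] dy dx]] :=
  nilp_split_element ch0 nL zero_weight_subalgebra (zero_weight_nondegenerate sa nL) yz ny.
have da : d \in a.
  apply: torus_max us sd => h ha'; apply: dx => m /zero_weightP /(_ h ha') E.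
  by rewrite lieC E oppr0.
have /zero_weightP /(_ d da) := yz; rewrite dy -scaler_nat => /eqP.
by rewrite scaler_eq0 (negPf (ch0 1)) => /eqP.
Qed.

End Maximal.
End Torus.

Section Descent.
Variables (F : fieldType) (L : lieType F) (H0 : L).
Hypothesis ch0 : forall n, n.+1%:R != 0 :> F.
Hypothesis grade_sum : (grade H0 (- 2) + grade H0 0 + grade H0 2)%VS = fullv.
Hypothesis nL : nondegenerate_on {:L}.
Variable a : {vspace L}.
Hypothesis ha : maximal_split_abelian H0 a.
Variable Pi : seq (dual a).
Hypothesis hbase : is_base Pi.
Hypothesis hPi : forall nu, nu \in Pi -> ev nu H0 = 0 \/ ev nu H0 = 2.
Variables (k : nat) (lam : 'I_k.+1 -> dual a).
Hypothesis hlam : descent H0 Pi lam.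
Variables H X Y : 'I_k.+1 -> L.
Hypothesis Ha : forall j, H j \in a.
Hypothesis XE : forall j, X j \in root_space (lam j).
Hypothesis X0 : forall j, X j != 0.
Hypothesis YE : forall j, Y j \in root_space (- lam j).
Hypothesis XYsl2 : forall j, sl2_triple (Y j) (H j) (X j).
Hypothesis H0YX : [lie \sum_j Y j, \sum_j X j] = H0.
Implicit Types (x y z h v : L) (U V : {vspace L}) (mu nu : dual a).

Let sa : split_abelian a := ms_split ha.
Let H0a : H0 \in a := ms_H0 ha.
Local Notation root := (is_root fullv).
Local Notation g := (grade H0 0).

Lemma root_degree mu : root mu -> exists2 j : int, j \in degrees & ev mu H0 = j%:~R.
Proof.
case/is_rootP=> _ [x /root_spaceP xm x0]; apply: (degree_mem grade_sum x0).
exact: xm.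
Qed.

Lemma root_strongly_orthogonal (i j : 'I_k.+1) : (i < j)%N -> strongly_orthogonal (lam j) (lam i).
Proof.
move=> ij; have j0 : (0 < j)%N by apply: leq_ltn_trans ij.
by have [[_ /(_ i ij)]] := ds_simple hlam j0.
Qed.

Lemma root_lam_sub i j x : i != j -> x \in root_space (lam j - lam i) -> x = 0.
Proof.
rewrite -(inj_eq val_inj) neq_ltn => /orP [] /root_strongly_orthogonal [n1 n2 n3 n4].
  exact: not_root.
apply: not_root; first by rewrite -opprB oppr_eq0.
by rewrite -opprB is_rootNE.
Qed.

Lemma root_lam_add i j x : i != j -> x \in root_space (lam i + lam j) -> x = 0.
Proof.
rewrite -(inj_eq val_inj) neq_ltn => /orP [] /root_strongly_orthogonal [n1 n2 n3 n4].
  by rewrite addrC; exact: not_root.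
exact: not_root.
Qed.

Lemma lie_YX i j : i != j -> [lie Y i, X j] = 0.
Proof.
by move=> ij; apply: (root_lam_sub ij); rewrite addrC root_space_br.
Qed.

Lemma lie_XX i j : [lie X i, X j] = 0.
Proof.
have [->|ij] := eqVneq i j; first exact: lie_brxx.
by apply: (root_lam_add ij); apply: root_space_br.
Qed.

Lemma lie_YX_diag j : [lie Y j, X j] = H j.
Proof. by have [_ _] := XYsl2 j. Qed.

Lemma H0_sum : H0 = \sum_j H j.
Proof.
rewrite -H0YX lie_suml; apply: eq_bigr => i _.
rewrite lie_sumr (bigD1 i) //= big1 ?addr0 ?lie_YX_diag // => j ji.
by rewrite lie_YX // eq_sym.
Qed.

Lemma lie_HX i j : i != j -> [lie H i, X j] = 0.
Proof.
move=> ij; rewrite -lie_YX_diag lieAl lie_XX lie0r sub0r lieC opprK.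
by rewrite lie_YX // lie0l.
Qed.

Lemma ev_lam i j : ev (lam j) (H i) = if i == j then 2%:R else 0.
Proof.
have E : [lie H i, X j] = ev (lam j) (H i) *: X j by apply/root_spaceP.
case: eqP => [ij|/eqP ij].
  move: E; rewrite ij; have [-> _ _] := XYsl2 j; rewrite -scaler_nat.
  move/eqP; rewrite -subr_eq0 -scalerBl scaler_eq0 (negPf (X0 j)) orbF subr_eq0.
  by move/eqP.
move: E; rewrite lie_HX // => /esym/eqP; rewrite scaler_eq0 (negPf (X0 j)) orbF.
by move/eqP.
Qed.

Lemma lie_HY i j : i != j -> [lie H i, Y j] = 0.
Proof.
move=> ij; have /root_spaceP /(_ _ (Ha i)) -> := YE j.
by rewrite evN ev_lam (negPf ij) oppr0 scale0r.
Qed.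

Lemma ev_lam_H0 j : ev (lam j) H0 = 2%:R.
Proof. exact: ds_two hlam j. Qed.

Lemma triples j : graded_triple H0 (Y j) (H j) (X j).
Proof.
have [h1 h2 h3] := XYsl2 j; split=> //.
- by rewrite h1 scaler_nat.
- by rewrite h2 scaleNr scaler_nat.
- by have /root_spaceP -> := XE j; rewrite ?ev_lam_H0.
- by have /root_spaceP -> := YE j; rewrite ?evN ?ev_lam_H0.
- exact: degree4_eq0.
- exact: degreeN4_eq0.
Qed.

Lemma nat_comb_degree nu : nat_comb Pi nu -> exists n : nat, ev nu H0 = n%:R.
Proof.
case=> c ->; rewrite /ev sum_lfunE.
have : forall i : 'I_(size Pi), exists n : nat, (Pi`_i *+ c i) (vsproj a H0) = n%:R.
  move=> i; have [E|E] := hPi (mem_nth 0 (ltn_ord i)).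
    by exists 0; rewrite -scaler_nat scale_lfunE -/(ev _ _) E scaler0.
  exists (c i * 2)%N; rewrite -scaler_nat scale_lfunE -/(ev _ _) E natrM.
  by [].
by case/fin_all_exists=> n nE; exists (\sum_i n i)%N; rewrite natr_sum; apply: eq_bigr.
Qed.

Lemma root2_nat_comb nu : root nu -> ev nu H0 = 2%:R -> nat_comb Pi nu.
Proof.
case: hbase => _ _ hb /hb [//|/nat_comb_degree [n]]; rewrite evN => En E2.
by move: (ch0 n.+1); rewrite -addn2 natrD -En E2 addNr eqxx.
Qed.

Lemma nat_comb_add_simple m nu beta : (m < size Pi)%N -> nat_comb Pi nu ->
  nat_comb Pi beta -> Pi`_m = nu + beta -> nu = 0 \/ beta = 0.
Proof.
move=> mP [c ->] [d ->] E; have [fP _ _] := hbase.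
pose M := Ordinal mP.
have cd i : (c i + d i = (i == M))%N.
  have /freeP fP' : free (in_tuple Pi) by [].
  have := fP' (fun i => (c i + d i)%N%:R - (i == M)%:R) _ i.
  rewrite big_mkcond /=; set S := \sum_(i < _) _.
  have -> : S = 0.
    rewrite /S; under eq_bigr do rewrite scalerBl natrD scalerDl !scaler_nat.
    rewrite sumrB big_split /= -E (bigD1 M) //= eqxx mulr1n big1 ?addr0 ?subrr //.
    by move=> j /negPf ->.
  move=> /(_ erefl) /eqP; rewrite subr_eq0.
  by rewrite natr_eq // => /eqP.
have zero (e : 'I_(size Pi) -> nat) : (forall i, e i = 0%N) ->
    \sum_(i < size Pi) Pi`_i *+ e i = 0.
  by move=> e0; rewrite big1 // => i _; rewrite e0 mulr0n.
have nM i : i != M -> c i = 0%N /\ d i = 0%N by move=> /negPf iM; have := cd i; rewrite iM; lia.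
have := cd M; rewrite eqxx; case cM: (c M) => [|n] dM; [left|right]; apply: zero => i.
  by have [->|/nM []] := eqVneq i M.
by have [->|/nM []] := eqVneq i M; first lia.
Qed.

Lemma not_root_degree4 mu : ev mu H0 = 4%:R -> ~~ root mu.
Proof.
move=> E; apply/negP => /root_degree [j jd /eqP]; rewrite E.
by rewrite -[X in X == _]/((4%:Z)%:~R) intr_eq // => /eqP E'; move: jd; rewrite -E'.
Qed.

Lemma ev_neq0 mu h : ev mu h != 0 -> mu != 0.
Proof. by apply: contraNneq => ->; rewrite ev0. Qed.

(* Induction on [j]: if [mu] were another such root, then [lam j + beta] and
   [lam j - beta] would be roots for [beta := mu - lam j], and [lam j] would be
   the sum of two positive roots of the [j]-th descent system. *)
Lemma root_eq_lam j mu : root mu ->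
  (forall i, ev mu (H i) = if i == j then 2%:R else 0) -> mu = lam j.
Proof.
have [n] := ubnP (j : nat); elim: n j mu => // n IHn j mu jn rmu muH.
have muH0 : ev mu H0 = 2%:R.
  by rewrite H0_sum ev_sum (bigD1 j) //= muH eqxx big1 ?addr0 // => i /negPf ij; rewrite muH ij.
apply/eqP; rewrite -subr_eq0; set beta := mu - lam j; apply: contraT => beta0.
have betaH i : ev beta (H i) = 0 by rewrite evDl evN muH ev_lam subrr.
have betaH0 : ev beta H0 = 0 by rewrite evDl evN muH0 ev_lam_H0 subrr.
have [_ [x xm x0]] := is_rootP rmu.
(* Weight 2 under [H j] in degree 2 starts a string [x], [y1], [y2] of nonzero vectors, of weights
   [mu], [beta] and [beta - lam j]. *)
have T := triples j; pose y1 := [lie Y j, x]; pose y2 := [lie Y j, y1].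
have xw h : h \in a -> [lie h, x] = ev mu h *: x by apply/root_spaceP.
have Xx : [lie X j, x] = 0.
  by apply: (gt_no4 T); rewrite lieA (gt_0x T) (xw _ H0a) muH0 lieZl lieZr -scalerDl -natrD.
have XY v : [lie X j, [lie Y j, v]] = [lie Y j, [lie X j, v]] - [lie H j, v].
  by rewrite lieA (lieC (X j)) lie_YX_diag lieNl addrC.
have y1w : y1 \in root_space beta by rewrite /beta addrC; apply: root_space_br.
have Xy1 : [lie X j, y1] = - 2%:R *: x.
  by rewrite XY Xx lie0r sub0r (xw _ (Ha j)) muH eqxx scaleNr.
have Hy1 : [lie H j, y1] = 0.
  by have /root_spaceP -> := y1w; rewrite ?betaH ?scale0r.
have Xy2 : [lie X j, y2] = - 2%:R *: y1 by rewrite XY Xy1 Hy1 subr0 lieZr.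
have n2 : - 2%:R != 0 :> F by rewrite oppr_eq0; exact: (ch0 1).
have y10 : y1 != 0.
  by apply: contraNneq x0 => E; move/eqP: Xy1; rewrite E lie0r eq_sym scaler_eq0 (negPf n2).
have y20 : y2 != 0.
  by apply: contraNneq y10 => E; move/eqP: Xy2; rewrite E lie0r eq_sym scaler_eq0 (negPf n2).
have rbeta : root beta by apply: is_root_mem y1w y10.
have y2w : y2 \in root_space (beta - lam j) by rewrite addrC; apply: root_space_br.
have nu0 : beta - lam j != 0.
  by apply: (ev_neq0 (h := H0)); rewrite evDl evN betaH0 ev_lam_H0 sub0r.
have rnu : root (lam j - beta).
  by rewrite -opprB (is_rootNE sa nL); apply: is_root_mem y2w y20.
have nu2 : ev (lam j - beta) H0 = 2%:R by rewrite evDl evN betaH0 ev_lam_H0 subr0.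
(* This serves both signs: [lam j] is [(lam j - beta) + beta] and also [mu + (- beta)], and one of
   [beta] and [- beta] is positive. *)
have key b nu : lam j = nu + b -> root nu -> root b -> ev nu H0 = 2%:R ->
    (forall i, ev nu (H i) = if i == j then 2%:R else 0) -> ev b H0 = 0 ->
    (forall i, ev b (H i) = 0) -> b != 0 -> nat_comb Pi b -> False.
  move=> E rn rb n20 nH b00 bH b0 cb; have cn := root2_nat_comb rn n20.
  have nn0 : nu != 0 by apply: (ev_neq0 (h := H0)); rewrite n20; exact: (ch0 1).
  (* For [j = 0], indecomposability is that of a member of the base; for later [j] it is part of the
     descent. *)
  have [j0|jpos] := posnP (j : nat).
    have Ej : j = ord0 by apply/val_inj.
    have lP := ds_first hlam; rewrite -Ej in lP.
    have mP : (index (lam j) Pi < size Pi)%N by rewrite index_mem.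
    have [||] := nat_comb_add_simple mP cn cb; first by rewrite nth_index.
      by apply/eqP.
    by apply/eqP.
  have [_ _ /(_ nu b) ns] := ds_simple hlam jpos.
  apply: (ns _ (conj rn cn) _ (conj rb cb) E); split=> // i ij.
    have iij : (i == j) = false by apply/negbTE; rewrite -(inj_eq val_inj) neq_ltn ij.
    split.
    - by apply: (ev_neq0 (h := H0)); rewrite evDl n20 ev_lam_H0 -natrD; exact: (ch0 3).
    - by apply: (ev_neq0 (h := H i)); rewrite evDl evN nH iij ev_lam eqxx sub0r.
    - by apply: not_root_degree4; rewrite evDl n20 ev_lam_H0 -natrD.
    (* A root [nu - lam i] would have degree 0 and value -2 on [H i], while only 0, 1 and -1 are
       possible. *)
    apply/negP => /is_rootP [_ [w /root_spaceP ww w0]].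
    have w1 : [lie H0, w] = 0 by rewrite ww // evDl evN n20 ev_lam_H0 subrr scale0r.
    have w2 : [lie H i, w] = - 2%:R *: w by rewrite ww // evDl evN nH iij ev_lam eqxx sub0r.
    have [E2|[E2 _]|[E2 _]] := triple_zero ch0 (triples i) w1 w2 w0.
    - by move: n2; rewrite E2 eqxx.
    - by have /eqP := E2; rewrite -[X in X == _]/((- 2%:Z)%:~R) -[X in _ == X]/(1%:~R) intr_eq.
    by have /eqP := E2; rewrite -[X in X == _]/((- 2%:Z)%:~R) -[X in _ == X]/((- 1%:Z)%:~R) intr_eq.
  have lamP c : lam i = c *: b + lam i -> c != 0 -> False.
    move=> E' c0; case/eqP: b0; apply: (scalerI c0); apply: (addIr (lam i)).
    by rewrite -E' scaler0 add0r.
  have valH c l : ev (c *: b + lam i) (H l) = if l == i then 2%:R else 0.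
    by rewrite evDl ev_lam /ev scale_lfunE -/(ev _ _) bH scaler0 add0r.
  have ij' : (i < n)%N := leq_trans ij jn.
  split.
  - by apply: (ev_neq0 (h := H0)); rewrite evDl b00 ev_lam_H0 add0r; exact: (ch0 1).
  - by apply: (ev_neq0 (h := H0)); rewrite evDl evN b00 ev_lam_H0 add0r.
  (* The root [b + lam i] would take the values of [lam i] on all [H l], so the induction hypothesis
     would give [b = 0]. *)
  - apply/negP => r; have := IHn i (1 *: b + lam i) ij'; rewrite scale1r.
    move=> /(_ r) E'; apply: (lamP 1); rewrite ?oner_neq0 // scale1r E' // => l.
    by have := valH 1 l; rewrite scale1r.
  rewrite -is_rootNE // opprB addrC; apply/negP => r.
  have := IHn i (- b + lam i) ij' r => E'; apply: (lamP (-1)); rewrite ?oppr_eq0 ?oner_neq0 //.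
  by rewrite scaleN1r E' // => l; have := valH (-1) l; rewrite scaleN1r.
exfalso; have [_ _ hb] := hbase; case: (hb beta rbeta) => cb.
  apply: (key beta (lam j - beta)) => //; first by rewrite subrK.
  by move=> i; rewrite evDl evN betaH subr0 ev_lam.
apply: (key (- beta) mu _ rmu _ muH0 muH _ _ _ cb).
- by rewrite /beta opprB addrC subrK.
- by rewrite (is_rootNE sa nL).
- by rewrite evN betaH0 oppr0.
- by move=> i; rewrite evN betaH oppr0.
by rewrite oppr_eq0.
Qed.

Local Notation h := (height_element H).

Lemma height_torus : h \in a.
Proof. by apply: memv_suml => j _; apply: memvZ. Qed.

(** In degrees 2 and -2 two facts about the height matter: being nonzero, it makes the centralizer
    of [h] in all of [L] commute with [a_zero]; being bounded, it leaves finitely many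
    eigenvalues. *)
Lemma root_weight mu x : x \in root_space mu -> x != 0 ->
  [\/ ev mu H0 = 2%:R /\ exists2 m : int, (0 < `|m| <= k.+1.*2)%N & [lie h, x] = m%:~R *: x,
      ev mu H0 = - 2%:R /\ exists2 m : int, (0 < `|m| <= k.+1.*2)%N & [lie h, x] = m%:~R *: x,
      forall i, ev mu (H i) = 0
    | exists j s : 'I_k.+1, [/\ j != s, ev mu (H j) = 1, ev mu (H s) = -1,
        forall i, i != j -> i != s -> ev mu (H i) = 0
        & [lie h, x] = ((s : nat)%:Z - (j : nat)%:Z)%:~R *: x]].
Proof.
move=> /root_spaceP xm x0; have xH i : [lie H i, x] = ev mu (H i) *: x by apply: xm.
have xH0 : [lie H0, x] = ev mu H0 *: x by apply: xm.
have [d dd E] := degree_mem grade_sum x0 xH0.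
have hx := height_weight xH; rewrite E in xH0.
move: dd; rewrite !inE => /or3P [] /eqP dE; rewrite dE in E xH0.
- have [z zE zs] := weights_low ch0 triples H0_sum xH0 xH x0.
  apply: Or42; split=> //; exists (- (\sum_(j < k.+1) (k.+1 - j) * z j)%N%:Z).
    by rewrite abszN; exact: height_bounds zs.
  rewrite hx; congr (_ *: _); rewrite intrN -pmulrn natr_sum -sumrN.
  by apply: eq_bigr => j _; rewrite zE natrM mulrN.
- rewrite scale0r in xH0.
  have [c0|[j [s [js cj cs c0]]]] := weights_zero ch0 triples lie_HX lie_HY H0_sum xH0 xH x0.
    exact: Or43.
  apply: Or44; exists j, s; split=> //; exact: height_zero xH js cj cs c0.
have [z zE zs] := weights_high ch0 triples H0_sum xH0 xH x0.
apply: Or41; split=> //; exists (\sum_(j < k.+1) (k.+1 - j) * z j)%N%:Z.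
  exact: height_bounds zs.
rewrite hx; congr (_ *: _); rewrite -pmulrn natr_sum.
by apply: eq_bigr => j _; rewrite zE natrM.
Qed.

Lemma exists_heights : exists2 js : seq int, uniq js & forall x,
  hor (ad h) (\prod_(j <- js) ('X - j%:~R%:P)) x = 0.
Proof.
pose js := [seq i%:Z - (k.+1.*2)%:Z | i <- iota 0 (k.+1.*2).*2.+1].
have jsP (m : int) : (`|m| <= k.+1.*2)%N -> m \in js.
  by move=> mk; apply/mapP; exists (absz (m + (k.+1.*2)%:Z)); rewrite ?mem_iota; lia.
exists js; first by rewrite map_inj_uniq ?iota_uniq // => i j; lia.
have eig (m : int) x : (`|m| <= k.+1.*2)%N -> [lie h, x] = m%:~R *: x ->
    hor (ad h) (\prod_(j <- js) ('X - j%:~R%:P)) x = 0.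
  by move=> /jsP mjs hx; apply: hor_prod_int mjs _; rewrite adE.
move=> x; have := memvf x; move: x; apply: (weight_ind sa) => [? ? _ _||x y Ex Ey|mu x _ xm].
- exact: memvf.
- exact: linear0.
- by rewrite linearD /= Ex Ey addr0.
have [->|x0] := eqVneq x 0; first exact: linear0.
have [[_ [m /andP [_ mk] E]]|[_ [m /andP [_ mk] E]]|E|[j [s [_ _ _ _ E]]]] := root_weight xm x0.
- exact: eig E.
- exact: eig E.
- apply: (eig 0) => //; rewrite (height_weight (c := fun=> 0)) => [|i].
    by rewrite big1 // => i _; rewrite mulr0.
  by have /root_spaceP -> := xm; rewrite ?E.
by apply: eig E; move: (ltn_ord j) (ltn_ord s); lia.
Qed.

Variable js : seq int.
Hypothesis ujs : uniq js.
Hypothesis hjs : forall x, hor (ad h) (\prod_(j <- js) ('X - j%:~R%:P)) x = 0.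
Let gjs x (_ : x \in g) := hjs x.

Lemma g_subalgebra : is_subalgebra g.
Proof.
apply/is_subalgebraP => x y; rewrite !gradeP !scale0r => /eqP x0 /eqP y0.
by rewrite lieA x0 y0 lie0l lie0r addr0.
Qed.

Lemma torus_g : (a <= g)%VS.
Proof. exact: ms_sub ha. Qed.

Lemma height_g : h \in g.
Proof. exact: (subvP torus_g) height_torus. Qed.

(** Seen as the Levi part of the grading by [H0], [g] inherits nondegeneracy from [L]. *)
Lemma g_levi : g = levi_part fullv H0 degrees.
Proof.
apply/vspaceP => x; rewrite (levi_partE ch0 (fun y _ => degrees_split grade_sum y)).
by rewrite memvf gradeP scale0r.
Qed.

Lemma subalgebra_fullv : is_subalgebra {:L}.
Proof. by apply/is_subalgebraP => *; exact: memvf. Qed.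

Lemma g_nondegenerate : nondegenerate_on g.
Proof.
rewrite g_levi; apply: levi_nondegenerate => //; first exact: subalgebra_fullv.
  exact: memvf.
by move=> x _; apply: degrees_split.
Qed.

Local Notation levi := (levi_part g h js).
Local Notation pos := (pos_part g h js).
Local Notation neg := (neg_part g h js).

Lemma torus_levi : (a <= levi)%VS.
Proof.
apply/subvP => x xa; rewrite (levi_partE ch0 gjs) (subvP torus_g) //=.
by rewrite (torus_comm sa) // height_torus.
Qed.

Lemma torus_stable P : stable a (graded_part g h js P).
Proof.
move=> x y xa; apply: (graded_part_brv ch0 g_subalgebra gjs (P := fun j => j == 0)).
  by move=> i j /eqP ->; rewrite add0r.
exact: (subvP torus_levi).
Qed.

Lemma centralizer_azeroP x :
  (x \in centralizer g (a_zero H)) <-> (forall j, [lie H j, x] = 0).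
Proof.
split=> [/centralizerP [_ xH] j|xH].
  by apply: xH; rewrite memvE /a_zero; apply: (sumv_sup j) => //; exact: subvv.
apply/centralizerP; split.
  by rewrite gradeP scale0r H0_sum lie_suml big1.
by move=> y /memv_sumP [u uH ->]; rewrite lie_suml big1 // => j _; have /vlineP [c ->] := uH j isT; rewrite lieZl xH scaler0.
Qed.

Lemma height_kernel x : [lie h, x] = 0 -> forall i, [lie H i, x] = 0.
Proof.
move=> hx; have xk : x \in lker (ad h) by rewrite memv_ker adE hx.
move: x {hx} xk; apply: (weight_ind sa) => [t x ta||x y Ex Ey i|mu x xk xm i].
- rewrite !memv_ker !adE => /eqP hx.
  by rewrite lieA hx lie0r addr0 (torus_comm sa height_torus ta) lie0l.
- by move=> i; exact: lie0r.
- by rewrite lieDr Ex Ey addr0.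
have [->|x0] := eqVneq x 0; first exact: lie0r.
have hx0 : [lie h, x] = 0 by move: xk; rewrite memv_ker adE => /eqP.
have nz (m : int) : m != 0 -> [lie h, x] = m%:~R *: x -> False.
  move=> m0 /eqP; rewrite hx0 eq_sym scaler_eq0 (negPf x0) orbF.
  by apply/negP; apply: intr_neq0.
case: (root_weight xm x0) => [[_ [m m0 E]]|[_ [m m0 E]]|E|[j [s [js' _ _ _ E]]]].
- by case: (nz m) => //; rewrite -absz_gt0; case/andP: m0.
- by case: (nz m) => //; rewrite -absz_gt0; case/andP: m0.
- by have /root_spaceP -> := xm; rewrite ?E ?scale0r.
case: (nz _ _ E); rewrite subr_eq0 eqz_nat eq_sym.
by apply: contraNneq js' => /val_inj ->.
Qed.

Lemma centralizer_azeroE : centralizer g (a_zero H) = levi.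
Proof.
apply/vspaceP => x; apply/idP/idP => xl.
  rewrite (levi_partE ch0 gjs); have /centralizerP [-> _] := xl.
  move/centralizer_azeroP: xl => xH.
  by rewrite (height_weight (c := fun=> 0)) ?big1 ?scale0r ?eqxx // => i; rewrite ?mulr0 // scale0r.
apply/centralizer_azeroP; apply: height_kernel.
by move: xl; rewrite (levi_partE ch0 gjs) => /andP [_ /eqP].
Qed.

Lemma E_spaceP i j p q x : (x \in E_space H i j p q) <->
  [/\ [lie H i, x] = p *: x, [lie H j, x] = q *: x
    & forall s, s != i -> s != j -> [lie H s, x] = 0].
Proof.
split=> [/memv_capP [/memv_capP []]|[xi xj xs]].
  rewrite !leigenspaceP !adE => /eqP xi /eqP xj xs; split=> // s si sj.
  move: xs; rewrite memvE => /subv_bigcapP /(_ s); rewrite si sj => /(_ isT).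
  by rewrite -memvE leigenspaceP adE scale0r => /eqP.
apply/memv_capP; split.
  by apply/memv_capP; rewrite !leigenspaceP !adE xi xj.
rewrite memvE; apply/subv_bigcapP => s /andP [si sj].
by rewrite -memvE leigenspaceP adE xs // scale0r.
Qed.

Lemma E_space_height i j x : i != j -> x \in E_space H i j 1 (-1) ->
  x \in g /\ [lie h, x] = ((j : nat)%:Z - (i : nat)%:Z)%:~R *: x.
Proof.
move=> ij /E_spaceP [xi xj xs].
pose c s : F := if s == i then 1 else if s == j then -1 else 0.
have xc s : [lie H s, x] = c s *: x.
  rewrite /c; case: eqP => [->//|/eqP si]; case: eqP => [->//|/eqP sj].
  by rewrite xs // scale0r.
have ci : c i = 1 by rewrite /c eqxx.
have cj : c j = -1 by rewrite /c eq_sym (negPf ij) eqxx.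
have cs s : s != i -> s != j -> c s = 0 by rewrite /c => /negPf -> /negPf ->.
split; last exact: height_zero xc ij ci cj cs.
rewrite gradeP scale0r H0_sum lie_suml (eq_bigr (fun s => c s *: x)) //.
rewrite -scaler_suml (bigD1 i) //= (bigD1 j) 1?eq_sym //= big1 => [|s /andP [si sj]].
  by rewrite ci cj addr0 subrr scale0r.
by rewrite cs.
Qed.

Lemma pos_partE :
  (\sum_(ij : 'I_k.+1 * 'I_k.+1 | (ij.1 < ij.2)%N) E_space H ij.1 ij.2 1 (-1))%VS = pos.
Proof.
apply/eqP; rewrite eqEsubv; apply/andP; split.
  apply/subv_sumP => -[i j] /= ij; have ijn : i != j by rewrite -(inj_eq val_inj) neq_ltn ij.
  apply/subvP => x /(E_space_height ijn) [xg hx].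
  by apply: (graded_part_mem ch0 gjs xg hx); rewrite subr_gt0 ltz_nat.
apply/subvP => x; move: x.
apply: (weight_ind sa) => [|||mu x xP xm]; [exact: torus_stable|exact: mem0v|exact: memvD|].
have [->|x0] := eqVneq x 0; first exact: mem0v.
have xg : x \in g by apply: (subvP (graded_part_sub _ _ _ _)) xP.
have pos_gt0 (m : int) : [lie h, x] = m%:~R *: x -> 0 < m.
  move=> hx; apply: contraT => nPm; case/eqP: x0; apply/eqP; rewrite -memv0.
  rewrite -(graded_part_disjoint ch0 g h js (P := fun j => 0 < j) (Q := fun j => ~~ (0 < j))).
    by apply/memv_capP; split=> //; apply: (graded_part_mem ch0 gjs xg hx).
  by move=> j ->.
have xH0 : ev mu H0 = 0.
  move: xg; rewrite gradeP; have /root_spaceP -> := xm => //.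
  by rewrite scale0r scaler_eq0 (negPf x0) orbF => /eqP.
case: (root_weight xm x0) => [[E _]|[E _]|E|[i [j [ij ci cj c0 E]]]].
- by move: (ch0 1); rewrite -E xH0 eqxx.
- by move: (ch0 1); rewrite -oppr_eq0 -E xH0 eqxx.
- suff : (0 : int) < 0 by rewrite ltxx.
  apply: pos_gt0; rewrite (height_weight (c := fun=> 0)) => [|i].
    by rewrite big1 // => i _; rewrite mulr0.
  by have /root_spaceP -> := xm; rewrite ?E.
rewrite memvE; apply: (sumv_sup (i, j)) => /=; first by have := pos_gt0 _ E; rewrite subr_gt0 ltz_nat.
rewrite -memvE; apply/E_spaceP; split=> [||s si sj].
- by have /root_spaceP -> := xm; rewrite ?ci.
- by have /root_spaceP -> := xm; rewrite ?cj.
by have /root_spaceP -> := xm; rewrite ?c0 ?scale0r.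
Qed.

Lemma directv_levi_E :
  directv (centralizer g (a_zero H) +
    \sum_(ij : 'I_k.+1 * 'I_k.+1 | (ij.1 < ij.2)%N) E_space H ij.1 ij.2 1 (-1)).
Proof.
rewrite directv_addE /= directv_trivial /= -/(directv (\sum_(ij | _) _)).
apply/andP; split; last first.
  rewrite pos_partE centralizer_azeroE; apply/eqP.
  exact: (levi_pos_cap ch0).
apply/directv_sum_independent => u uE u0 [i j] /= ij.
have E (p : 'I_k.+1 * 'I_k.+1) (pp : (p.1 < p.2)%N) := iffLR (E_spaceP _ _ _ _ _) (uE p pp).
(* Applying [H j] and then [H i] multiplies the [(i, j)] component by -1 and kills every other one,
   since both indices are increasing pairs. *)
have : [lie H i, [lie H j, \sum_(p : 'I_k.+1 * 'I_k.+1 | (p.1 < p.2)%N) u p]] = 0.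
  by rewrite u0 !lie0r.
rewrite !lie_sumr (bigD1 (i, j)) //= big1 => [|[s t] /= /andP [st ne]].
  have [/= hi hj _] := E (i, j) ij; rewrite addr0 hj lieZr hi scale1r scaleN1r.
  by move/eqP; rewrite oppr_eq0 => /eqP.
have [/= hs ht h0] := E (s, t) st.
have zero l : l != s -> l != t -> [lie H l, u (s, t)] = 0 by exact: h0.
have [js0|nj] := eqVneq j s; last first.
  have [jt|jt] := eqVneq j t; last by rewrite (zero j) // lie0r.
  rewrite jt ht lieZr zero ?scaler0 //; last by rewrite -(inj_eq val_inj) /= -jt neq_ltn ij.
  by apply: contraNneq ne => ->; rewrite jt.
rewrite js0 hs scale1r zero // -(inj_eq val_inj) /=; first by rewrite -js0 neq_ltn ij.
by move: ij st; rewrite js0 => ij st; rewrite neq_ltn (ltn_trans ij st).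
Qed.

Lemma two_weight (j : 'I_k.+1) v : (forall i, [lie H i, v] = (if i == j then 2%:R else 0) *: v) ->
  v \in root_space (lam j).
Proof.
move=> vw; pose U := (\bigcap_i leigenspace (ad (H i)) (if i == j then 2%:R else 0 : F)%R)%VS.
have UP x : x \in U <-> forall i, [lie H i, x] = (if i == j then 2%:R else 0) *: x.
  rewrite memvE; split=> [/subv_bigcapP xU i|xU].
    by have := xU i isT; rewrite -memvE leigenspaceP adE => /eqP.
  by apply/subv_bigcapP => i _; rewrite -memvE leigenspaceP adE xU.
have {vw} : v \in U by apply/UP.
move: v; apply: (weight_ind sa) => [t x ta /UP xU|||mu x /UP xU xm].
- by apply/UP => i; rewrite lieA (torus_comm sa (Ha i) ta) lie0l add0r xU lieZr.
- exact: mem0v.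
- exact: memvD.
have [->|x0] := eqVneq x 0; first exact: mem0v.
have muH (i : 'I_k.+1) : ev mu (H i) = if i == j then 2%:R else 0.
  apply/eqP; rewrite -subr_eq0; have /eqP : (ev mu (H i) - (if i == j then 2%:R else 0)) *: x = 0.
    by rewrite scalerBl -xU; have /root_spaceP -> := xm; rewrite // subrr.
  by rewrite scaler_eq0 (negPf x0) orbF.
have mu0 : mu != 0 by apply: (ev_neq0 (h := H j)); rewrite muH eqxx; exact: (ch0 1).
by rewrite -(root_eq_lam (is_root_mem mu0 xm x0) muH).
Qed.

Local Notation sigma := (involution_of (\sum_j Y j) (\sum_j X j)).

Lemma sigma_levi_dec x : x \in levi ->
  exists z t, [/\ x = z + t, sigma z = z, sigma t = - t & t \in root_space (0 : dual a)].
Proof.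
rewrite (levi_partE ch0 gjs) gradeP scale0r => /andP [/eqP x0 /eqP /height_kernel xH].
have XxR j : [lie X j, x] \in root_space (lam j).
  apply: two_weight => i; rewrite lieA xH lie0r addr0.
  have /root_spaceP -> // := XE j; rewrite ev_lam lieZl.
  by [].
have YX i j : i != j -> [lie Y i, [lie X j, x]] = 0.
  by move=> ij; apply: (root_lam_sub ij); rewrite addrC; apply: root_space_br.
have [z [t [E sz st tE _]]] :=
  sigma_dec ch0 grade_sum triples lie_YX lie_HX lie_HY X0 xH x0 YX.
exists z, t; split=> //; rewrite tE memvN memvZ //; apply: memv_suml => j _.
by rewrite -(addNr (lam j)); apply: root_space_br.
Qed.

Lemma zero_weight_levi : (root_space (0 : dual a)%R <= levi)%VS.
Proof.
apply/subvP => x /zero_weightP xz; rewrite (levi_partE ch0 gjs) gradeP scale0r.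
by rewrite !xz ?eqxx // height_torus.
Qed.

Lemma sigma_levi x : x \in levi -> sigma x \in levi.
Proof.
move=> xl; have [z [t [E sz st /(subvP zero_weight_levi) tl]]] := sigma_levi_dec xl.
rewrite E linearD /= sz st -[z](addrK t) -E.
by rewrite !memvB.
Qed.

Lemma sigma_levi_anti x : x \in levi -> sigma x = - x -> x \in root_space (0 : dual a).
Proof.
move=> xl sx; have [z [t [E sz st tz]]] := sigma_levi_dec xl.
suff z0 : z = 0 by rewrite E z0 add0r.
move: sx; rewrite {1 2}E linearD /= sz st opprD => /addIr /eqP.
by rewrite -addr_eq0 -mulr2n -scaler_nat scaler_eq0 (negPf (ch0 1)) => /eqP.
Qed.

Let s_br u v : sigma [lie u, v] = [lie sigma u, sigma v] :=
  sigma_br ch0 grade_sum triples X0 u v.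
Let s_inj v : sigma v = 0 -> v = 0 := @sigma_inj _ _ _ ch0 grade_sum _ _ _ _ triples X0 v.
Let s_H j : sigma (H j) = - H j := sigma_H ch0 grade_sum triples lie_YX X0 j.

Lemma sigma_height : sigma h = - h.
Proof.
by rewrite /height_element linear_sum -sumrN; apply: eq_bigr => j _; rewrite linearZ /= s_H scalerN.
Qed.

Lemma sigma_graded_part P x : x \in graded_part g h js P ->
  sigma x \in graded_part g h js (fun j => P (- j)).
Proof.
move: x; apply: graded_part_ind => [|x y|j x _ Pj xg xj].
- by rewrite linear0 mem0v.
- by rewrite linearD; exact: memvD.
apply: (graded_part_mem ch0 gjs (j := - j)); last by rewrite opprK.
  move: xg; rewrite !gradeP !scale0r => /eqP x0.
  have : sigma [lie H0, x] = 0 by rewrite x0 linear0.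
  rewrite s_br {1}H0_sum linear_sum /= (eq_bigr _ (fun j _ => s_H j)) sumrN -H0_sum lieNl.
  by move/eqP; rewrite oppr_eq0.
have := congr1 sigma xj; rewrite s_br sigma_height linearZ lieNl => /eqP.
by rewrite eqr_oppLR -scaleNr -intrN => /eqP.
Qed.

Local Notation js' := [seq - j | j <- js].

(** The inclusion for the reflected predicate supplies the reverse inequality of dimensions. *)
Lemma sigma_graded_partE P :
  (sigma @: graded_part g h js P)%VS = graded_part g (- h) js' P.
Proof.
have sub Q : (sigma @: graded_part g h js Q <= graded_part g h js (fun j => Q (- j)))%VS.
  by apply/subvP => _ /memv_imgP [x xQ ->]; apply: sigma_graded_part.
rewrite opposite_graded_part; apply/eqP; rewrite eqEdim sub (automorphism_dim s_inj).
have := dimvS (sub (fun j => P (- j))); rewrite (automorphism_dim s_inj).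
by congr (_ <= \dim _)%N; apply: eq_bigl => j; rewrite opprK.
Qed.

Lemma sigma_parabolic_part :
  (sigma @: parabolic_part g h js)%VS = parabolic_part g (- h) js'.
Proof. by rewrite limgD !sigma_graded_partE. Qed.

Lemma levi_full x : [lie h, x] = 0 -> x \in levi.
Proof.
move=> hx; rewrite (levi_partE ch0 gjs) gradeP scale0r hx eqxx andbT.
by rewrite H0_sum lie_suml big1 // => i _; apply: height_kernel.
Qed.

Section Parabolics.
Variables (Fbar : closedFieldType) (iota : {rmorphism F -> Fbar}).

Let split' := opposite_split ch0 g_subalgebra height_g ujs gjs.
Let hg' : - h \in g. Proof. by rewrite memvN height_g. Qed.

Lemma sigma_split_parabolic_part : sigma_split iota sigma g (parabolic_part g h js).
Proof.
rewrite /sigma_split /opposite sigma_parabolic_part (opposite_parabolic_cap ch0 gjs).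
split; first exact: (parabolic_part_is_parabolic iota ch0 g_subalgebra height_g ujs gjs g_nondegenerate).
  exact: (parabolic_part_is_parabolic iota ch0 g_subalgebra hg' (opposite_uniq ujs) split' g_nondegenerate).
split; first exact: (levi_is_levi ch0 g_subalgebra height_g ujs gjs g_nondegenerate).
rewrite -opposite_levi_part.
exact: (levi_is_levi ch0 g_subalgebra hg' (opposite_uniq ujs) split' g_nondegenerate).
Qed.

Lemma minimal_parabolic_part : minimal_sigma_split iota sigma g (parabolic_part g h js).
Proof.
split=> [|r rs]; first exact: sigma_split_parabolic_part.
apply: (parabolic_part_minimal (iota := iota) ch0 g_subalgebra height_g ujs gjs g_nondegenerate levi_full nL
  hjs s_br s_inj sigma_levi _ _ (zero_weight_subalgebra a) sigma_levi_anti _ rs).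
- move=> x /sigma_graded_part; apply: (subvP (graded_partS ch0 gjs _)) => j.
  by rewrite oppr_gt0.
- by move=> x /sigma_levi_dec [z [t [E sz st _]]]; exists z, t.
by move=> y; apply: (zero_weight_nilp ch0 ha nL).
Qed.

End Parabolics.

Definition split_component : {vspace L} := centralizer a levi.
Local Notation ap := split_component.

Lemma split_component_torus : (ap <= a)%VS.
Proof. exact: capvSl. Qed.

(** The Levi part is spanned by weight vectors, whose weights are 0 or roots of [g] vanishing on
    [a_zero]. *)
Lemma split_componentP t : (t \in ap) <->
  t \in a /\ (forall mu : dual a, is_root g mu ->
    (forall h0, h0 \in a_zero H -> ev mu h0 = 0) -> ev mu t = 0).
Proof.
split=> [/centralizerP [ta tl]|[ta troot]].
  split=> // mu /andP [mu0 rg] muH.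
  have x0 : vpick (root_space mu :&: g) != 0 by rewrite vpick0.
  have /memv_capP [xm xg] := memv_pick (root_space mu :&: g).
  have xl : vpick (root_space mu :&: g) \in levi.
    rewrite -centralizer_azeroE; apply/centralizer_azeroP => j.
    have /root_spaceP -> // := xm; rewrite muH ?scale0r //.
    by rewrite memvE /a_zero; apply: (sumv_sup j) => //; exact: subvv.
  have := tl _ xl; rewrite lieC; have /root_spaceP -> // := xm => /eqP.
  by rewrite oppr_eq0 scaler_eq0 (negPf x0) orbF => /eqP.
apply/centralizerP; split=> // y; move: y.
apply: (weight_ind sa) => [|||mu x xl xm].
- exact: torus_stable.
- exact: lie0l.
- by move=> x y Ex Ey; rewrite lieDl Ex Ey addr0.
have [->|x0] := eqVneq x 0; first exact: lie0l.
rewrite lieC; have /root_spaceP -> // := xm.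
have [->|mu0] := eqVneq mu 0; first by rewrite ev0 scale0r oppr0.
have xH j : [lie H j, x] = 0.
  by move: j; apply/centralizer_azeroP; rewrite centralizer_azeroE.
have xg : x \in g by apply: (subvP (graded_part_sub _ _ _ _)) xl.
rewrite troot ?scale0r ?oppr0 //.
  rewrite /is_root mu0 /=; apply: contraNneq x0 => E.
  by rewrite -memv0 -E; apply/memv_capP.
move=> h0 /memv_sumP [u uH ->]; rewrite ev_sum big1 // => j _.
have /vlineP [c ->] := uH j isT; rewrite evZ.
have /eqP := xH j; have /root_spaceP -> // := xm.
by rewrite scaler_eq0 (negPf x0) orbF => /eqP ->; rewrite mulr0.
Qed.

Lemma split_component_is_split : is_split_component ap levi.
Proof.
split.
- apply/subvP => x /centralizerP [xa xl]; apply/centralizerP; split=> //.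
  exact: (subvP torus_levi).
- split; last by move=> x /(subvP split_component_torus); case: sa => _; apply.
  rewrite /abelian_lie -subv0; apply: brvP => x y.
  move=> /(subvP split_component_torus) xa /(subvP split_component_torus) ya.
  by rewrite (torus_comm sa) // mem0v.
(* An element of [A'] commutes with [a], which lies in the Levi part; being diagonalizable, it
   belongs to [a] by maximality. *)
move=> A' A'Z [_ dA']; apply/subvP => d dA; have [s us sd] := diagonalizable_split (dA' d dA).
have /centralizerP [dl dc] := subvP A'Z d dA; apply/centralizerP; split=> //.
apply: (torus_max ha) us sd => t /(subvP torus_levi) /dc E.
by rewrite lieC E oppr0.
Qed.

(** The parts [d] of [x] in Cartan's trick commute with whatever commutes with [x]; by maximality of
    [a] they lie in [ap]. So an [x] orthogonal to [ap] is nilpotent, hence 0. *)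
Lemma split_component_nondegenerate : nondegenerate_on ap.
Proof.
move=> x xap xo; have xa := subvP split_component_torus _ xap.
have [_ xl] := centralizerP _ _ _ xap.
have [t ut xt] := torus_split sa xa.
apply: (zero_weight_nilp ch0 ha nL).
  by apply/zero_weightP => t' ta; rewrite (torus_comm sa).
apply: (nilp_of_orthogonal_parts ch0 nL xt) => d _ dc [s us sd]; apply: xo.
apply/centralizerP; split.
  by apply: (torus_max ha) us sd => t' ta; apply: dc; rewrite (torus_comm sa).
by move=> y yl; rewrite lieC dc ?oppr0 // lieC xl ?oppr0.
Qed.

Lemma langlands_parabolic_part :
  langlands_decomposition (parabolic_part g h js) levi (perp levi ap) ap pos.
Proof.
have apl : (ap <= levi)%VS by apply: subv_trans torus_levi; exact: capvSl.
have [E D] := perp_add apl split_component_nondegenerate.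
have lE : levi = (perp levi ap + ap)%VS by rewrite addvC E.
split=> //.
- exact: (parabolic_nilpotent_radical ch0 g_subalgebra height_g ujs gjs g_nondegenerate).
- exact: (levi_is_levi ch0 g_subalgebra height_g ujs gjs g_nondegenerate).
- exact: split_component_is_split.
- by move=> x; split=> [/perpP|?]; [|apply/perpP].
rewrite directv_addE /= directv_addE /= !directv_trivial /= -lE.
by rewrite capvC D eqxx (levi_pos_cap ch0) eqxx.
Qed.
End Descent.

(** * Characteristic 0 of p-adic fields, and the final assembly *)

Lemma padic_natr_neq0 (p : nat) (Qp : fieldType) (v : Qp -> rat) :
  is_padic_field p v -> forall n, n.+1%:R != 0 :> Qp.
Proof.
move=> hQp n; rewrite -(pa_eq0 hQp) -ratr_nat (pa_rat hQp) /padic_norm pnatr_eq0 /=.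
by rewrite expfz_neq0 // pnatr_eq0 -lt0n (prime_gt0 (pa_prime hQp)).
Qed.

Theorem proposition4p2p2
  (p : nat) (Qp : fieldType) (v : Qp -> rat) (hQp : is_padic_field p v)
  (F : fieldExtType Qp) (hres : ~ residue_char v F 2)
  (Fbar : closedFieldType) (iota : {rmorphism F -> Fbar})
  (hFbar : is_algebraic_closure iota)
  (L : lieType F) (H0 : L)
  (hgraded : regular_graded iota H0) (hsimple : simple_lie L)
  (a : {vspace L}) (ha : maximal_split_abelian H0 a)
  (Pi : seq (dual a)) (hbase : is_base Pi)
  (hPi : forall nu, nu \in Pi -> ev nu H0 = 0 \/ ev nu H0 = 2)
  (k : nat) (lam : 'I_k.+1 -> dual a) (hlam : descent H0 Pi lam)
  (H : 'I_k.+1 -> L) (hH : forall j, is_coroot (lam j) (H j))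
  (Im Ip : L) (hdiag : diagonal_triple H0 lam H Im Ip) :
  let g : {vspace L} := grade H0 0 in
  let sigma : 'End(L) := involution_of Im Ip in
  let l : {vspace L} := centralizer g (a_zero H) in
  let n : {vspace L} := (\sum_(ij : 'I_k.+1 * 'I_k.+1 | (ij.1 < ij.2)%N)
                           E_space H ij.1 ij.2 1 (-1))%VS in
  let p_ : {vspace L} := (l + n)%VS in
  [/\ directv (l + \sum_(ij : 'I_k.+1 * 'I_k.+1 | (ij.1 < ij.2)%N)
                      E_space H ij.1 ij.2 1 (-1)),
      minimal_sigma_split iota sigma g p_
    & exists m1 ap : {vspace L},
        (forall h, h \in ap <->
           h \in a /\
           (forall mu : dual a, is_root g mu ->
              (forall h0, h0 \in a_zero H -> ev mu h0 = 0) -> ev mu h = 0)) /\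
        langlands_decomposition p_ l m1 ap n].
Proof.
have ch0 n : n.+1%:R != 0 :> F.
  by rewrite -(rmorph_nat (in_alg F)) fmorph_eq0; exact: padic_natr_neq0 hQp n.
have gs := rg_sum hgraded; have nL := simple_nondegenerate ch0 gs hsimple (rg_neq0 hgraded).
case: hdiag => -[_ _ + [X [Y [EX EY XY]]]]; rewrite {Ip}EX {Im}EY => H0YX.
have Ha j : H j \in a by case: (hH j).
have XE j : X j \in root_space (lam j) by case: (XY j).
have X0 j : X j != 0 by case: (XY j).
have YE j : Y j \in root_space (- lam j) by case: (XY j).
have T j : sl2_triple (Y j) (H j) (X j) by case: (XY j).
have [js ujs hjs] := exists_heights ch0 gs nL ha hlam Ha XE X0 YE T H0YX.
have lE := centralizer_azeroE ch0 gs nL ha hlam Ha XE X0 YE T H0YX hjs.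
have nE := pos_partE ch0 gs nL ha hlam Ha XE X0 YE T H0YX hjs.
have D := directv_levi_E ch0 gs nL ha hlam Ha XE X0 YE T H0YX hjs.
move=> g sigma l n p_; split=> //; rewrite /p_ /n /l lE nE.
  exact: (minimal_parabolic_part ch0 gs nL ha hbase hPi hlam Ha XE X0 YE T H0YX ujs hjs iota).
exists (perp (levi_part g (height_element H) js) (split_component H0 a H js)).
exists (split_component H0 a H js); split.
  exact: (split_componentP ch0 gs nL ha hlam Ha XE X0 YE T H0YX hjs).
exact: (langlands_parabolic_part ch0 gs nL ha Ha ujs hjs).
Qed.
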